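(* For given $A\in\mathbb{R}^{m\times n}$, $b\in\mathbb{R}^m$, $c\in\mathbb{R}^n$ (with $A$ of full row rank, $n\ge3$, and the linear matroid of the columns of $A$ non-separable), and an initial feasible solution $w^0=(x^0,y^0,s^0)\in\mathcal N(1/8)$, the algorithm $\textsc{LP-Solve}(A,b,c,w^0)$ described in the context finds an optimal solution to the primal-dual pair \[ \min\{c^\top x: Ax=b,\ x\ge0\},\qquad \max\{b^\top y: A^\top y+s=c,\ s\ge 0\} \] in $O(n^{2.5}\log n\,\log(\bar\chi^*_A+n))$ iterations.
   Context: **Notation.** $W=\ker(A)\subseteq\mathbb{R}^n$, so $W^\perp=\mathrm{range}(A^\top)$. Products, quotients and powers of vectors in $\mathbb{R}^n$ are componentwise; $e$ is the all-ones vector; $e^i$ are unit vectors; $\mathrm{Diag}(v)$ is the diagonal matrix with diagonal $v$; $\|\cdot\|$ is the Euclidean (operator) norm; $\pi_I(x)=x_I$ is coordinate projection. $\mathbf D$ is the set of positive $n\times n$ diagonal matrices. **Condition number.** $\bar\chi_A=\sup\{\|A^\top(ADA^\top)^{-1}AD\|:D\in\mathbf D\}$ and $\bar\chi^*_A=\inf\{\bar\chi_{AD}:D\in\mathbf D\}$. **Neighborhood.** $\mathcal P^{++}=\{x:Ax=b,x>0\}$, $\mathcal D^{++}=\{(y,s):A^\top y+s=c,s>0\}$. For $w=(x,y,s)$, $\mu(w)=x^\top s/n$, and $\mathcal N(\beta)=\{w\in\mathcal P^{++}\times\mathcal D^{++}:\|xs/\mu(w)-e\|\le\beta\}$. Throughout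 $\beta=1/8$ and $\gamma=\beta/(2^{10}n^5)$. For $w\in\mathcal P^{++}\times\mathcal D^{++}$, $\delta(w)=s^{1/2}x^{-1/2}$. **Circuits.** A circuit is an inclusion-wise minimal linearly dependent set $C\subseteq[n]$ of columns of $A$; to it belongs a vector $g^C\in W$ with $\mathrm{supp}(g^C)=C$, unique up to scaling. $\kappa_{ij}=\max\{|g^C_j/g^C_i|: C\text{ a circuit},\ i,j\in C\}$. The matroid is non-separable if every two $i\ne j$ lie in a common circuit. For estimates $\hat\kappa_{ij}$ and $\delta\in\mathbb{R}^n_{++}$ put $\hat\kappa^\delta_{ij}=\hat\kappa_{ij}\delta_j/\delta_i$, $\kappa^\delta_{ij}=\kappa_{ij}\delta_j/\delta_i$. $\hat G_{\delta,\sigma}=([n],\hat E_{\delta,\sigma})$ is the digraph with edges $(i,j)$ such that $\hat\kappa^\delta_{ij}\ge\sigma$. **Search directions at $w$.** The affine scaling direction $\Delta w^{\mathrm a}=(\Delta x^{\mathrm a},\Delta y^{\mathrm a},\Delta s^{\mathrm a})$ solves $A\Delta x=0$, $A^\top\Delta y+\Delta s=0$, $s\Delta x+x\Delta s=-xs$. The centrality direction $\Delta w^{\mathrm c}$ solves the same system with last equation $s\Delta x+x\Delta s=\mu(w)e-xs$. For a layering (ordered partition) $\mathcal J=(J_1,\dots,J_p)$ of $[n]$, with $J_{<k}=\bigcup_{l<k}J_l$, $J_{>k}=\bigcup_{l>k}J_l$ (similarly $J_{\ge k}$), and $\delta=\delta(w)$, the layered least squares (LLS) direction $\Delta w^{\mathrm{ll}}=(\Delta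 x^{\mathrm{ll}},\Delta y^{\mathrm{ll}},\Delta s^{\mathrm{ll}})$ is: for $k=p,\dots,1$, $\Delta x^{\mathrm{ll}}_{J_k}$ is the $J_k$-projection of any minimizer of $\|\delta_{J_k}(x_{J_k}+\Delta x_{J_k})\|$ over $\Delta x\in W$ with $\Delta x_{J_{>k}}=\Delta x^{\mathrm{ll}}_{J_{>k}}$; for $k=1,\dots,p$, $\Delta s^{\mathrm{ll}}_{J_k}$ is the $J_k$-projection of any minimizer of $\|\delta_{J_k}^{-1}(s_{J_k}+\Delta s_{J_k})\|$ over $\Delta s\in W^\perp$ with $\Delta s_{J_{<k}}=\Delta s^{\mathrm{ll}}_{J_{<k}}$; and $A^\top\Delta y^{\mathrm{ll}}=-\Delta s^{\mathrm{ll}}$. Residuals of a direction $(\Delta x,\Delta y,\Delta s)$ are $\mathit{Rx}=\delta(x+\Delta x)/\sqrt{\mu(w)}$, $\mathit{Rs}=\delta^{-1}(s+\Delta s)/\sqrt{\mu(w)}$; $\epsilon^{\mathrm a}(w)=\max_{i}\min\{|\mathit{Rx}^{\mathrm a}_i|,|\mathit{Rs}^{\mathrm a}_i|\}$ and $\epsilon^{\mathrm{ll}}(w)$ is defined in the same way from the LLS residuals. **Subroutine $\textsc{Verify-Lift}(U,I,\theta)$** ($U\subseteq\mathbb{R}^n$ a subspace, $I\subseteq[n]$, $\theta>0$). Choose a minimal $I'\subseteq I$ with $\dim\pi_{I'}(U)=\dim\pi_I(U)$ (so $\pi_{I'}(U)=\mathbb{R}^{I'}$). Let $B\in\mathbb{R}^{([n]\setminus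 I)\times I'}$ be the matrix sending $q\in\mathbb{R}^{I'}$ to $z_{[n]\setminus I}$, where $z$ is the minimum-norm vector of $U$ with $z_{I'}=q$. If $n\max_{j,i}|B_{ji}|\le\theta$ (or $B$ is empty), answer `pass'; otherwise answer `fail' and return a pair $i\in I$, $j\in[n]\setminus I$ maximizing $|B_{ji}|$, with $t=|B_{ji}|$. **Subroutine $\textsc{Layering}(\delta,\hat\kappa)$.** Compute the strongly connected components $C_1,\dots,C_\ell$ of $\hat G_{\delta,\gamma/n}$, in the linear order in which $(u,v)\in\hat E_{\delta,\gamma/n}$ whenever $u\in C_i,v\in C_j,i<j$. Set $\bar E=\hat E_{\delta,\gamma/n}$. For $k=2,\dots,\ell$: call $\textsc{Verify-Lift}(\mathrm{Diag}(\delta)W,C_{\ge k},\gamma)$; if it answers `fail' with $(i,j,t)$, set $\hat\kappa_{ij}\leftarrow t\delta_i/\delta_j$ and add $(i,j)$ to $\bar E$. Return the strongly connected components $J_1,\dots,J_p$ of $([n],\bar E)$, in the induced order, and the updated $\hat\kappa$. **Algorithm $\textsc{LP-Solve}(A,b,c,w^0)$.** Initially, compute a family of circuits such that every pair $i\ne j$ lies in a common circuit of the family, and let $\hat\kappa_{ij}$ be the maximum of $|g^C_j/g^C_i|$ over circuits $C\ni i,j$ of the family. For $k=0,1,2,\dots$ perform the following iteration at $w=w^k$: (1) Compute $\Delta w^{\mathrm a}$ at $w^k$. If $\epsilon^{\mathrm a}(w^k)<10n^{3/2}\gamma$: let $\delta=\delta(w^k)$, $(\mathcal J,\hat\kappa)\leftarrow\textsc{Layering}(\delta,\hat\kappa)$,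 $\Delta w=\Delta w^{\mathrm{ll}}$ for $\mathcal J$, and $\alpha=1-24\sqrt n\,\epsilon^{\mathrm{ll}}(w^k)$. Otherwise, $\Delta w=\Delta w^{\mathrm a}$ and $\alpha=\max\{1/(8\sqrt n),\,1-8\|\Delta x^{\mathrm a}\Delta s^{\mathrm a}\|/\mu(w^k)\}$. (2) $w'=w^k+\alpha\Delta w$. If $\mu(w')=0$, terminate and return $w'$. (3) Compute the centrality direction $\Delta w^{\mathrm c}$ at $w'$ and set $w^{k+1}=w'+\Delta w^{\mathrm c}$. *)

(* Defs.v *)
From HB Require Import structures.
From mathcomp Require Import all_boot all_order all_algebra.
From mathcomp Require Import classical_sets reals exp.

Set Implicit Arguments.
Unset Strict Implicit.
Unset Printing Implicit Defensive.

Import Order.TTheory GRing.Theory Num.Theory.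
Local Open Scope ring_scope.

(** * Vectors *)

Definition cmul (R : realType) (n : nat) (u v : 'cV[R]_n) : 'cV[R]_n :=
  \col_i (u i 0 * v i 0).

Definition cinv (R : realType) (n : nat) (u : 'cV[R]_n) : 'cV[R]_n :=
  \col_i (u i 0)^-1.

Definition dot (R : realType) (n : nat) (u v : 'cV[R]_n) : R :=
  \sum_i u i 0 * v i 0.

Definition norm2 (R : realType) (n : nat) (v : 'cV[R]_n) : R :=
  Num.sqrt (\sum_i v i 0 ^+ 2).

(* The projection x |-> x_I.  R^I is embedded in R^n: coordinates outside I
   are set to 0, so that [coordproj I *m x = coordproj I *m y] says x_I = y_I
   and [norm2 (coordproj I *m x)] is the norm of x_I. *)
Definition coordproj (R : realType) (n : nat) (I : {set 'I_n}) : 'M[R]_n :=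
  diag_mx (\row_i (i \in I)%:R).

(** * The subspaces W and its orthogonal complement; circuits *)

Definition kerspace (R : realType) (m n : nat) (A : 'M[R]_(m, n)) :
    {vspace 'cV[R]_n} :=
  lker (linfun (mulmx A : 'cV[R]_n -> 'cV[R]_m)).

Definition rangespace (R : realType) (m n : nat) (A : 'M[R]_(m, n)) :
    {vspace 'cV[R]_m} :=
  limg (linfun (mulmx A : 'cV[R]_n -> 'cV[R]_m)).

Definition mximage (R : realType) (n : nat) (M : 'M[R]_n)
    (U : {vspace 'cV[R]_n}) : {vspace 'cV[R]_n} :=
  (linfun (mulmx M : 'cV[R]_n -> 'cV[R]_n) @: U)%VS.

Definition circuit (R : realType) (m n : nat) (A : 'M[R]_(m, n))
    (C : {set 'I_n}) : bool :=
  minset (fun S : {set 'I_n} => ~~ free [seq col j A | j in S]) C.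

Definition circuit_vector (R : realType) (m n : nat) (A : 'M[R]_(m, n))
    (C : {set 'I_n}) (g : 'cV[R]_n) : Prop :=
  g \in kerspace A /\ [set i | g i 0 != 0] = C.

Definition nonseparable (R : realType) (m n : nat) (A : 'M[R]_(m, n)) : Prop :=
  forall i j : 'I_n, i != j ->
    exists C : {set 'I_n}, [/\ circuit A C, i \in C & j \in C].

(** * Condition numbers *)

Definition opnorm (R : realType) (n : nat) (M : 'M[R]_n) : R :=
  sup [set norm2 (M *m v) | v in [set v : 'cV[R]_n | norm2 v <= 1]]%classic.

Definition posdiag (R : realType) (n : nat) : set 'M[R]_n :=
  [set diag_mx d | d in [set d : 'rV[R]_n | forall i, 0 < d 0 i]]%classic.

(* The set below is bounded for every A of full row rank (a theorem of Dikin,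
   Stewart and Todd), so the real-valued [sup] is the genuine supremum. *)
Definition chibar (R : realType) (m n : nat) (A : 'M[R]_(m, n)) : R :=
  sup [set opnorm (A^T *m invmx (A *m D *m A^T) *m A *m D)
      | D in @posdiag R n]%classic.

Definition chibar_star (R : realType) (m n : nat) (A : 'M[R]_(m, n)) : R :=
  inf [set chibar (A *m D) | D in @posdiag R n]%classic.

(** * Primal-dual points, feasibility, optimality, central path neighborhood *)

(* (x, y, s); also used for directions.  Sums and scalings are those of the
   product module. *)
Notation pdpoint R m n := ('cV[R]_n * 'cV[R]_m * 'cV[R]_n)%type.

Notation xpart w := (w.1.1) (only parsing).
Notation ypart w := (w.1.2) (only parsing).
Notation spart w := (w.2) (only parsing).

Definition primal_feasible (R : realType) (m n : nat) (A : 'M[R]_(m, n))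
    (b : 'cV[R]_m) (x : 'cV[R]_n) : Prop :=
  A *m x = b /\ forall i, 0 <= x i 0.

Definition dual_feasible (R : realType) (m n : nat) (A : 'M[R]_(m, n))
    (c : 'cV[R]_n) (y : 'cV[R]_m) (s : 'cV[R]_n) : Prop :=
  A^T *m y + s = c /\ forall i, 0 <= s i 0.

Definition optimal (R : realType) (m n : nat) (A : 'M[R]_(m, n))
    (b : 'cV[R]_m) (c : 'cV[R]_n) (w : pdpoint R m n) : Prop :=
  [/\ primal_feasible A b (xpart w),
      forall x, primal_feasible A b x -> dot c (xpart w) <= dot c x,
      dual_feasible A c (ypart w) (spart w)
    & forall y s, dual_feasible A c y s -> dot b y <= dot b (ypart w)].

Definition strictly_feasible (R : realType) (m n : nat) (A : 'M[R]_(m, n))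
    (b : 'cV[R]_m) (c : 'cV[R]_n) (w : pdpoint R m n) : Prop :=
  [/\ A *m xpart w = b, forall i, 0 < xpart w i 0,
      A^T *m ypart w + spart w = c & forall i, 0 < spart w i 0].

Definition mu (R : realType) (m n : nat) (w : pdpoint R m n) : R :=
  dot (xpart w) (spart w) / n%:R.

Definition neighborhood (R : realType) (m n : nat) (A : 'M[R]_(m, n))
    (b : 'cV[R]_m) (c : 'cV[R]_n) (beta : R) (w : pdpoint R m n) : Prop :=
  strictly_feasible A b c w /\
  norm2 ((mu w)^-1 *: cmul (xpart w) (spart w) - const_mx 1) <= beta.

Definition beta0 (R : realType) : R := 1 / 8.

Definition gamma (R : realType) (n : nat) : R :=
  beta0 R / (2 ^+ 10 * n%:R ^+ 5).

Definition delta (R : realType) (m n : nat) (w : pdpoint R m n) : 'cV[R]_n :=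
  \col_i (Num.sqrt (spart w i 0) / Num.sqrt (xpart w i 0)).

(** * Search directions *)

Definition affine_direction (R : realType) (m n : nat) (A : 'M[R]_(m, n))
    (w d : pdpoint R m n) : Prop :=
  [/\ A *m xpart d = 0, A^T *m ypart d + spart d = 0
    & cmul (spart w) (xpart d) + cmul (xpart w) (spart d)
      = - cmul (xpart w) (spart w)].

Definition centrality_direction (R : realType) (m n : nat) (A : 'M[R]_(m, n))
    (w d : pdpoint R m n) : Prop :=
  [/\ A *m xpart d = 0, A^T *m ypart d + spart d = 0
    & cmul (spart w) (xpart d) + cmul (xpart w) (spart d)
      = mu w *: const_mx 1 - cmul (xpart w) (spart w)].

(* [d] minimizes |rho_J (v_J + d_J)| among the vectors of [U] that agree with
   [d0] on the coordinates in [F]. *)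
Definition layer_minimizer (R : realType) (n : nat) (U : {vspace 'cV[R]_n})
    (rho v d0 : 'cV[R]_n) (J F : {set 'I_n}) (d : 'cV[R]_n) : Prop :=
  let admissible e := e \in U /\ coordproj R F *m e = coordproj R F *m d0 in
  admissible d /\
  forall e, admissible e ->
    norm2 (coordproj R J *m cmul rho (v + d))
      <= norm2 (coordproj R J *m cmul rho (v + e)).

(* Layers are numbered from 0 in the list [J]. *)
Definition layer (n : nat) (J : seq {set 'I_n}) (k : nat) : {set 'I_n} :=
  nth finset.set0 J k.
Definition layers_lt (n : nat) (J : seq {set 'I_n}) (k : nat) : {set 'I_n} :=
  \bigcup_(C <- take k J) C.
Definition layers_ge (n : nat) (J : seq {set 'I_n}) (k : nat) : {set 'I_n} :=
  \bigcup_(C <- drop k J) C.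
Definition layers_gt (n : nat) (J : seq {set 'I_n}) (k : nat) : {set 'I_n} :=
  layers_ge J k.+1.

(* The constraint of stage k involves [xpart d] only on J_{>k} (resp.
   [spart d] on J_{<k}), so the conditions for all k express the recursion. *)
Definition lls_direction (R : realType) (m n : nat) (A : 'M[R]_(m, n))
    (J : seq {set 'I_n}) (w d : pdpoint R m n) : Prop :=
  [/\ forall k : nat, (k < size J)%N ->
        exists2 dx : 'cV[R]_n,
          layer_minimizer (kerspace A) (delta w) (xpart w) (xpart d)
            (layer J k) (layers_gt J k) dx
        & coordproj R (layer J k) *m xpart d = coordproj R (layer J k) *m dx,
      forall k : nat, (k < size J)%N ->
        exists2 ds : 'cV[R]_n,
          layer_minimizer (rangespace A^T) (cinv (delta w)) (spart w) (spart d)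
            (layer J k) (layers_lt J k) ds
        & coordproj R (layer J k) *m spart d = coordproj R (layer J k) *m ds
    & A^T *m ypart d = - spart d].

Definition residual_x (R : realType) (m n : nat) (w d : pdpoint R m n) :
    'cV[R]_n :=
  (Num.sqrt (mu w))^-1 *: cmul (delta w) (xpart w + xpart d).

Definition residual_s (R : realType) (m n : nat) (w d : pdpoint R m n) :
    'cV[R]_n :=
  (Num.sqrt (mu w))^-1 *: cmul (cinv (delta w)) (spart w + spart d).

Definition epsilon (R : realType) (m n : nat) (w d : pdpoint R m n) : R :=
  \big[Num.max/0]_(i < n)
     Num.min `|residual_x w d i 0| `|residual_s w d i 0|.

(** * Verify-Lift *)

Definition min_norm_lift (R : realType) (n : nat) (U : {vspace 'cV[R]_n})
    (I : {set 'I_n}) (q z : 'cV[R]_n) : Prop :=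
  let lift_of_q v := v \in U /\ coordproj R I *m v = coordproj R I *m q in
  lift_of_q z /\ forall v, lift_of_q v -> norm2 z <= norm2 v.

(* Only the entries [B j i] with [j \notin I] and [i \in I'] are meaningful. *)
Definition lift_matrix (R : realType) (n : nat) (U : {vspace 'cV[R]_n})
    (I I' : {set 'I_n}) (B : 'M[R]_n) : Prop :=
  forall q z : 'cV[R]_n, min_norm_lift U I' q z ->
    forall j, j \notin I -> z j 0 = \sum_(i in I') B j i * q i 0.

Definition lift_max (R : realType) (n : nat) (I I' : {set 'I_n})
    (B : 'M[R]_n) : R :=
  \big[Num.max/0]_(j in ~: I) \big[Num.max/0]_(i in I') `|B j i|.

Definition full_dim_subset (R : realType) (n : nat) (U : {vspace 'cV[R]_n})
    (I I' : {set 'I_n}) : bool :=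
  (I' \subset I) &&
  (\dim (mximage (coordproj R I') U) == \dim (mximage (coordproj R I) U)).

(* [None] is the answer `pass', [Some (i, j, t)] the answer `fail'. *)
Definition verify_lift (R : realType) (n : nat) (U : {vspace 'cV[R]_n})
    (I : {set 'I_n}) (theta : R) (res : option ('I_n * 'I_n * R)) : Prop :=
  exists (I' : {set 'I_n}) (B : 'M[R]_n),
    [/\ minset (full_dim_subset U I) I',
        lift_matrix U I I' B
      & match res with
        | None => n%:R * lift_max I I' B <= theta
        | Some (i, j, t) =>
            [/\ theta < n%:R * lift_max I I' B, i \in I', j \notin I,
                `|B j i| = lift_max I I' B & t = `|B j i|]
        end].

(** * Layering *)

Definition edge_set (R : realType) (n : nat) (kh : 'M[R]_n) (d : 'cV[R]_n)
    (sigma : R) : {set 'I_n * 'I_n} :=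
  [set e | sigma <= kh e.1 e.2 * d e.2 0 / d e.1 0].

Definition strong_components (n : nat) (E : {set 'I_n * 'I_n}) :
    {set {set 'I_n}} :=
  let e := fun u v : 'I_n => (u, v) \in E in
  equivalence_partition (fun u v => connect e u v && connect e v u)
    [set: 'I_n].

Definition enumerates (T : finType) (s : seq T) (S : {set T}) : bool :=
  perm_eq s (enum S).

Definition position (n : nat) (Cs : seq {set 'I_n}) (u : 'I_n) : nat :=
  find (fun C : {set 'I_n} => u \in C) Cs.

Definition update_mx (R : realType) (n : nat) (M : 'M[R]_n) (i j : 'I_n)
    (a : R) : 'M[R]_n :=
  \matrix_(u, v) (if (u == i) && (v == j) then a else M u v).

(* The loop of Layering over the indices [ks], relating the values of the
   estimates and of the edge set before and after. *)
Fixpoint layering_loop (R : realType) (n : nat) (U : {vspace 'cV[R]_n})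
    (d : 'cV[R]_n) (Cs : seq {set 'I_n}) (ks : seq nat)
    (kh : 'M[R]_n) (E : {set 'I_n * 'I_n})
    (kh' : 'M[R]_n) (E' : {set 'I_n * 'I_n}) : Prop :=
  match ks with
  | [::] => kh' = kh /\ E' = E
  | k :: ks' =>
      exists2 res, verify_lift U (layers_ge Cs k) (gamma R n) res &
      match res with
      | None => layering_loop U d Cs ks' kh E kh' E'
      | Some (i, j, t) =>
          layering_loop U d Cs ks' (update_mx kh i j (t * d i 0 / d j 0))
            ((i, j) |: E) kh' E'
      end
  end.

(* [(J, kh')] is a possible output on input [(d, kh)].  The first component
   of the list, for which Verify-Lift is not called, has index 0. *)
Definition layering (R : realType) (m n : nat) (A : 'M[R]_(m, n))
    (d : 'cV[R]_n) (kh : 'M[R]_n)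
    (out : seq {set 'I_n} * 'M[R]_n) : Prop :=
  let: (J, kh') := out in
  let E0 := edge_set kh d (gamma R n / n%:R) in
  exists (Cs : seq {set 'I_n}) (E : {set 'I_n * 'I_n}),
    [/\ enumerates Cs (strong_components E0),
        forall u v, (position Cs u < position Cs v)%N -> (u, v) \in E0,
        layering_loop (mximage (diag_mx d^T) (kerspace A)) d Cs
          (iota 1 (size Cs).-1) kh E0 kh' E,
        enumerates J (strong_components E)
      & forall u v, (position J u < position J v)%N ->
          (position Cs u < position Cs v)%N].

(** * LP-Solve *)

Definition initial_estimates (R : realType) (m n : nat) (A : 'M[R]_(m, n))
    (kh : 'M[R]_n) : Prop :=
  exists (F : {set {set 'I_n}}) (g : {set 'I_n} -> 'cV[R]_n),
    [/\ forall C, C \in F -> circuit A C /\ circuit_vector A C (g C),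
        forall i j : 'I_n, i != j ->
          exists C, [/\ C \in F, i \in C & j \in C]
      & forall i j : 'I_n,
          kh i j = \big[Num.max/0]_(C in F | (i \in C) && (j \in C))
                      `|g C j 0 / g C i 0|].

(* Programs are given by their total-correctness semantics.  [choose P k] is
   the program "take any x such that P x, then continue with k": such an x
   has to exist, and the continuation has to be correct for every choice. *)
Definition choose (T : Type) (P : T -> Prop) (k : T -> Prop) : Prop :=
  (exists x, P x) /\ forall x, P x -> k x.

(* One iteration at the iterate [w] with estimates [kh].  The point returned
   upon termination must satisfy [ret]; otherwise the next iterate and
   estimates must satisfy [next]. *)
Definition iteration (R : realType) (m n : nat) (A : 'M[R]_(m, n))
    (w : pdpoint R m n) (kh : 'M[R]_n)
    (ret : pdpoint R m n -> Prop)
    (next : pdpoint R m n -> 'M[R]_n -> Prop) : Prop :=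
  let move (d : pdpoint R m n) (alpha : R) (kh' : 'M[R]_n) : Prop :=
    let w' := w + alpha *: d in
    if mu w' == 0 then ret w'
    else choose (centrality_direction A w')
           (fun dc => next (w' + dc) kh') in
  choose (affine_direction A w) (fun da =>
    if epsilon w da < 10 * (n%:R `^ (3 / 2)) * gamma R n then
      choose (layering A (delta w) kh) (fun Jkh : seq {set 'I_n} * 'M[R]_n =>
      choose (lls_direction A Jkh.1 w) (fun dll =>
        move dll (1 - 24 * Num.sqrt n%:R * epsilon w dll) Jkh.2))
    else
      move da (Num.max (1 / (8 * Num.sqrt n%:R))
                 (1 - 8 * norm2 (cmul (xpart da) (spart da)) / mu w)) kh).

(* Started at [w] and [kh], every run terminates within [N] iterations and
   returns an optimal solution. *)
Fixpoint finds_optimum_from (R : realType) (m n : nat) (A : 'M[R]_(m, n))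
    (b : 'cV[R]_m) (c : 'cV[R]_n) (N : nat)
    (w : pdpoint R m n) (kh : 'M[R]_n) : Prop :=
  match N with
  | 0%N => False
  | N'.+1 =>
      iteration A w kh (optimal A b c) (finds_optimum_from A b c N')
  end.

Definition lp_solve_finds_optimum (R : realType) (m n : nat)
    (A : 'M[R]_(m, n)) (b : 'cV[R]_m) (c : 'cV[R]_n)
    (w0 : pdpoint R m n) (N : nat) : Prop :=
  choose (initial_estimates A) (finds_optimum_from A b c N w0).

(* Main.v *)
Require Import Defs.
From mathcomp Require Import all_boot all_order all_algebra.
From mathcomp Require Import classical_sets reals exp.
From mathcomp Require Import boolp.
From mathcomp Require Import zify ring lra.

(** Every iteration stays near the central path and multiplies the duality
    measure mu by at most 1 - 1 / (8 sqrt n) ([predictor_step],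
    [corrector_step], [affine_step], [lls_step]). That alone bounds nothing in
    terms of A only. The bound comes from the circuit imbalances of A. Let
    kap i j be the largest |g_j / g_i| over the circuit vectors g. These numbers
    are submultiplicative, kap i k <= kap i j * kap j k ([kap_triangle]), and
    after one fixed positive rescaling of the columns all of them are at most
    chibar_star A + 1 ([balancing_weights]). At a point w = (x, y, s) the pair
    (i, j) has the [weight] kap i j * x_i * s_j / mu, which is its imbalance in
    the local metric delta(w), up to a constant.

    Each iteration yields a pinned pair (i, j) in a set S of indices
    ([pinned_pair], [iteration_progress]): x_i and s_j keep their order of
    magnitude at all later points, the product kap i j * x_i * s_j is at least
    the new mu, and the weights of (i, l) and (l, j) for l in S are at present
    at most M^|S|; all this up to powers of a number M that is polynomial in n
    and chibar_star A. The reason is as follows. Layering returns layers between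
    which the rescaled kernel almost splits, while inside a layer every
    imbalance is at most a power of M ([layering_spec], [k_layer]). Hence the
    residuals p and q of the layered step are close to those of the affine
    scaling step, which add up to a vector near 1 ([lls_closeness]), so that
    each index has a large residual. A primal residual p_i forces, at every
    later point, some primal variable in the layer of i to keep at least the
    order of p_i ([layered_pin], [uniform_pin]). If a layer contains large
    primal and large dual residuals, this pins a pair at once
    ([event_same_layer]). Otherwise let eps be the largest of the small
    residuals, attained, say, by a primal one. The new mu is about eps, and the
    layer of eps contains small primal residuals only, which bound its later
    primal variables by a multiple of eps from above. So a primal variable is
    pinned at the order eps and a dual one at the order 1
    ([event_pure_layer]), unless this layer feels a later layer with large
    primal residuals; that takes an imbalance of order eps between the two, and
    this imbalance then makes up for the decrease of mu ([event_crossover]).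

    A pinned pair is rewarding ([pinned_gain]). When mu has decreased by another
    factor M^(8|S|), the weight of (i, j) exceeds M^(7|S|); by the triangle
    inequality one of the pairs (i, l) and (l, j) then has weight at least
    M^(2|S|), for every l in S, and pinning makes this permanent. So the number
    of triples (u, v, e) such that (u, v) has weight at least M^(2^e) from now
    on grows by |S| - 1 within O(|S| sqrt n log M) iterations. There are
    O(n^2 log n) triples, and log M = O(log (chibar_star A + n)), whence the
    bound ([finds_from_potential], [iteration_count]). *)

Set Implicit Arguments.
Unset Strict Implicit.
Unset Printing Implicit Defensive.

Import Order.TTheory GRing.Theory Num.Theory.
Local Open Scope ring_scope.
Local Notation subsetP := fintype.subsetP.
Local Notation subset_trans := fintype.subset_trans.

(** * Inner products and orthogonal complements *)

Section InnerProduct.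
Context {R : realType} {n : nat}.
Implicit Types (u v w d : 'cV[R]_n) (U : {vspace 'cV[R]_n}).

Lemma dotC u v : dot u v = dot v u.
Proof. by apply: eq_bigr => i _; rewrite mulrC. Qed.

Lemma dotDl u v w : dot (u + v) w = dot u w + dot v w.
Proof. by rewrite /dot -big_split; apply: eq_bigr => i _; rewrite mxE mulrDl. Qed.

Lemma dotDr u v w : dot u (v + w) = dot u v + dot u w.
Proof. by rewrite dotC dotDl !(dotC u). Qed.

Lemma dotZl a u v : dot (a *: u) v = a * dot u v.
Proof. by rewrite /dot mulr_sumr; apply: eq_bigr => i _; rewrite mxE mulrA. Qed.

Lemma dotZr a u v : dot u (a *: v) = a * dot u v.
Proof. by rewrite dotC dotZl dotC. Qed.

Lemma dotNl u v : dot (- u) v = - dot u v.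
Proof. by rewrite -scaleN1r dotZl mulN1r. Qed.

Lemma dotNr u v : dot u (- v) = - dot u v.
Proof. by rewrite dotC dotNl dotC. Qed.

Lemma dotBl u v w : dot (u - v) w = dot u w - dot v w.
Proof. by rewrite dotDl dotNl. Qed.

Lemma dotBr u v w : dot u (v - w) = dot u v - dot u w.
Proof. by rewrite dotDr dotNr. Qed.

Lemma dot0l u : dot 0 u = 0.
Proof. by rewrite -(scale0r 0) dotZl mul0r. Qed.

Lemma dot_suml (I : Type) (r : seq I) (F : I -> 'cV[R]_n) v :
  dot (\sum_(i <- r) F i) v = \sum_(i <- r) dot (F i) v.
Proof.
elim: r => [|i r IH]; first by rewrite !big_nil dot0l.
by rewrite !big_cons dotDl IH.
Qed.

Lemma dot_ge0 v : 0 <= dot v v.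
Proof. by apply: sumr_ge0 => i _; rewrite -expr2 sqr_ge0. Qed.

Lemma dot_eq0 v : dot v v = 0 -> v = 0.
Proof.
move=> /eqP; rewrite psumr_eq0 => [/allP vv0|i _]; last by rewrite -expr2 sqr_ge0.
apply/matrixP => i j; rewrite ord1 mxE; apply/eqP.
by have /implyP/(_ isT) := vv0 i (mem_index_enum i); rewrite mulf_eq0 orbb.
Qed.

Definition orthv U : {vspace 'cV[R]_n} :=
  lker (linfun (mulmx (\matrix_(i < \dim U, j < n) (vbasis U)`_i j 0)
                : 'cV[R]_n -> 'cV[R]_(\dim U))).

Lemma mem_orthv U v : reflect (forall u, u \in U -> dot v u = 0) (v \in orthv U).
Proof.
rewrite memv_ker lfunE /=; apply: (iffP eqP) => [v0 u uU|vU].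
  rewrite (coord_vbasis uU) dotC dot_suml big1 // => i _; rewrite dotZl.
  have /matrixP/(_ i 0) := v0; rewrite !mxE => e0.
  rewrite -[X in _ * X](_ : 0 = _) ?mulr0 // -e0.
  by apply: eq_bigr => j _; rewrite mxE.
apply/matrixP => i j; rewrite ord1 !mxE.
have bU : (vbasis U)`_i \in U by rewrite vbasis_mem ?mem_nth ?size_tuple.
rewrite -[RHS](vU _ bU).
by apply: eq_bigr => k _; rewrite !mxE mulrC.
Qed.

Lemma orthv_decomp U v : exists2 u, u \in U & v - u \in orthv U.
Proof.
suff /memv_addP [u uU [w wU ->]] : v \in (U + orthv U)%VS.
  by exists u => //; rewrite addrC addKr.
suff -> : (U + orthv U)%VS = fullv by rewrite memvf.
apply/eqP; rewrite -(dimv_leqif_eq (subvf _)) eqn_leq dimvS ?subvf //=.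
rewrite dimv_disjoint_sum; last first.
  apply/eqP; rewrite -subv0; apply/subvP => z /memv_capP[zU /mem_orthv zO].
  by rewrite memv0; apply/eqP; apply: dot_eq0; apply: zO.
set f := linfun (mulmx (\matrix_(i < \dim U, j < n) (vbasis U)`_i j 0)
                : 'cV[R]_n -> 'cV[R]_(\dim U)).
have <- : (\dim (orthv U) + \dim (limg f))%N = \dim {: 'cV[R]_n}.
  by rewrite -(limg_ker_dim f fullv) capfv.
by rewrite addnC leq_add2r (leq_trans (dimvS (subvf _))) // dimvf /dim /= muln1.
Qed.

Lemma orthvK U : orthv (orthv U) = U.
Proof.
apply/eqP; rewrite eqEsubv; apply/andP; split; apply/subvP => v.
  have [u uU wU] := orthv_decomp U v => /mem_orthv vO.
  suff /dot_eq0/eqP : dot (v - u) (v - u) = 0 by rewrite subr_eq0 => /eqP ->.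
  rewrite dotBl vO // (dotC u); move/mem_orthv: wU => /(_ _ uU) ->.
  by rewrite subrr.
by move=> vU; apply/mem_orthv => w /mem_orthv wU; rewrite dotC wU.
Qed.

Lemma cmulE u v i : cmul u v i 0 = u i 0 * v i 0.
Proof. by rewrite mxE. Qed.

Lemma dot_cmul u v w : dot (cmul u v) w = dot v (cmul u w).
Proof. by apply: eq_bigr => i _; rewrite !mxE; ring. Qed.

Definition scalev d U := mximage (diag_mx d^T) U.

Lemma mul_diag_cmul d v : diag_mx d^T *m v = cmul d v.
Proof. by apply/matrixP => i j; rewrite ord1 mul_diag_mx !mxE. Qed.

Lemma mem_scalevP d U v : reflect (exists2 u, u \in U & v = cmul d u) (v \in scalev d U).
Proof.
apply: (iffP memv_imgP) => [] [u uU ->]; exists u => //;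
  by rewrite lfunE /= mul_diag_cmul.
Qed.

Lemma scalev_cmul d U u : u \in U -> cmul d u \in scalev d U.
Proof. by move=> uU; apply/mem_scalevP; exists u. Qed.

Lemma cinvK d v : (forall i, 0 < d i 0) -> cmul d (cmul (cinv d) v) = v.
Proof.
move=> d0; apply/matrixP => i j; rewrite ord1 !mxE mulrA mulfV ?mul1r //.
by rewrite gt_eqF.
Qed.

Lemma cinvKV d v : (forall i, 0 < d i 0) -> cmul (cinv d) (cmul d v) = v.
Proof.
move=> d0; apply/matrixP => i j; rewrite ord1 !mxE mulrA mulVf ?mul1r //.
by rewrite gt_eqF.
Qed.

Lemma cinv_gt0 d : (forall i, 0 < d i 0) -> forall i, 0 < cinv d i 0.
Proof. by move=> d0 i; rewrite mxE invr_gt0. Qed.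

Lemma mem_scalev d U v : (forall i, 0 < d i 0) ->
  (v \in scalev d U) = (cmul (cinv d) v \in U).
Proof.
move=> d0; apply/mem_scalevP/idP => [[u uU ->]|vU]; first by rewrite cinvKV.
by exists (cmul (cinv d) v); rewrite ?cinvK.
Qed.

Lemma orthv_scale d U : (forall i, 0 < d i 0) ->
  orthv (scalev d U) = scalev (cinv d) (orthv U).
Proof.
move=> d0; apply/vspaceP => v.
have d1 := cinv_gt0 d0.
apply/mem_orthv/mem_scalevP => [vO|[w /mem_orthv wU ->] _ /mem_scalevP [u uU ->]].
  exists (cmul d v); last by rewrite cinvKV.
  by apply/mem_orthv => u uU; rewrite dot_cmul vO // scalev_cmul.
by rewrite dot_cmul cinvKV // wU.
Qed.

End InnerProduct.

Lemma dot_mulmx (R : realType) m n (A : 'M[R]_(m, n)) x y :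
  dot (A *m x) y = dot x (A^T *m y).
Proof.
rewrite /dot; under eq_bigr do rewrite mxE mulr_suml.
rewrite exchange_big; apply: eq_bigr => j _; rewrite mxE mulr_sumr.
by apply: eq_bigr => i _; rewrite mxE; ring.
Qed.

Lemma mem_kerspace (R : realType) m n (A : 'M[R]_(m, n)) x :
  (x \in kerspace A) = (A *m x == 0).
Proof. by rewrite memv_ker lfunE. Qed.

Lemma mem_rangespaceP (R : realType) m n (A : 'M[R]_(m, n)) y :
  reflect (exists x, y = A *m x) (y \in rangespace A).
Proof.
apply: (iffP memv_imgP) => [[x _ ->]|[x ->]]; exists x; rewrite ?memvf ?lfunE //.
Qed.

Lemma rangespace_tr (R : realType) m n (A : 'M[R]_(m, n)) :
  rangespace A^T = orthv (kerspace A).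
Proof.
rewrite -[LHS]orthvK; congr orthv; apply/vspaceP => v; rewrite mem_kerspace.
apply/mem_orthv/eqP => [vO|Av0 _ /mem_rangespaceP [y ->]]; last first.
  by rewrite -dot_mulmx Av0 dot0l.
by apply: dot_eq0; rewrite dot_mulmx vO //; apply/mem_rangespaceP; exists (A *m v).
Qed.

(** * Elementary vectors and circuit imbalances *)

Section Elementary.
Context {R : realType} {n : nat}.
Implicit Types (u v w d g z h : 'cV[R]_n) (U : {vspace 'cV[R]_n}).

Definition supp v : {set 'I_n} := [set i | v i 0 != 0].

Definition elementary U g : Prop :=
  [/\ g \in U, g != 0
    & forall z, z \in U -> z != 0 -> supp z \subset supp g -> supp g \subset supp z].

Lemma in_supp v i : (i \in supp v) = (v i 0 != 0).
Proof. by rewrite inE. Qed.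

Lemma supp0P v : reflect (v = 0) (supp v == finset.set0).
Proof.
apply: (iffP eqP) => [v0|->]; last by apply/setP => i; rewrite !inE mxE eqxx.
apply/matrixP => i j; rewrite ord1 mxE; apply/eqP.
by have /setP/(_ i) := v0; rewrite !inE => /negbFE.
Qed.

Lemma suppZ (a : R) v : a != 0 -> supp (a *: v) = supp v.
Proof. by move=> a0; apply/setP => i; rewrite !inE mxE mulf_eq0 (negPf a0). Qed.

Lemma neq0_supp v : v != 0 -> exists i, v i 0 != 0.
Proof.
move=> v0; have /set0Pn [i] : supp v != finset.set0 by apply: contra v0 => /supp0P ->.
by rewrite in_supp; exists i.
Qed.

Lemma elementaryZ U g a : a != 0 -> elementary U g -> elementary U (a *: g).
Proof.
move=> a0 [gU g0 gmin]; split; first by rewrite memvZ.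
  by rewrite scaler_eq0 negb_or a0.
by rewrite suppZ.
Qed.

Lemma elementary_unique U g z i : elementary U g -> z \in U ->
  supp z \subset supp g -> g i 0 != 0 -> z = (z i 0 / g i 0) *: g.
Proof.
move=> [gU g0 gmin] zU sub gi; apply/eqP; rewrite -subr_eq0; apply/negP => /negP nz.
set y := _ - _ in nz.
have yU : y \in U by rewrite memvB // memvZ.
have sy : supp y \subset supp g.
  apply/subsetP => k; rewrite !in_supp !mxE; apply: contraNN => /eqP gk.
  have zk : z k 0 = 0.
    by apply/eqP/negPn/negP; rewrite -in_supp => /(subsetP sub); rewrite in_supp gk eqxx.
  by rewrite zk gk mulr0 subrr.
have /subsetP/(_ i) := gmin _ yU nz sy.
by rewrite !in_supp => /(_ gi); rewrite !mxE mulfVK // subrr eqxx.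
Qed.

(** Moving from [z] along a vector of [U] with smaller support until the first
    coordinate vanishes keeps all signs, so a vector of minimal support is
    reached without ever leaving the orthant of [z]. *)
Lemma conformal_elementary U z : z \in U -> z != 0 ->
  exists g, [/\ elementary U g, forall k, 0 <= g k 0 * z k 0 & supp g \subset supp z].
Proof.
have [N] := ubnP #|supp z|; elim: N z => // N IH z /ltnSE-szN zU z0.
have [zel|/not_and3P [//|//|]] := pselect (elementary U z).
  by exists z; split => // k; rewrite -expr2 sqr_ge0.
move=> /existsNP [y /not_implyP [yU /not_implyP [y0 /not_implyP [sy /negP nsy]]]].
wlog [k0 k0P] : y yU y0 sy nsy / exists k, 0 < y k 0 * z k 0.
  have [k yk] := neq0_supp y0.
  have zk : z k 0 != 0 by move/subsetP/(_ k): sy; rewrite !in_supp; apply.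
  move=> H; have := mulf_neq0 yk zk; rewrite neq_lt => /orP[yz|yz]; last first.
    by apply: (H y) => //; exists k.
  have sN : supp (- y) = supp y by rewrite -scaleN1r suppZ // oppr_eq0 oner_eq0.
  apply: (H (- y)); rewrite ?memvN ?oppr_eq0 ?sN //.
  by exists k; rewrite mxE mulNr oppr_gt0.
case: (@arg_minP _ R _ k0 (fun k => 0 < y k 0 * z k 0) (fun k => z k 0 / y k 0) k0P).
move=> a ya amin.
set t := z a 0 / y a 0.
have yn k : 0 < y k 0 * z k 0 -> y k 0 != 0.
  by apply: contraTneq => ->; rewrite mul0r ltxx.
have t0 : 0 < t.
  rewrite /t -(pmulr_rgt0 _ (_ : 0 < y a 0 ^+ 2)) ?exprn_even_gt0 ?yn //.
  suff -> : y a 0 ^+ 2 * (z a 0 / y a 0) = y a 0 * z a 0 by [].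
  by field; exact: yn.
have zs k : z k 0 = 0 -> y k 0 = 0.
  move=> zk; apply/eqP; move/subsetP/(_ k): sy; rewrite !in_supp zk eqxx.
  by move/implyP; rewrite implybF negbK.
set z' := z - t *: y.
have z'U : z' \in U by rewrite memvB // memvZ.
have ssz : supp z' \subset supp z.
  apply/subsetP => k; rewrite !in_supp !mxE; apply: contraNN => /eqP zk.
  by rewrite zk zs // mulr0 subrr.
have az' : a \notin supp z' by rewrite in_supp negbK !mxE mulfVK ?subrr ?yn.
have az : a \in supp z.
  by rewrite in_supp; apply: contraTneq ya => ->; rewrite mulr0 ltxx.
have z'0 : z' != 0.
  have /subsetPn [k kz ky] := nsy; move: ky; rewrite in_supp negbK => /eqP ky.
  apply/eqP => /matrixP/(_ k 0); rewrite !mxE ky mulr0 subr0 => /eqP.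
  by apply/negP; rewrite -in_supp.
have conf k : 0 <= z' k 0 * z k 0.
  rewrite !mxE mulrBl.
  case: (ltrP 0 (y k 0 * z k 0)) => [yz|yz]; last first.
    rewrite -mulrA -mulrN addr_ge0 //; first by rewrite -expr2 sqr_ge0.
    by rewrite mulr_ge0 ?(ltW t0) ?oppr_ge0.
  have : t <= z k 0 / y k 0 by apply: amin.
  move=> /(ler_wpM2r (ltW yz)).
  rewrite (_ : z k 0 / y k 0 * _ = z k 0 * z k 0); last by field; rewrite yn.
  by rewrite subr_ge0 mulrA.
have [|g [gel gc gs]] := IH z' _ z'U z'0.
  by rewrite (leq_trans _ szN) // proper_card // properE ssz; apply/subsetPn; exists a.
exists g; split => // [k|]; last exact: subset_trans gs ssz.
have [gk|gk] := eqVneq (g k 0) 0; first by rewrite gk mul0r.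
have z'k : z' k 0 != 0 by move/subsetP/(_ k): gs; rewrite !in_supp; apply.
have p : 0 < z' k 0 ^+ 2 by rewrite exprn_even_gt0.
rewrite -(pmulr_rge0 _ p).
have -> : z' k 0 ^+ 2 * (g k 0 * z k 0) = (g k 0 * z' k 0) * (z' k 0 * z k 0) by ring.
by rewrite mulr_ge0.
Qed.

(** Subtracting the largest multiple of a conformal elementary vector that
    flips no sign of [z] makes the support of [z] smaller. *)
Lemma conformal_decomposition U z : z \in U ->
  exists gs : seq 'cV[R]_n,
    [/\ forall g, g \in gs -> elementary U g, z = \sum_(g <- gs) g,
        forall k, `|z k 0| = \sum_(g <- gs) `|g k 0| & (size gs <= #|supp z|)%N].
Proof.
have [N] := ubnP #|supp z|; elim: N z => // N IH z /ltnSE-szN zU.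
have [->|z0] := eqVneq z 0.
  by exists [::]; split => //= [|k]; rewrite big_nil // mxE normr0.
have [g [gel gc gs]] := conformal_elementary zU z0.
have [gU g0 gmin] := gel.
have [k0 k0P] := neq0_supp g0.
case: (@arg_minP _ R _ k0 (fun k => g k 0 != 0) (fun k => z k 0 / g k 0) k0P).
move=> a ga amin.
set t := z a 0 / g a 0.
have zn k : g k 0 != 0 -> z k 0 != 0 by move/subsetP/(_ k): gs; rewrite !in_supp.
have pos k : g k 0 != 0 -> 0 < z k 0 / g k 0.
  move=> gk; rewrite -(pmulr_rgt0 _ (_ : 0 < g k 0 ^+ 2)) ?exprn_even_gt0 //.
  rewrite (_ : g k 0 ^+ 2 * _ = g k 0 * z k 0); last by field.
  by rewrite lt_def gc mulf_neq0 // zn.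
have t0 : 0 < t by apply: pos.
set z' := z - t *: g.
have z'U : z' \in U by rewrite memvB // memvZ.
have zE k : z' k 0 = z k 0 - t * g k 0 by rewrite !mxE.
have ssz : supp z' \subset supp z.
  apply/subsetP => k; rewrite !in_supp zE; apply: contraNN => /eqP zk.
  have [->|/zn] := eqVneq (g k 0) 0; first by rewrite zk mulr0 subrr.
  by rewrite zk eqxx.
have [|hs [hel zs na sh]] := IH z' _ z'U.
  rewrite (leq_trans _ szN) // proper_card // properE ssz; apply/subsetPn; exists a.
    by rewrite in_supp zn.
  by rewrite in_supp zE mulfVK ?subrr ?eqxx.
exists (t *: g :: hs); split.
- move=> h; rewrite inE => /orP[/eqP ->|/hel //].
  by apply: elementaryZ => //; rewrite gt_eqF.
- by rewrite big_cons -zs /z' addrC subrK.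
- move=> k; rewrite big_cons -na zE mxE.
  have [->|gk] := eqVneq (g k 0) 0; first by rewrite mulr0 subr0 normr0 add0r.
  set r := z k 0 / g k 0.
  have -> : z k 0 = r * g k 0 by rewrite mulfVK.
  have rt : t <= r by apply: amin.
  rewrite -mulrBl (normrM r) (normrM t) (normrM (r - t)) -mulrDl; congr (_ * _).
  by rewrite (gtr0_norm t0) (gtr0_norm (pos k gk)) ger0_norm ?subr_ge0 // addrC subrK.
- rewrite /= (leq_ltn_trans sh) // proper_card // properE ssz; apply/subsetPn; exists a.
    by rewrite in_supp zn.
  by rewrite in_supp zE mulfVK ?subrr ?eqxx.
Qed.

Lemma ler_bigsum_mem (s : seq 'cV[R]_n) (F : 'cV[R]_n -> R) g :
  (forall h, 0 <= F h) -> g \in s -> F g <= \sum_(h <- s) F h.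
Proof.
move=> F0; elim: s => // a s IH; rewrite inE big_cons => /orP[/eqP ->|/IH Fg].
  by rewrite lerDl sumr_ge0.
by rewrite (le_trans Fg) // lerDr.
Qed.

(** [kap U i j] is the largest imbalance |g_j / g_i| of an elementary vector of
    [U]; for U = ker A these vectors are the circuit vectors of A. One
    representative per support suffices, by [elementary_unique]. *)
Definition kap U (i j : 'I_n) : R :=
  \big[Num.max/0]_(C : {set 'I_n})
     let g := xget 0 [set g | elementary U g /\ supp g = C]%classic in
     `|g j 0 / g i 0|.

Lemma kap_ge U g i j : elementary U g -> g i 0 != 0 -> `|g j 0 / g i 0| <= kap U i j.
Proof.
move=> gel gi; rewrite /kap.
pose F C := let g := xget 0 [set g | elementary U g /\ supp g = C]%classic in
  `|g j 0 / g i 0|.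
suff -> : `|g j 0 / g i 0| = F (supp g) by apply: (le_bigmax 0 F).
rewrite /F /=; set h := xget _ _.
have [[hU h0 hmin] sh] : elementary U h /\ supp h = supp g.
  apply: (@xgetPex _ 0 [set h | elementary U h /\ supp h = supp g]%classic).
  by exists g.
have hi : h i 0 != 0 by rewrite -in_supp sh in_supp.
have -> : h = (h i 0 / g i 0) *: g by apply: (elementary_unique gel hU _ gi); rewrite sh.
by rewrite !mxE; congr `|_|; field; rewrite hi gi.
Qed.

Lemma kap_le U i j (t : R) : 0 <= t ->
  (forall g, elementary U g -> g i 0 != 0 -> `|g j 0 / g i 0| <= t) -> kap U i j <= t.
Proof.
move=> t0 H; apply: bigmax_le => // C _ /=; set g := xget _ _.
have [gi|gi] := eqVneq (g i 0) 0; first by rewrite gi invr0 mulr0 normr0.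
apply: H => //.
have [ex|nex] := pselect (exists g, elementary U g /\ supp g = C).
  by have [] := @xgetPex _ 0 [set g | elementary U g /\ supp g = C]%classic ex.
case/negP: gi; rewrite /g xgetPN ?mxE // => h hP; apply: nex; exists h; exact: hP.
Qed.

Lemma kap_ge0 U i j : 0 <= kap U i j.
Proof. by apply: bigmax_ge_id. Qed.

Lemma kap_geM U g i j : elementary U g -> g i 0 != 0 ->
  `|g j 0| <= kap U i j * `|g i 0|.
Proof.
move=> gel gi; have := kap_ge j gel gi.
by rewrite normrM normfV ler_pdivrMr ?normr_gt0.
Qed.

Lemma supp_cmul d v : (forall i, 0 < d i 0) -> supp (cmul d v) = supp v.
Proof. by move=> d0; apply/setP => i; rewrite !inE mxE mulf_eq0 gt_eqF. Qed.

Lemma elementary_scale U d g : (forall i, 0 < d i 0) ->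
  elementary (scalev d U) g -> elementary U (cmul (cinv d) g).
Proof.
move=> d0 [gU g0 gmin]; have d1 := cinv_gt0 d0; split.
- by rewrite -mem_scalev.
- apply: contra g0 => /eqP g0.
  by rewrite -(cinvK g d0) g0; apply/eqP/matrixP => i j; rewrite !mxE mulr0.
move=> z zU z0; rewrite supp_cmul // => sz.
rewrite -(supp_cmul z d0); apply: gmin; rewrite ?scalev_cmul ?supp_cmul //.
apply: contra z0 => /eqP z0.
by rewrite -(cinvKV z d0) z0; apply/eqP/matrixP => i j; rewrite !mxE mulr0.
Qed.

Lemma kap_scale_le U d i j : (forall i, 0 < d i 0) ->
  kap (scalev d U) i j <= kap U i j * d j 0 / d i 0.
Proof.
move=> d0; apply: kap_le => [|g gel gi].
  by rewrite !mulr_ge0 ?kap_ge0 ?invr_ge0 ?(ltW (d0 _)).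
have gel' := elementary_scale d0 gel.
have := kap_ge j gel' (i := i).
have ne : (d i 0)^-1 * g i 0 != 0 by rewrite mulf_neq0 // invr_eq0 gt_eqF.
rewrite !mxE => /(_ ne) H.
rewrite -mulrA [X in _ <= X]mulrC -ler_pdivrMl ?divr_gt0 //.
rewrite (le_trans _ H) //.
rewrite [X in _ <= X](_ : _ = (d j 0 / d i 0)^-1 * `|g j 0 / g i 0|) //.
rewrite -[X in _ = X * _]ger0_norm ?invr_ge0 ?divr_ge0 ?(ltW (d0 _)) //.
rewrite -normrM; congr `|_|; field.
by rewrite gi !gt_eqF.
Qed.

End Elementary.

(** For U = ker A this is non-separability of the column matroid; the case i = j
    says in addition that the matroid has no coloop. *)
Definition connectedv (R : realType) n (U : {vspace 'cV[R]_n}) : Prop :=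
  forall i j : 'I_n, exists g, [/\ elementary U g, g i 0 != 0 & g j 0 != 0].

Section Connected.
Context {R : realType} {n : nat} (U : {vspace 'cV[R]_n}).
Hypothesis Uconn : connectedv U.
Implicit Types (i j k l : 'I_n) (g h z : 'cV[R]_n).

Lemma kap_mul_ge1 i j : 1 <= kap U i j * kap U j i.
Proof.
have [g [gel gi gj]] := Uconn i j.
rewrite -(_ : `|g j 0 / g i 0| * `|g i 0 / g j 0| = 1); last first.
  by rewrite -normrM mulf_div [X in _ / X]mulrC divff ?normr1 // mulf_neq0.
by rewrite ler_pM ?kap_ge.
Qed.

Lemma kap_diag i : kap U i i = 1.
Proof.
have [g [gel gi _]] := Uconn i i.
apply/eqP; rewrite eq_le; apply/andP; split.
  by apply: kap_le => // h _ hi; rewrite divff ?normr1.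
by rewrite -(normr1 R) -(divff gi) kap_ge.
Qed.

(** Take [g] through [i] and [k]; if it misses [j], choose an elementary [h]
    through [j] that meets [g] and makes the union of both supports minimal.
    Then the vectors of [U] supported in that union form the plane spanned by
    [g] and [h], and each h - l g that vanishes somewhere on [g] is elementary.
    One or two of these, through [i] and [j] and through [j] and [k], have
    imbalances whose product is at least |g_k / g_i|. *)
Lemma kap_triangle i j k : kap U i k <= kap U i j * kap U j k.
Proof.
apply: kap_le => [|g gel gi]; first by rewrite mulr_ge0 ?kap_ge0.
have [gj|gj] := eqVneq (g j 0) 0; last first.
  rewrite (_ : g k 0 / g i 0 = (g j 0 / g i 0) * (g k 0 / g j 0)); last first.
    by field; rewrite gi gj.
  by rewrite normrM ler_pM ?kap_ge.
have [gk|gk] := eqVneq (g k 0) 0.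
  by rewrite gk mul0r normr0 mulr_ge0 ?kap_ge0.
have [gU g0 gmin] := gel.
pose good h := [/\ elementary U h, h j 0 != 0 & ~~ [disjoint supp h & supp g]].
have exg : exists h, good h.
  have [h [hel hj hi]] := Uconn j i; exists h; split => //.
  by apply/pred0Pn; exists i; rewrite /= !in_supp hi gi.
have [h [hel hj hg] hmin] : exists2 h, good h &
    forall h', good h' -> (#|supp h :|: supp g| <= #|supp h' :|: supp g|)%N.
  pose P m := `[< exists h, good h /\ #|supp h :|: supp g| = m >].
  have exP : exists m, P m.
    by case: exg => h hh; exists #|supp h :|: supp g|; apply/asboolP; exists h.
  case: (ex_minnP exP) => m /asboolP [h [hh <-]] mmin.
  by exists h => // h' hh'; apply: mmin; apply/asboolP; exists h'.
have [hU h0 helmin] := hel.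
pose S := supp h :|: supp g.
(* the vectors supported in S that vanish at j are the multiples of g *)
have plane y : y \in U -> supp y \subset S -> y j 0 = 0 -> y = (y i 0 / g i 0) *: g.
  move=> yU sy yj; apply: (elementary_unique gel yU _ gi); apply/subsetP => l yl.
  apply/negPn/negP => lg.
  have [e [esum]] : exists e, [/\ elementary U e, e l 0 != 0 & supp e \subset supp y].
    have [es [eel ys na _]] := conformal_decomposition yU.
    have [e ee el] : exists2 e, e \in es & e l 0 != 0.
      apply: contrapT => H; move: yl; rewrite in_supp -normr_eq0 na.
      rewrite big_seq big1 ?eqxx // => e ee; apply/eqP; rewrite normr_eq0.
      by apply/negPn/negP => el; apply: H; exists e.
    exists e; split=> //; first exact: eel.
    apply/subsetP => q; rewrite !in_supp => eq0; rewrite -normr_gt0 na.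
    apply: (lt_le_trans (y := `|e q 0|)); first by rewrite normr_gt0.
    by apply: (ler_bigsum_mem (F := fun e : 'cV[R]_n => `|e q 0|)).
  move=> el sey; have [eU e0 _] := esum.
  have ej : e j 0 = 0.
    by apply/eqP/negPn/negP; rewrite -in_supp => /(subsetP sey); rewrite in_supp yj eqxx.
  have lh : h l 0 != 0.
    by have /(subsetP sy) := yl; rewrite inE (negPf lg) orbF in_supp.
  pose x := h - (h l 0 / e l 0) *: e.
  have xU : x \in U by rewrite memvB // memvZ.
  have xj : x j 0 = h j 0 by rewrite !mxE ej mulr0 subr0.
  have xl : x l 0 = 0 by rewrite !mxE mulfVK // subrr.
  have sx : supp x \subset S.
    apply/subsetP => q; rewrite in_supp !mxE => xq.
    have [hq|hq] := eqVneq (h q 0) 0; last by rewrite inE in_supp hq.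
    apply: (subsetP sy); apply: (subsetP sey); rewrite in_supp.
    by apply: contraNN xq => /eqP ->; rewrite hq mulr0 subrr.
  have [xs [xel xsum na _]] := conformal_decomposition xU.
  have [f fx fj] : exists2 f, f \in xs & f j 0 != 0.
    apply: contrapT => H; move: hj; rewrite -xj -normr_eq0 na.
    rewrite big_seq big1 ?eqxx // => f ff; apply/eqP; rewrite normr_eq0.
    by apply/negPn/negP => fj; apply: H; exists f.
  have sf : supp f \subset supp x.
    apply/subsetP => q; rewrite !in_supp => fq; rewrite -normr_gt0 na.
    apply: (lt_le_trans (y := `|f q 0|)); first by rewrite normr_gt0.
    by apply: (ler_bigsum_mem (F := fun e : 'cV[R]_n => `|e q 0|)).
  have fel := xel f fx; have [fU f0 _] := fel.
  have fS : supp f \subset S := subset_trans sf sx.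
  have lf : l \notin supp f by apply: contra (subsetP sf l) _; rewrite in_supp xl eqxx.
  have [fg|fg] := boolP [disjoint supp f & supp g].
    have fh : supp f \subset supp h.
      apply/subsetP => q qf; have := subsetP fS q qf; rewrite inE => /orP[//|qg].
      by rewrite disjoint_sym in fg; rewrite (disjointFr fg qg) in qf.
    have := helmin f fU f0 fh => /subsetP/(_ l); rewrite (negPf lf) in_supp lh.
    by move/(_ isT).
  have := hmin f; rewrite leqNgt => /(_ _) /negP; apply; first by split.
  apply: proper_card; rewrite properE; apply/andP; split.
    by rewrite finset.subUset fS finset.subsetUr.
  apply/subsetPn; exists l; first by rewrite inE in_supp lh.
  by rewrite inE negb_or lf lg.
pose lam l := h l 0 / g l 0.
have felem l : g l 0 != 0 -> elementary U (h - lam l *: g).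
  move=> gl; have fU : h - lam l *: g \in U by rewrite memvB // memvZ.
  have fl : (h - lam l *: g) l 0 = 0 by rewrite !mxE mulfVK // subrr.
  have fj : (h - lam l *: g) j 0 = h j 0 by rewrite !mxE gj mulr0 subr0.
  have fS : supp (h - lam l *: g) \subset S.
    apply/subsetP => q; rewrite !inE !mxE; apply: contraNT.
    by rewrite negb_or !negbK => /andP [/eqP -> /eqP ->]; rewrite mulr0 subrr.
  split => //; first by apply: contra hj => /eqP f0; rewrite -fj f0 mxE.
  move=> z zU z0 sz.
  have zl : z l 0 = 0.
    by apply/eqP/negPn/negP; rewrite -in_supp => /(subsetP sz); rewrite in_supp fl eqxx.
  have [zj|zj] := eqVneq (z j 0) 0.
    have zE := plane z zU (subset_trans sz fS) zj.
    have : z i 0 / g i 0 = 0.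
      apply/eqP; move/matrixP/(_ l 0): zE; rewrite zl mxE => /esym/eqP.
      by rewrite mulf_eq0 (negPf gl) orbF.
    by move=> c0; move: z0; rewrite zE c0 scale0r eqxx.
  pose y := (h j 0 / z j 0) *: z - h.
  have yU : y \in U by rewrite memvB // memvZ.
  have yj : y j 0 = 0 by rewrite !mxE mulfVK // subrr.
  have yS : supp y \subset S.
    apply/subsetP => q yq.
    have [qz|qz] := boolP (q \in supp z); first exact: subsetP fS _ (subsetP sz _ qz).
    rewrite inE; apply/orP; left; move: yq; rewrite in_supp !mxE.
    move: qz; rewrite !in_supp negbK => /eqP ->; rewrite mulr0 sub0r oppr_eq0.
    by [].
  have yE := plane y yU yS yj.
  have c : y i 0 / g i 0 = - lam l.
    move: (y i 0 / g i 0) yE => c /matrixP/(_ l 0).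
    by rewrite !mxE zl mulr0 add0r /lam -mulNr => ->; rewrite mulfK.
  have -> : h - lam l *: g = (h j 0 / z j 0) *: z.
    by rewrite -scaleNr -c -yE /y addrC subrK.
  by rewrite suppZ // mulf_neq0 ?invr_eq0.
have [l1 gl1 l1h] : exists2 l, g l 0 != 0 & h l 0 != 0.
  move/pred0Pn: hg => [l /= /andP[lh lg]]; exists l; rewrite -in_supp //.
have fE l q : (h - lam l *: g) q 0 = h q 0 - lam l * g q 0 by rewrite !mxE.
have fi l q : g q 0 != 0 -> (h - lam l *: g) q 0 = g q 0 * (lam q - lam l).
  by move=> gq; rewrite fE mulrBr [g q 0 * lam q]mulrC mulfVK // [_ * g q 0]mulrC.
have fj l : (h - lam l *: g) j 0 = h j 0 by rewrite fE gj mulr0 subr0.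
have step l l' : g l 0 != 0 -> g l' 0 != 0 -> lam i != lam l ->
    `|lam k - lam l'| >= `|lam i - lam l| ->
    `|g k 0 / g i 0| <= kap U i j * kap U j k.
  move=> gl gl' il le.
  have d0 : lam i - lam l != 0 by rewrite subr_eq0.
  have fi0 : (h - lam l *: g) i 0 != 0 by rewrite fi // mulf_neq0.
  have fj0 : (h - lam l' *: g) j 0 != 0 by rewrite fj.
  have H1 := kap_ge j (felem l gl) fi0.
  have H2 := kap_ge k (felem l' gl') fj0.
  apply: le_trans (ler_pM _ _ H1 H2) => //.
  rewrite !fj !fi // -normrM.
  rewrite (_ : h j 0 / _ * _ = (g k 0 / g i 0) * ((lam k - lam l') / (lam i - lam l))).
    rewrite [X in _ <= X]normrM ler_peMr // normrM normfV.
    by rewrite ler_pdivlMr ?normr_gt0 // mul1r.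
  by field; rewrite hj gi d0.
have [e|ik] := eqVneq (lam i) (lam k); last first.
  by apply: (step k i) => //; rewrite distrC.
have [l gl il] : exists2 l, g l 0 != 0 & lam i != lam l.
  apply: contrapT => H.
  have all l : g l 0 != 0 -> lam l = lam i.
    by move=> gl; apply/eqP/negPn/negP => ll; apply: H; exists l; rewrite // eq_sym.
  have [/subsetP/(_ j)] : supp h \subset supp (h - lam i *: g).
    have [fU f0 _] := felem i gi; apply: helmin => //.
    apply/subsetP => q; rewrite !in_supp fE.
    have [gq|gq] := eqVneq (g q 0) 0; first by rewrite gq mulr0 subr0.
    by rewrite -(all _ gq) mulfVK // subrr eqxx.
  have [fU f0 _] := felem i gi.
  have sub : supp (h - lam i *: g) \subset supp h.
    apply/subsetP => q; rewrite !in_supp fE.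
    have [gq|gq] := eqVneq (g q 0) 0; first by rewrite gq mulr0 subr0.
    by rewrite -(all _ gq) mulfVK // subrr eqxx.
  have /subsetP/(_ l1) := helmin _ fU f0 sub.
  by rewrite !in_supp l1h fE -(all _ gl1) mulfVK // subrr eqxx => /(_ isT).
by apply: (step l l) => //; rewrite e.
Qed.

End Connected.

(** * Circuit imbalances are bounded by the condition number *)

Section Norms.
Context {R : realType} {n : nat}.
Implicit Types (u v : 'cV[R]_n).

Lemma sumsq_ge0 v : 0 <= \sum_i v i 0 ^+ 2.
Proof. by apply: sumr_ge0 => i _; rewrite sqr_ge0. Qed.

Lemma norm2_ge0 v : 0 <= norm2 v.
Proof. exact: sqrtr_ge0. Qed.

Lemma sqr_norm2 v : norm2 v ^+ 2 = \sum_i v i 0 ^+ 2.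
Proof. by rewrite sqr_sqrtr // sumsq_ge0. Qed.

Lemma norm2_le v (t : R) : 0 <= t -> (norm2 v <= t) = (\sum_i v i 0 ^+ 2 <= t ^+ 2).
Proof. by move=> t0; rewrite -sqr_norm2 ler_sqr ?nnegrE ?norm2_ge0. Qed.

Lemma coord_le_norm2 v i : `|v i 0| <= norm2 v.
Proof.
rewrite -ler_sqr ?nnegrE ?norm2_ge0 // sqr_norm2 real_normK ?num_real //.
by rewrite (bigD1 i) //= lerDl sumr_ge0 // => j _; rewrite sqr_ge0.
Qed.

Lemma norm2_le_sum v : norm2 v <= \sum_i `|v i 0|.
Proof.
rewrite norm2_le ?sumr_ge0 // expr2 mulr_suml ler_sum // => i _.
rewrite -(real_normK (num_real (v i 0))) expr2 ler_wpM2l // (bigD1 i) //=.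
by rewrite lerDl sumr_ge0.
Qed.

End Norms.

Section ConformalTerms.
Context {R : realType} {n : nat}.
Variables (gs : seq 'cV[R]_n) (z : 'cV[R]_n).
Hypotheses (zE : z = \sum_(g <- gs) g) (zN : forall k, `|z k 0| = \sum_(g <- gs) `|g k 0|).

Lemma conformal_sub g k : g \in gs -> `|z k 0 - g k 0| <= `|z k 0| - `|g k 0|.
Proof.
move=> gg; rewrite zN zE summxE !(perm_big _ (perm_to_rem gg)) !big_cons /=.
by rewrite addrAC subrr add0r addrAC subrr add0r ler_norm_sum.
Qed.

Lemma conformal_le g k : g \in gs -> `|g k 0| <= `|z k 0|.
Proof. by move=> /(conformal_sub k); have := normr_ge0 (z k 0 - g k 0); lra. Qed.

Lemma conformal_sign g k : g \in gs -> 0 <= g k 0 * z k 0.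
Proof.
move=> gg; rewrite leNgt; apply/negP => gz.
have := conformal_sub k gg.
have g0 : g k 0 != 0 by apply: contraTneq gz => ->; rewrite mul0r ltxx.
have := normr_gt0 (g k 0); rewrite g0.
case: (ltrgt0P (g k 0)) gz g0 => [g0|g0|->]; rewrite ?mul0r ?eqxx //; last first.
  rewrite nmulr_rlt0 // => z0 _ _; rewrite (gtr0_norm z0) ger0_norm; lra.
by rewrite pmulr_rlt0 // => z0 _ _; rewrite (ltr0_norm z0) ler0_norm; lra.
Qed.

End ConformalTerms.

(** Projections that are orthogonal for a weighted inner product are bounded
    uniformly in the weights: an elementary vector [g] conformal to the
    projection [p] of [v] has a coordinate where |p_i| <= |v_i|, for otherwise
    g would not be orthogonal to d (v - p); imbalances then bound all of [g]. *)
Lemma weighted_projection_bound (R : realType) n (V : {vspace 'cV[R]_n})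
    (d v p : 'cV[R]_n) (t : R) j :
  (forall i, 0 < d i 0) -> p \in V -> cmul d (v - p) \in orthv V ->
  (forall i, `|v i 0| <= t) ->
  `|p j 0| <= n%:R * ((\sum_i kap V i j) * t).
Proof.
move=> d0 pV /mem_orthv dpV vt.
have t0 : 0 <= t by apply: le_trans (vt j).
have [gs [gel pE pN sz]] := conformal_decomposition pV.
set B := _ * t.
have B0 : 0 <= B by rewrite mulr_ge0 ?sumr_ge0 // => i _; rewrite kap_ge0.
have gB g : g \in gs -> `|g j 0| <= B.
  move=> gg; have [gV g0 _] := gel g gg.
  have [i gi pv] : exists2 i, g i 0 != 0 & `|p i 0| <= `|v i 0|.
    apply: contrapT => H.
    suff : dot (cmul d (v - p)) g < 0 by rewrite dpV // ltxx.
    have [i gi] := neq0_supp g0.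
    have term k : d k 0 * (v k 0 - p k 0) * g k 0 <= 0 ?= iff (g k 0 == 0).
      have [->|gk] := eqVneq (g k 0) 0; first by rewrite mulr0; split; rewrite ?eqxx.
      suff lt0 : d k 0 * (v k 0 - p k 0) * g k 0 < 0.
        by split; [exact: ltW | rewrite lt_eqF].
      have pv : `|v k 0| < `|p k 0|.
        by rewrite ltNge; apply/negP => pv; apply: H; exists k.
      rewrite -mulrA pmulr_rlt0 //.
      have := conformal_sign pE pN k gg.
      have p0 : p k 0 != 0 by rewrite -normr_gt0 (le_lt_trans _ pv).
      move: pv gk p0; rewrite ltr_norml.
      case: (ltrgt0P (p k 0)) => // p0 /andP[h1 h2] gk _.
        by rewrite pmulr_lge0 // => g1; rewrite nmulr_rlt0 ?lt_def ?gk //; lra.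
      by rewrite nmulr_lge0 // => g1; rewrite pmulr_rlt0 ?lt_def 1?eq_sym ?gk //; lra.
    rewrite /dot (bigD1 i) //= ltr_wnDr //.
      by apply: sumr_le0 => k _; rewrite !mxE; apply: (term k).
    by have [le eq] := term i; rewrite !mxE lt_neqAle eq gi le.
  have gi_le : `|g i 0| <= t.
    exact: le_trans (conformal_le pE pN i gg) (le_trans pv (vt i)).
  rewrite (le_trans (kap_geM j (gel g gg) gi)) // ler_pM ?kap_ge0 //.
  by rewrite (bigD1 i) //= lerDl sumr_ge0 // => k _; rewrite kap_ge0.
rewrite pN big_seq (le_trans (ler_sum _ gB)) // -big_seq big_const_seq count_predT.
rewrite iter_addr addr0 -[B *+ _]mulr_natl ler_wpM2r // ler_nat.
by rewrite (leq_trans sz) // -[X in (_ <= X)%N]card_ord max_card.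
Qed.

Section ConditionNumber.
Context {R : realType} {m n : nat}.
Implicit Types (A : 'M[R]_(m, n)) (d : 'rV[R]_n) (v p : 'cV[R]_n).

(** The matrix whose norms the condition number takes the supremum of; applied
    to [v] it gives the projection of [v] on range A^T for the inner product
    weighted by D ([wproj_spec]). *)
Definition wproj A (D : 'M[R]_n) : 'M[R]_n := A^T *m invmx (A *m D *m A^T) *m A *m D.

Lemma gram_unit A d : row_free A -> (forall i, 0 < d 0 i) ->
  A *m diag_mx d *m A^T \in unitmx.
Proof.
move=> Afree d0; rewrite -row_free_unit; apply/inj_row_free => v v0.
apply: (row_free_inj Afree); rewrite mul0mx; apply/trmx_inj; rewrite trmx0.
set x := (v *m A)^T.
have /eqP : \sum_i d 0 i * x i 0 ^+ 2 = 0.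
  have e0 : (v *m (A *m diag_mx d *m A^T) *m v^T) 0 0 = 0 by rewrite v0 mul0mx mxE.
  rewrite -[RHS]e0 [RHS](_ : _ = ((v *m A *m diag_mx d) *m (v *m A)^T) 0 0); last first.
    by rewrite trmx_mul !mulmxA mxE.
  by rewrite mxE; apply: eq_bigr => i _; rewrite mul_mx_diag /x !mxE expr2; ring.
rewrite psumr_eq0 => [/allP H|i _]; last by rewrite mulr_ge0 ?sqr_ge0 ?(ltW (d0 _)).
apply/matrixP => i j; rewrite ord1 [RHS]mxE; apply/eqP.
have := H i (mem_index_enum i); rewrite /= mulf_eq0 sqrf_eq0 gt_eqF //.
Qed.

Lemma wproj_spec A d v : row_free A -> (forall i, 0 < d 0 i) ->
  wproj A (diag_mx d) *m v \in orthv (kerspace A) /\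
  cmul d^T (v - wproj A (diag_mx d) *m v) \in kerspace A.
Proof.
move=> Afree d0; split.
  rewrite -rangespace_tr; apply/mem_rangespaceP; eexists; by rewrite /wproj -!mulmxA.
rewrite mem_kerspace -mul_diag_cmul trmxK mulmxBr mulmxBr /wproj !mulmxA.
by rewrite mulmxV ?gram_unit // mul1mx subrr.
Qed.

Lemma opnorm_ge (M : 'M[R]_n) v : norm2 v <= 1 -> norm2 (M *m v) <= opnorm M.
Proof.
move=> v1; apply: ub_le_sup; last by exists v.
exists (\sum_i \sum_j `|M i j|) => _ [u /= u1 <-].
rewrite (le_trans (norm2_le_sum _)) // ler_sum // => i _.
rewrite mxE (le_trans (ler_norm_sum _ _ _)) // ler_sum // => j _.
by rewrite normrM ler_piMr // (le_trans (coord_le_norm2 _ _)).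
Qed.

Lemma norm2_0 : norm2 (0 : 'cV[R]_n) = 0.
Proof. by rewrite /norm2 big1 ?sqrtr0 // => i _; rewrite mxE expr0n. Qed.

Lemma opnorm_le (M : 'M[R]_n) (t : R) :
  (forall v, norm2 v <= 1 -> norm2 (M *m v) <= t) -> opnorm M <= t.
Proof.
move=> H; apply: sup_le_ub; last by move=> _ [v /= v1 <-]; apply: H.
by exists (norm2 (M *m 0)); exists 0 => //=; rewrite norm2_0 ler01.
Qed.

Lemma chibar_ge A d : row_free A -> (forall i, 0 < d 0 i) ->
  opnorm (wproj A (diag_mx d)) <= chibar A.
Proof.
move=> Afree d0; apply: ub_le_sup; last by exists (diag_mx d) => //; exists d.
pose V := orthv (kerspace A).
exists (\sum_(j < n) n%:R * ((\sum_i kap V i j) * 1)) => _ [_ [e /= e0 <-] <-].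
apply: opnorm_le => v v1; rewrite (le_trans (norm2_le_sum _)) // ler_sum // => j _.
have [pV dpW] := wproj_spec v Afree e0.
apply: (@weighted_projection_bound _ _ V e^T v) => //.
- by move=> i; rewrite mxE.
- by rewrite orthvK.
- by move=> i; rewrite (le_trans (coord_le_norm2 _ _)).
Qed.

(** With weight 1 on supp g minus i and a tiny weight elsewhere, the weighted
    projection of the unit vector e^j nearly agrees with e^j on the heavy
    coordinates; orthogonality to g then forces its i-th entry to be about
    - g_j / g_i. *)
Lemma kap_le_chibar A i j : row_free A -> i != j -> kap (kerspace A) i j <= chibar A.
Proof.
move=> Afree ij; set W := kerspace A; pose V := orthv W.
have chi0 : 0 <= chibar A.
  have d1 k : 0 < (const_mx 1 : 'rV[R]_n) 0 k by rewrite mxE ltr01.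
  apply: le_trans (chibar_ge Afree d1).
  apply: le_trans (opnorm_ge _ (v := 0) _); rewrite ?norm2_ge0 ?norm2_0 ?ler01 //.
apply: kap_le => // g gel gi.
rewrite normrM normfV ler_pdivrMr ?normr_gt0 //.
have [gj|gj] := eqVneq (g j 0) 0; first by rewrite gj normr0 mulr_ge0.
have [gW g0 gmin] := gel.
pose v : 'cV[R]_n := delta_mx j 0.
have vE k : v k 0 = (k == j)%:R by rewrite mxE eqxx andbT.
have v1 : norm2 v = 1.
  rewrite /norm2 (bigD1 j) //= big1 ?vE ?eqxx ?addr0 ?expr1n ?sqrtr1 // => k kj.
  by rewrite vE (negPf kj) expr0n.
(* a vector of V that agrees with e^j on supp g minus i *)
have [h hV hE] : exists2 h, h \in V &
    forall k, g k 0 != 0 -> k != i -> h k 0 = v k 0.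
  pose Z := lker (linfun (mulmx (coordproj R (supp g)) : 'cV[R]_n -> 'cV[R]_n)).
  have inZ x : (x \in Z) = (coordproj R (supp g) *m x == 0) by rewrite memv_ker lfunE.
  have projE x k : (coordproj R (supp g) *m x) k 0 = (k \in supp g)%:R * x k 0.
    by rewrite mul_diag_mx !mxE.
  pose t : 'cV[R]_n := v - (g j 0 / g i 0) *: delta_mx i 0.
  have : t \in (V + Z)%VS.
    rewrite -(orthvK (V + Z)%VS); apply/mem_orthv => w /mem_orthv wVZ.
    have wW : w \in W.
      rewrite -[W]orthvK; apply/mem_orthv => u uV; apply: wVZ.
      by rewrite -[u]addr0 memv_add // mem0v.
    have sw : supp w \subset supp g.
      apply/subsetP => k; rewrite [_ \in supp w]in_supp; apply: contraNT => kg.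
      have : dot w (delta_mx k 0) = 0.
        apply: wVZ; rewrite -[delta_mx _ _]add0r memv_add ?mem0v // inZ.
        apply/eqP/matrixP => q q'; rewrite ord1 projE !mxE eqxx andbT.
        by have [->|] := eqVneq q k; rewrite ?mulr0 // (negPf kg) mul0r.
      rewrite /dot (bigD1 k) //= big1 => [|q qk]; last first.
        by rewrite mxE eqxx (negPf qk) mulr0.
      by rewrite mxE !eqxx mulr1 addr0 => ->.
    rewrite (elementary_unique gel wW sw gi) dotZr /dot.
    rewrite (bigD1 i) // (bigD1 j) /= 1?eq_sym //.
    rewrite big1 => [|k /andP [ki kj]]; last first.
      by rewrite !mxE !eqxx (negPf ki) (negPf kj) mulr0 subr0 mul0r.
    rewrite !mxE !eqxx (negPf ij) [j == i]eq_sym (negPf ij) /=.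
    by rewrite mulr1 mulr0 subr0 sub0r mul1r addr0 mulNr mulfVK // addNr mulr0.
  move=> /memv_addP [h hV [r]]; rewrite inZ => /eqP rZ tE.
  exists h => // k gk ki.
  have rk : r k 0 = 0.
    by have /matrixP/(_ k 0) := rZ; rewrite projE in_supp gk mul1r mxE.
  have /matrixP/(_ k 0) := tE.
  by rewrite !mxE (negPf ki) mulr0 subr0 rk addr0 => ->; rewrite ?eqxx.
pose G := \sum_k `|g k 0|; pose H := \sum_k (h k 0 - v k 0) ^+ 2.
have G0 : 0 <= G by rewrite sumr_ge0.
have H0 : 0 <= H by rewrite sumr_ge0 // => k _; rewrite sqr_ge0.
suff near eta : 0 < eta -> `|g j 0| <= chibar A * `|g i 0| + G * eta.
  apply/ler_addgt0Pr => e e0.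
  have [G1|G1] := eqVneq G 0.
    by rewrite (le_trans (near 1 ltr01)) // G1 mul0r lerD2l ltW.
  rewrite (le_trans (near (e / G) _)) ?divr_gt0 // ?lt_def ?G1 //.
  by rewrite mulrCA mulfV // mulr1.
move=> eta0; pose eps := eta ^+ 2 / (H + 1).
have H1 : 0 < H + 1 by rewrite ltr_wpDl.
have eps0 : 0 < eps by rewrite divr_gt0 ?exprn_gt0.
have epsH : eps * H <= eta ^+ 2.
  by rewrite /eps mulrAC ler_pdivrMr // ler_wpM2l ?sqr_ge0 // lerDl ler01.
pose heavy k := (g k 0 != 0) && (k != i).
pose d : 'rV[R]_n := \row_k (if heavy k then 1 else eps).
have dE k : d 0 k = if heavy k then 1 else eps by rewrite mxE.
have d0 k : 0 < d 0 k by rewrite dE; case: ifP => _; rewrite ?ltr01.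
set p := wproj A (diag_mx d) *m v.
have [pV dpW] := wproj_spec v Afree d0; rewrite -/p in pV dpW.
have pyth : \sum_k d 0 k * (p k 0 - v k 0) ^+ 2 <= eps * H.
  have cross : \sum_k d 0 k * (v k 0 - p k 0) * (h k 0 - p k 0) = 0.
    have /mem_orthv hpO : h - p \in V by rewrite memvB.
    rewrite -[RHS](hpO _ dpW) dotC; apply: eq_bigr => k _.
    by rewrite !mxE.
  have -> : \sum_k d 0 k * (p k 0 - v k 0) ^+ 2
      = \sum_k d 0 k * (h k 0 - v k 0) ^+ 2 - \sum_k d 0 k * (h k 0 - p k 0) ^+ 2.
    rewrite -sumrB -[LHS]addr0 -[X in _ + X](mulr0 (- 2)) -[in X in _ + X]cross.
    rewrite mulr_sumr -big_split; apply: eq_bigr => k _ /=; ring.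
  rewrite lerBlDr ler_wpDr //.
    by apply: sumr_ge0 => k _; rewrite mulr_ge0 ?sqr_ge0 ?(ltW (d0 _)).
  rewrite /H mulr_sumr ler_sum // => k _; rewrite dE; case: ifP => // /andP[gk ki].
  by rewrite hE // subrr expr0n !mulr0.
have close k : heavy k -> `|p k 0 - v k 0| <= eta.
  move=> hk; rewrite -ler_sqr ?nnegrE ?(ltW eta0) // real_normK ?num_real //.
  apply: le_trans epsH; apply: le_trans pyth; rewrite (bigD1 k) //= dE hk mul1r.
  by rewrite lerDl sumr_ge0 // => q _; rewrite mulr_ge0 ?sqr_ge0 ?(ltW (d0 _)).
have pi : `|p i 0| <= chibar A.
  rewrite (le_trans (coord_le_norm2 _ _)) // (le_trans _ (chibar_ge Afree d0)) //.
  by apply: opnorm_ge; rewrite v1.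
have pg : dot p g = 0 by move/mem_orthv: pV; apply.
have gjE : g j 0 = - (p i 0 * g i 0) - \sum_(k | k != i) (p k 0 - v k 0) * g k 0.
  have -> : \sum_(k | k != i) (p k 0 - v k 0) * g k 0 =
      \sum_(k | k != i) p k 0 * g k 0 - \sum_(k | k != i) v k 0 * g k 0.
    by rewrite -sumrB; apply: eq_bigr => k _; rewrite mulrBl.
  have -> : \sum_(k | k != i) v k 0 * g k 0 = g j 0.
    rewrite (bigD1 j) /= 1?eq_sym // big1 ?vE ?eqxx ?mul1r ?addr0 // => k /andP[_ kj].
    by rewrite vE (negPf kj) mul0r.
  by move: pg; rewrite /dot (bigD1 i) //= => pg; lra.
rewrite gjE (le_trans (ler_normB _ _)) // normrN normrM lerD //.
  by rewrite ler_wpM2r.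
rewrite (le_trans (ler_norm_sum _ _ _)) // /G mulr_suml [leRHS](bigD1 i) //=.
rewrite ler_wpDl ?mulr_ge0 ?(ltW eta0) // ler_sum // => k ki.
rewrite normrM mulrC; have [->|gk] := eqVneq (g k 0) 0; first by rewrite normr0 !mul0r.
by rewrite ler_wpM2l // close // /heavy gk.
Qed.

Lemma kerspace_scale A d : (forall i, 0 < d 0 i) ->
  kerspace (A *m diag_mx d) = scalev (cinv d^T) (kerspace A).
Proof.
move=> d0; apply/vspaceP => x; rewrite mem_scalev; last by apply: cinv_gt0 => i; rewrite mxE.
rewrite !mem_kerspace (_ : cinv (cinv _) = d^T) -?mul_diag_cmul ?trmxK ?mulmxA //.
by apply/matrixP => i j; rewrite ord1 !mxE invrK.
Qed.

(** Rescaling the columns changes imbalances by ratios of the weights, so the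
    infimum defining the optimised condition number yields a rescaling under
    which all imbalances are bounded. *)
Lemma balancing_weights A : row_free A -> connectedv (kerspace A) ->
  0 <= chibar_star A /\
  exists d : 'cV[R]_n, (forall i, 0 < d i 0) /\
    forall i j, kap (kerspace A) i j * d j 0 / d i 0 <= chibar_star A + 1.
Proof.
move=> Afree conn.
have free d : (forall i, 0 < d 0 i) -> row_free (A *m diag_mx d).
  move=> d0; rewrite /row_free mxrankMfree //.
  rewrite row_free_unit unitmxE det_diag unitfE; apply/prodf_neq0 => i _.
  by rewrite gt_eqF.
have chi0 d : (forall i, 0 < d 0 i) -> 0 <= chibar (A *m diag_mx d).
  move=> d0; have d1 k : 0 < (const_mx 1 : 'rV[R]_n) 0 k by rewrite mxE ltr01.
  apply: le_trans (chibar_ge (free d d0) d1).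
  apply: le_trans (opnorm_ge _ (v := 0) _); rewrite ?norm2_ge0 ?norm2_0 ?ler01 //.
pose E := [set chibar (A *m D) | D in @posdiag R n]%classic.
have E0 : (E !=set0)%classic.
  exists (chibar (A *m diag_mx (const_mx 1))); exists (diag_mx (const_mx 1)) => //.
  by exists (const_mx 1) => //= i; rewrite mxE ltr01.
have lbE : lbound E 0 by move=> _ [_ [d /= d0 <-] <-]; apply: chi0.
have s0 : 0 <= chibar_star A by apply: lb_le_inf.
split => //.
have hasE : has_inf E by split => //; exists 0.
have [_ [_ [d /= d0 <-] <-] lt] := inf_adherent ltr01 hasE.
exists (cinv d^T); split=> [i|i j]; first by rewrite cinv_gt0 // => k; rewrite mxE.
have dT0 i' : 0 < d^T i' 0 by rewrite mxE.
have [->|ij] := eqVneq i j.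
  rewrite kap_diag // mul1r divff ?lerDr // !mxE invr_eq0 gt_eqF //.
apply: le_trans (ltW lt).
apply: le_trans (kap_le_chibar (free d d0) ij); rewrite kerspace_scale //.
have := kap_scale_le (scalev (cinv d^T) (kerspace A)) i j dT0.
have -> : scalev d^T (scalev (cinv d^T) (kerspace A)) = kerspace A.
  apply/vspaceP => x; rewrite mem_scalev // mem_scalev; last exact: cinv_gt0.
  rewrite (_ : cinv (cinv _) = d^T) ?cinvK //.
  by apply/matrixP => i' j'; rewrite ord1 !mxE invrK.
rewrite !mxE invrK => le; rewrite -mulrA mulrC.
rewrite -ler_pdivlMl ?mulr_gt0 ?invr_gt0 // (le_trans le) //.
have -> : ((d 0 j)^-1 * d 0 i)^-1 = d 0 j / d 0 i by rewrite invfM invrK.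
by rewrite [leRHS]mulrC !mulrA.
Qed.

End ConditionNumber.

(** * Liftings and the subroutine Verify-Lift *)

(** [B] prescribes how a vector of [U] can be changed outside [G] so that its
    coordinates there become a linear function of those in [G]. *)
Definition lifting (R : realType) n (U : {vspace 'cV[R]_n}) (G : {set 'I_n})
    (B : 'M[R]_n) : Prop :=
  forall u, u \in U -> exists u', [/\ u' \in U, forall i, i \in G -> u' i 0 = u i 0
    & forall j, j \notin G -> u' j 0 = \sum_(i in G) B j i * u i 0].

Section Lifting.
Context {R : realType} {n : nat}.
Implicit Types (U : {vspace 'cV[R]_n}) (I G : {set 'I_n}) (u v z q : 'cV[R]_n).

(** Liftings dualise by negated transposition: for [u] in [U] with lift u',
    the difference u - u' lies in [U] and vanishes on [G], so pairing it with
    a vector [v] orthogonal to [U] involves only the coordinates of [v] outside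
    [G], and so does the candidate lift of [v]. *)
Lemma lifting_dual U G B : lifting U G B -> lifting (orthv U) (~: G) (- B^T).
Proof.
move=> lB v /mem_orthv vU.
pose v' : 'cV[R]_n := \col_i (if i \in G then \sum_(j in ~: G) (- B^T) i j * v j 0 else v i 0).
exists v'; split => [|i iG|j jG]; rewrite ?mxE.
- apply/mem_orthv => u uU; have [u' [u'U uG uE]] := lB u uU.
  have := vU (u - u'); rewrite memvB // => /(_ isT).
  rewrite /dot (bigID (mem G)) /= big1 ?add0r; last first.
    by move=> i iG; rewrite !mxE uG // subrr mulr0.
  move=> v0; rewrite (bigID (mem G)) /= -[RHS]v0.
  under eq_bigr => i iG do rewrite mxE iG mulr_suml.
  rewrite exchange_big /=.
  rewrite (eq_bigl (fun j => j \notin G)); last by move=> j; rewrite inE.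
  rewrite -big_split /=; apply: eq_bigr => j jG; rewrite !mxE (negPf jG) uE //.
  rewrite mulrBr mulr_sumr -sumrN addrC; congr (_ + _).
  by apply: eq_bigr => i iG; rewrite !mxE; ring.
- by move: iG; rewrite inE => /negPf ->.
- by move: jG; rewrite inE negbK => ->.
Qed.

Lemma lifting_set0 U : lifting U finset.set0 0.
Proof.
move=> u uU; exists 0; split => [|i|j _]; rewrite ?mem0v ?inE //.
by rewrite mxE big_set0.
Qed.

Lemma coordprojE I v i : (coordproj R I *m v) i 0 = (i \in I)%:R * v i 0.
Proof. by rewrite mul_diag_mx !mxE. Qed.

Lemma coordproj_eqP I u v :
  coordproj R I *m u = coordproj R I *m v <-> forall i, i \in I -> u i 0 = v i 0.
Proof.
split=> [e i iI|e].
  by have /matrixP/(_ i 0) := e; rewrite !coordprojE iI !mul1r.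
apply/matrixP => i j; rewrite ord1 !coordprojE.
by case: (boolP (i \in I)) => [/e ->|]; rewrite ?mul0r.
Qed.

Lemma mem_mximage (M : 'M[R]_n) U v :
  reflect (exists2 u, u \in U & v = M *m u) (v \in mximage M U).
Proof. by apply: (iffP memv_imgP) => [] [u uU ->]; exists u; rewrite ?lfunE. Qed.

(** Equal dimensions of the two projections mean that the kernels of both on
    [U] coincide. *)
Lemma dim_coordproj_sub U I I' : I' \subset I ->
  (\dim (mximage (coordproj R I') U) == \dim (mximage (coordproj R I) U)) <->
  (forall u, u \in U -> (forall i, i \in I' -> u i 0 = 0) -> forall i, i \in I -> u i 0 = 0).
Proof.
move=> sI; pose f := linfun (mulmx (coordproj R I') : 'cV[R]_n -> 'cV[R]_n).
have fE : mximage (coordproj R I') U = (f @: mximage (coordproj R I) U)%VS.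
  apply/vspaceP => v; apply/mem_mximage/memv_imgP => [[u uU ->]|[w /mem_mximage [u uU ->] ->]].
    exists (coordproj R I *m u); first by apply/mem_mximage; exists u.
    rewrite lfunE /=; apply/coordproj_eqP => i iI.
    by rewrite coordprojE (subsetP sI _ iI) mul1r.
  exists u => //; rewrite lfunE /=; apply/coordproj_eqP => i iI.
  by rewrite coordprojE (subsetP sI _ iI) mul1r.
have dimE := limg_ker_dim f (mximage (coordproj R I) U).
rewrite fE -dimE -[X in X == _]add0n eqn_add2r [_ == _]eq_sym dimv_eq0; split=> [/eqP cap0|H].
  move=> u uU u0 i iI.
  have : coordproj R I *m u \in (mximage (coordproj R I) U :&: lker f)%VS.
    rewrite memv_cap memv_ker; apply/andP; split; first by apply/mem_mximage; exists u.
    rewrite lfunE /= -(mulmx0 _ (coordproj R I')); apply/eqP/coordproj_eqP => k kI.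
    by rewrite coordprojE u0 // mulr0 mxE.
  rewrite cap0 memv0 => /eqP /matrixP/(_ i 0).
  by rewrite coordprojE iI mul1r mxE.
rewrite -subv0; apply/subvP => w; rewrite memv_cap memv_ker => /andP[/mem_mximage [u uU ->]].
rewrite lfunE /= -[X in _ == X](mulmx0 _ (coordproj R I')) => /eqP /coordproj_eqP u0.
rewrite memv0; apply/eqP; rewrite -(mulmx0 _ (coordproj R I)); apply/coordproj_eqP => i iI.
rewrite mxE; apply: (H u) => // k kI.
by have := u0 k kI; rewrite coordprojE (subsetP sI _ kI) mul1r mxE.
Qed.

Section Basis.
Variables (U : {vspace 'cV[R]_n}) (I I' : {set 'I_n}).
Hypothesis minI : minset (full_dim_subset U I) I'.

Lemma basis_sub : I' \subset I.
Proof. by have /minsetp/andP[] := minI. Qed.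

Lemma basis_determines u : u \in U -> (forall i, i \in I' -> u i 0 = 0) ->
  forall i, i \in I -> u i 0 = 0.
Proof. by have /minsetp/andP[sI] := minI; rewrite dim_coordproj_sub //; apply. Qed.

Lemma basis_unit i : i \in I' ->
  exists2 u, u \in U & forall k, k \in I' -> u k 0 = (k == i)%:R.
Proof.
move=> iI; apply: contrapT => H.
have /minsetP [/andP[sI /eqP dimI] minI'] := minI.
have sD : I' :\ i \subset I' by apply: subD1set.
suff e : I' :\ i = I' by move: iI; rewrite -e !inE eqxx.
apply: minI' => //; apply/andP; split; first exact: subset_trans sD sI.
rewrite -dimI dim_coordproj_sub // => u uU u0 k kI.
have [->|ki] := eqVneq k i; last by apply: u0; rewrite !inE ki.
apply/eqP/negPn/negP => ui; apply: H.
exists ((u i 0)^-1 *: u); rewrite ?memvZ // => l lI; rewrite mxE.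
have [->|li] := eqVneq l i; first by rewrite mulVf.
have ul : u l 0 = 0 by apply: u0; rewrite !inE li.
by rewrite ul mulr0.
Qed.

Definition vanishing : {vspace 'cV[R]_n} :=
  (U :&: lker (linfun (mulmx (coordproj R I') : 'cV[R]_n -> 'cV[R]_n)))%VS.

Lemma mem_vanishing u :
  u \in vanishing <-> u \in U /\ forall i, i \in I' -> u i 0 = 0.
Proof.
rewrite memv_cap memv_ker lfunE /= -[X in _ == X](mulmx0 _ (coordproj R I')).
split=> [/andP[uU /eqP/coordproj_eqP u0]|[uU u0]].
  by split=> // i /u0 ->; rewrite mxE.
by rewrite uU; apply/eqP/coordproj_eqP => i /u0 ->; rewrite mxE.
Qed.

(** The minimum-norm lifts of the unit vectors: orthogonality to the vectors of
    [U] that vanish on [I'] is the first-order condition. *)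
Definition lift_basis (Z : 'I_n -> 'cV[R]_n) : Prop := forall i, i \in I' ->
  [/\ Z i \in U, forall k, k \in I' -> Z i k 0 = (k == i)%:R
    & forall u, u \in vanishing -> dot (Z i) u = 0].

Lemma lift_basis_exists : exists Z, lift_basis Z.
Proof.
have [i|Z ZP] := @choice _ _ (fun i z => i \in I' -> [/\ z \in U,
  forall k, k \in I' -> z k 0 = (k == i)%:R & forall u, u \in vanishing -> dot z u = 0]);
  last by exists Z.
have [iI|] := boolP (i \in I'); last by exists 0.
have [u uU uE] := basis_unit iI.
have [w wN /mem_orthv uwN] := orthv_decomp vanishing u.
have /mem_vanishing [wU w0] := wN.
exists (u - w) => _; split => //; first by rewrite memvB.
by move=> k kI; rewrite !mxE uE // w0 // subr0.
Qed.

Variable Z : 'I_n -> 'cV[R]_n.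
Hypothesis ZP : lift_basis Z.

Definition comb q : 'cV[R]_n := \sum_(i in I') q i 0 *: Z i.

Lemma combE q j : comb q j 0 = \sum_(i in I') q i 0 * Z i j 0.
Proof. by rewrite summxE; apply: eq_bigr => i _; rewrite mxE. Qed.

Lemma comb_mem q : comb q \in U.
Proof. by apply: memv_suml => i /ZP [ZU _ _]; apply: memvZ. Qed.

Lemma comb_basis q k : k \in I' -> comb q k 0 = q k 0.
Proof.
move=> kI; rewrite combE (bigD1 k) //= big1 ?addr0.
  by have [_ -> //] := ZP kI; rewrite eqxx mulr1.
move=> i /andP[iI ik]; have [_ -> //] := ZP iI.
by rewrite eq_sym (negPf ik) mulr0.
Qed.

Lemma comb_orth q u : u \in vanishing -> dot (comb q) u = 0.
Proof.
move=> uN; rewrite /comb -big_filter dot_suml big_filter big1 // => i iI.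
by rewrite dotZl; have [_ _ ->] := ZP iI; rewrite ?mulr0.
Qed.

Lemma min_norm_liftP q z : min_norm_lift U I' q z <-> z = comb q.
Proof.
have combP v : v \in U -> coordproj R I' *m v = coordproj R I' *m q ->
    \sum_i v i 0 ^+ 2 = \sum_i comb q i 0 ^+ 2 + \sum_i (v - comb q) i 0 ^+ 2.
  move=> vU /coordproj_eqP vq.
  have vN : v - comb q \in vanishing.
    apply/mem_vanishing; split; first by rewrite memvB // comb_mem.
    by move=> i iI; rewrite !mxE vq // comb_basis // subrr.
  have d0 := comb_orth q vN.
  have -> : \sum_i v i 0 ^+ 2 = \sum_i comb q i 0 ^+ 2 + \sum_i (v - comb q) i 0 ^+ 2
      + 2 * dot (comb q) (v - comb q).
    rewrite /dot mulr_sumr -!big_split /=.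
    by apply: eq_bigr => i _; rewrite !mxE; ring.
  by rewrite d0 mulr0 addr0.
have combq : coordproj R I' *m comb q = coordproj R I' *m q.
  by apply/coordproj_eqP => i iI; rewrite comb_basis.
split=> [[[zU zq] zmin]|->]; last first.
  split; first by split=> //; apply: comb_mem.
  move=> v [vU vq]; rewrite norm2_le ?norm2_ge0 // sqr_norm2 (combP v) //.
  by rewrite lerDl sumsq_ge0.
have := zmin (comb q) (conj (comb_mem q) combq).
rewrite norm2_le ?norm2_ge0 // sqr_norm2 (combP z) // gerDl => le0.
apply/eqP; rewrite -subr_eq0; apply/eqP/dot_eq0/eqP.
rewrite eq_le dot_ge0 andbT; apply: le_trans le0.
by apply: ler_sum => i _; rewrite expr2.
Qed.

Lemma lift_matrixP B : lift_matrix U I I' B <->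
  forall i j, i \in I' -> j \notin I -> B j i = Z i j 0.
Proof.
split=> [lB i j iI jI|BE q z /min_norm_liftP -> j jI]; last first.
  by rewrite combE; apply: eq_bigr => i iI; rewrite BE // mulrC.
pose q : 'cV[R]_n := delta_mx i 0.
have /min_norm_liftP/lB/(_ j jI) := erefl (comb q).
have qE k : q k 0 = (k == i)%:R by rewrite mxE andbT.
rewrite combE (bigD1 i) //= big1 => [|k /andP[_ ki]]; last by rewrite qE (negPf ki) mul0r.
rewrite [RHS](bigD1 i) //= big1 => [|k /andP[_ ki]]; last by rewrite qE (negPf ki) mulr0.
by rewrite qE eqxx mul1r mulr1 !addr0.
Qed.

(** In a conformal decomposition of the lift of a unit vector e^i, a term that
    avoids i vanishes on the whole basis; being at once orthogonal and
    conformal to the lift, it is zero. Hence every term passes through i. *)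
Lemma lift_entry_le_kap i j : i \in I' -> `|Z i j 0| <= kap U i j.
Proof.
move=> iI; have [zU zI zO] := ZP iI.
have [gs [gel zE zN _]] := conformal_decomposition zU.
have zi : Z i i 0 = 1 by rewrite zI // eqxx.
rewrite -[leRHS]mulr1 -(normr1 R) -[X in _ * `|X|]zi !zN mulr_sumr.
rewrite big_seq [leRHS]big_seq ler_sum // => g gg.
have gel' := gel g gg; have [gU g0 _] := gel'.
apply: kap_geM => //; apply: contra g0 => /eqP gi0.
have gN : g \in vanishing.
  apply/mem_vanishing; split => // k kI.
  have [->//|ki] := eqVneq k i.
  have := conformal_le zE zN k gg; rewrite zI // (negPf ki) normr0 normr_le0.
  by move=> /eqP.
apply/eqP/matrixP => k l; rewrite ord1 [RHS]mxE.
have /eqP := zO g gN; rewrite psumr_eq0 => [/allP/(_ k (mem_index_enum _))|k' _]; last first.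
  by rewrite mulrC; apply: (conformal_sign zE zN k' gg).
rewrite /= mulf_eq0 => /orP[/eqP zk|/eqP //].
have := conformal_le zE zN k gg; rewrite zk normr0 normr_le0.
by move=> /eqP.
Qed.

Lemma lifting_basis : lifting U I (\matrix_(j, i) (if i \in I' then Z i j 0 else 0)).
Proof.
move=> u uU; exists (comb u); split; first exact: comb_mem.
  move=> i iI; apply/eqP; rewrite -subr_eq0; apply/eqP.
  have := @basis_determines (comb u - u); rewrite memvB ?comb_mem // => /(_ isT).
  move=> /(_ _ i iI); rewrite !mxE; apply => k kI.
  by rewrite !mxE comb_basis // subrr.
move=> j jI; rewrite combE [RHS](bigID (mem I')) /= [X in _ = _ + X]big1 => [|i].
  rewrite addr0; apply: eq_big => [i|i iI]; last by rewrite mxE iI mulrC.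
  by have [/(subsetP basis_sub) ->|] := boolP (i \in I'); rewrite ?andbF.
by move=> /andP[_ /negPf iI]; rewrite mxE iI mul0r.
Qed.

End Basis.

Lemma lift_max_ge I I' (B : 'M[R]_n) i j :
  i \in I' -> j \notin I -> `|B j i| <= Defs.lift_max I I' B.
Proof.
move=> iI jI; rewrite /Defs.lift_max.
apply: le_trans (le_bigmax_cond _ _ (_ : j \in ~: I)); last by rewrite inE.
exact: (le_bigmax_cond _ (fun i => `|B j i|) iI).
Qed.

Lemma lift_max_attained I I' (B : 'M[R]_n) : 0 < Defs.lift_max I I' B ->
  exists i j, [/\ i \in I', j \notin I & `|B j i| = Defs.lift_max I I' B].
Proof.
move=> H; apply: contrapT => none; move: H; apply/negP; rewrite -leNgt.
set M := Defs.lift_max I I' B; rewrite leNgt; apply/negP => M0.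
suff : M < M by rewrite ltxx.
rewrite {1}/M /Defs.lift_max; apply: bigmax_lt => // j; rewrite inE => jI.
apply: bigmax_lt => // i iI; rewrite lt_neqAle lift_max_ge // andbT.
by apply/eqP => e; apply: none; exists i, j.
Qed.

Lemma full_dim_basis_exists U I : exists I', minset (full_dim_subset U I) I'.
Proof.
have [|I' minI _] := @minset_exists _ (full_dim_subset U I) I; last by exists I'.
by rewrite /full_dim_subset subxx eqxx.
Qed.

Lemma verify_lift_exists U I (theta : R) : 0 < theta ->
  exists res, verify_lift U I theta res.
Proof.
move=> t0; have [I' minI] := full_dim_basis_exists U I.
have [Z ZP] := lift_basis_exists minI.
pose B : 'M[R]_n := \matrix_(j, i) Z i j 0.
have lB : lift_matrix U I I' B.
  by apply/(lift_matrixP I ZP B) => i j _ _; rewrite mxE.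
have [le|gt] := lerP (n%:R * Defs.lift_max I I' B) theta.
  by exists None, I', B; split.
have M0 : 0 < Defs.lift_max I I' B.
  have := lt_trans t0 gt; have := ler0n R n.
  by rewrite le_eqVlt => /orP[/eqP <-|n0]; rewrite ?mul0r ?ltxx // pmulr_rgt0.
have [i [j [iI jI ijM]]] := lift_max_attained M0.
by exists (Some (i, j, `|B j i|)), I', B; split.
Qed.

(** The bound by [kap] makes any coupling of the two sides visible in the
    imbalances. *)
Lemma verify_lift_pass U I (theta : R) : (0 < n)%N -> 0 <= theta ->
  verify_lift U I theta None ->
  exists2 B, lifting U I B & forall i j, `|B j i| <= theta / n%:R /\ `|B j i| <= kap U i j.
Proof.
move=> n0 t0 [I' [B [minI lB le]]]; have [Z ZP] := lift_basis_exists minI.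
have nR : 0 < n%:R :> R by rewrite ltr0n.
have BE := (lift_matrixP I ZP B).1 lB.
exists (\matrix_(j, i) (if (i \in I') && (j \notin I) then Z i j 0 else 0)).
  move=> u uU; have [u' [u'U uI uE]] := lifting_basis minI ZP uU.
  exists u'; split => // j jI; rewrite uE //.
  by apply: eq_bigr => i _; rewrite !mxE jI andbT.
move=> i j; rewrite mxE; case: ifP => [/andP[iI jI]|_].
  split; last exact: (lift_entry_le_kap ZP).
  rewrite -BE // ler_pdivlMr // mulrC (le_trans _ le) // ler_wpM2l ?ler0n //.
  exact: lift_max_ge.
by rewrite normr0 kap_ge0 divr_ge0 // ltW.
Qed.

Lemma verify_lift_fail U I (theta : R) i j t : (0 < n)%N ->
  verify_lift U I theta (Some (i, j, t)) ->
  [/\ i \in I, j \notin I, theta / n%:R < t & t <= kap U i j].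
Proof.
move=> n0 [I' [B [minI lB [lt iI jI BM tE]]]].
have [Z ZP] := lift_basis_exists minI.
have BE := (lift_matrixP I ZP B).1 lB.
split => //; first exact: (subsetP (basis_sub minI)).
  by rewrite tE BM ltr_pdivrMr ?ltr0n // mulrC.
by rewrite tE BE //; exact: (lift_entry_le_kap ZP).
Qed.

End Lifting.

(** * Strongly connected components and the subroutine Layering *)

Section Positions.
Context {n : nat}.
Implicit Types (E : {set 'I_n * 'I_n}) (Cs : seq {set 'I_n}).

Definition reach E : rel 'I_n := connect (fun u v => (u, v) \in E).
Definition sreach E : rel 'I_n := fun u v => reach E u v && reach E v u.

Lemma sreach_equiv E : {in [set: 'I_n] & &, equivalence_rel (sreach E)}.
Proof.
move=> u v w _ _ _; split; first by rewrite /sreach /reach connect0.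
have tr a b c : reach E a b -> reach E b c -> reach E a c by apply: connect_trans.
move=> /andP[uv vu]; apply/idP/idP => /andP[h1 h2]; apply/andP; split.
- exact: tr vu h1.
- exact: tr h2 uv.
- exact: tr uv h1.
- exact: tr h2 vu.
Qed.

Variables (E : {set 'I_n * 'I_n}) (Cs : seq {set 'I_n}).
Hypothesis CsE : enumerates Cs (strong_components E).

Lemma components_partition : finset.partition (strong_components E) [set: 'I_n].
Proof. exact: finset.equivalence_partitionP (@sreach_equiv E). Qed.

Lemma enumerates_uniq : uniq Cs.
Proof. by rewrite (perm_uniq CsE) enum_uniq. Qed.

Lemma mem_enumerates C : (C \in Cs) = (C \in strong_components E).
Proof. by rewrite (perm_mem CsE) mem_enum. Qed.

Lemma component_of u : exists2 C, C \in Cs & u \in C.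
Proof.
have /and3P[/eqP cov _ _] := components_partition.
have : u \in finset.cover (strong_components E) by rewrite cov inE.
by move=> /finset.bigcupP[C CE uC]; exists C; rewrite // mem_enumerates.
Qed.

Lemma position_lt_size u : (position Cs u < size Cs)%N.
Proof. by rewrite -has_find; apply/hasP; have [C] := component_of u; exists C. Qed.

Lemma nth_position u : u \in nth finset.set0 Cs (position Cs u).
Proof.
by have := nth_find finset.set0 (_ : has (fun C : {set 'I_n} => u \in C) Cs);
  rewrite has_find; apply; exact: position_lt_size.
Qed.

Lemma in_layer u k : (u \in layer Cs k) = (position Cs u == k).
Proof.
apply/idP/eqP => [uk|<-]; last exact: nth_position.
have [kS|kS] := ltnP k (size Cs); last first.
  by move: uk; rewrite /layer nth_default // inE.
have /and3P[_ tr _] := components_partition.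
apply/eqP; rewrite -(nth_uniq finset.set0 (position_lt_size u) kS enumerates_uniq).
apply/eqP; have inE k' : (k' < size Cs)%N -> nth finset.set0 Cs k' \in strong_components E.
  by move=> k'S; rewrite -mem_enumerates mem_nth.
rewrite -(finset.def_pblock tr (inE _ (position_lt_size u)) (nth_position u)).
by rewrite (finset.def_pblock tr (inE _ kS) uk).
Qed.

Lemma in_bigcup_seq u (s : seq {set 'I_n}) :
  (u \in \bigcup_(C <- s) C) = has (fun C : {set 'I_n} => u \in C) s.
Proof. by elim: s => [|C s IH]; rewrite ?big_nil ?big_cons ?inE // IH. Qed.

Lemma in_layers_lt u k : (u \in layers_lt Cs k) = (position Cs u < k)%N.
Proof.
rewrite in_bigcup_seq has_take // has_find; exact: position_lt_size.
Qed.

Lemma in_layers_ge u k : (u \in layers_ge Cs k) = (k <= position Cs u)%N.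
Proof.
rewrite in_bigcup_seq; apply/(has_nthP finset.set0)/idP => [[l lS]|kp].
  by rewrite nth_drop -/(layer _ _) in_layer => /eqP ->; rewrite leq_addr.
exists (position Cs u - k)%N; first by rewrite size_drop; have := position_lt_size u; lia.
by rewrite nth_drop subnKC // -/(layer _ _) in_layer.
Qed.

Lemma position_eq u v : (position Cs u == position Cs v) = sreach E u v.
Proof.
rewrite eq_sym -in_layer.
have /and3P[_ tr _] := components_partition.
have inC : layer Cs (position Cs u) \in strong_components E.
  by rewrite -mem_enumerates mem_nth // position_lt_size.
rewrite -(finset.def_pblock tr inC (nth_position u)).
by rewrite (finset.pblock_equivalence_partition (@sreach_equiv E)) ?inE.
Qed.

End Positions.

(** Sorting the components by the number of their predecessors is a
    topological order: a vertex that is reached from [v] has all the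
    predecessors of [v]. *)
Lemma topological_components n (E : {set 'I_n * 'I_n}) :
  exists2 Cs, enumerates Cs (strong_components E) &
    forall u v, (position Cs u < position Cs v)%N -> ~~ reach E v u.
Proof.
pose rank u := #|[set w | reach E w u]|.
pose f (C : {set 'I_n}) := (\max_(u in C) rank u)%N.
pose Cs := sort (relpre f leq) (enum (strong_components E)).
have CsE : enumerates Cs (strong_components E) by rewrite /enumerates perm_sort.
have sub u v : reach E v u -> [set w | reach E w v] \subset [set w | reach E w u].
  by move=> vu; apply/subsetP => w; rewrite !inE => wv; apply: connect_trans vu.
have fE u : f (layer Cs (position Cs u)) = rank u.
  apply/eqP; rewrite eqn_leq; apply/andP; split.
    apply/bigmax_leqP => v; rewrite (in_layer CsE) (position_eq CsE) => /andP[vu _].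
    exact: subset_leq_card (sub _ _ vu).
  by apply: (@leq_bigmax_cond _ (fun v => v \in layer Cs (position Cs u)) rank);
    rewrite (in_layer CsE).
exists Cs => // u v uv; apply/negP => vu.
have srt : sorted (relpre f leq) Cs by apply: sort_sorted => C D; exact: leq_total.
have le_rank : (rank u <= rank v)%N.
  rewrite -!fE; apply: (sorted_leq_nth _ _ finset.set0 srt); rewrite ?inE ?(ltnW uv) //;
    rewrite ?(position_lt_size CsE) //.
    by move=> x y z; apply: leq_trans.
  by move=> x; apply: leqnn.
have /eqP e : [set w | reach E w v] == [set w | reach E w u].
  by rewrite eqEcard sub // le_rank.
have : u \in [set w | reach E w v] by rewrite e inE /reach connect0.
rewrite inE => uv'; move: uv; rewrite ltn_neqAle (position_eq CsE) /sreach uv' vu.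
by [].
Qed.

(** The output of the subroutine Layering, as the analysis uses it. [U] is the
    rescaled subspace and [k] its imbalances; small values of the order [pos]
    come first. The statement is symmetric under passing to the orthogonal
    complement, transposing [k] and reversing [pos]. *)
Record balanced (R : realType) n (U : {vspace 'cV[R]_n}) (k : 'I_n -> 'I_n -> R)
    (sigma : R) (pos : 'I_n -> nat) : Prop := Balanced {
  bal_lift : forall r, exists2 B, lifting U [set i | (r < pos i)%N] B &
    forall i j, `|B j i| <= sigma /\ `|B j i| <= k i j;
  bal_fwd : forall i j, (pos i < pos j)%N -> sigma <= k i j;
  bal_conn : forall i j, pos i = pos j ->
    connect (fun u v => [&& pos u == pos i, pos v == pos i & sigma <= k u v]) i j
}.

(** The layer order is reversed, so the cut after position r becomes the
    complementary cut, to which [lifting_dual] applies. *)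
Lemma balanced_dual (R : realType) n (U : {vspace 'cV[R]_n}) k (sigma : R) pos (N : nat) :
  0 <= sigma -> (forall i j, 0 <= k i j) -> (forall i, (pos i <= N)%N) ->
  balanced U k sigma pos ->
  balanced (orthv U) (fun i j => k j i) sigma (fun i => (N - pos i)%N).
Proof.
move=> s0 k0 posN [lft fwd conn]; split.
- move=> r; have [rN|Nr] := ltnP r N; last first.
    exists 0; last by move=> i j; rewrite mxE normr0.
    have -> : [set i | (r < N - pos i)%N] = finset.set0.
      by apply/setP => i; rewrite !inE ltnNge (leq_trans (leq_subr _ _) Nr).
    exact: lifting_set0.
  have [B lB bB] := lft (N - r.+1)%N.
  exists (- B^T); last by move=> i j; rewrite !mxE normrN; apply: bB.
  have -> : [set i | (r < N - pos i)%N] = ~: [set i | (N - r.+1 < pos i)%N].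
    by apply/setP => i; rewrite !inE -leqNgt; have pN := posN i; apply/idP/idP; lia.
  exact: lifting_dual.
- move=> i j ij; apply: fwd; move: ij; have := posN i; have := posN j.
  by lia.
- move=> i j ij; have pij : pos i = pos j.
    by apply/eqP; rewrite -(eqn_sub2lE (posN i) (posN j)) ij.
  have := conn j i (esym pij); rewrite connect_rev; apply: connect_sub => u v /=.
  move=> /and3P[/eqP pv /eqP pu kvu]; apply: connect1.
  by rewrite pu pv pij !eqxx.
Qed.

Section Layering.
Context {R : realType} {m n : nat} (A : 'M[R]_(m, n)) (d : 'cV[R]_n).
Hypotheses (n0 : (0 < n)%N) (d0 : forall i, 0 < d i 0).
Implicit Types (kh : 'M[R]_n) (E : {set 'I_n * 'I_n}) (Cs J : seq {set 'I_n}).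

Let U := scalev d (kerspace A).

(** The imbalances of the rescaled kernel, in terms of those of the kernel, so
    that they can be compared for different values of [d]. *)
Definition kapd (i j : 'I_n) : R := kap (kerspace A) i j * d j 0 / d i 0.

(** The second condition makes any two indices adjacent in the estimated digraph,
    in one direction at least, so that its components are linearly ordered. *)
Definition sound_estimates kh : Prop :=
  (forall i j, 0 <= kh i j <= kap (kerspace A) i j) /\ (forall i j, 1 <= kh i j * kh j i).

Lemma gamma_gt0 : 0 < gamma R n.
Proof.
rewrite /gamma /beta0 divr_gt0 ?divr_gt0 ?ltr01 ?ltr0n //.
by rewrite mulr_gt0 ?exprn_gt0 ?ltr0n.
Qed.

Lemma gamma_small : gamma R n * (2 ^+ 13 * n%:R ^+ 5) = 1.
Proof.
rewrite /gamma /beta0; have nn : (n%:R : R) != 0 by rewrite pnatr_eq0 -lt0n.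
by field.
Qed.

Lemma sigma_gt0 : 0 < gamma R n / n%:R.
Proof. by rewrite divr_gt0 ?gamma_gt0 ?ltr0n. Qed.

Lemma sigma_le1 : gamma R n / n%:R <= 1.
Proof.
have n1 : 1 <= n%:R :> R by rewrite ler1n.
rewrite ler_pdivrMr ?ltr0n // mul1r (le_trans _ n1) //.
rewrite -[leRHS]gamma_small ler_peMr ?(ltW gamma_gt0) //.
by rewrite mulr_ege1 ?exprn_ege1 // ler1n.
Qed.

Lemma kapd_ge0 i j : 0 <= kapd i j.
Proof. by rewrite !mulr_ge0 ?kap_ge0 ?invr_ge0 ?(ltW (d0 _)). Qed.

Let sig := gamma R n / n%:R.

Lemma edge_total kh : sound_estimates kh ->
  forall u v, ((u, v) \in edge_set kh d sig) || ((v, u) \in edge_set kh d sig).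
Proof.
move=> [kh0 kh1] u v; rewrite !inE /=; apply/negPn; rewrite negb_or -!ltNge; apply/negP => /andP[h1 h2].
suff : (kh u v * d v 0 / d u 0) * (kh v u * d u 0 / d v 0) < 1.
  rewrite (_ : _ * _ = kh u v * kh v u) ?ltNge ?kh1 //.
  by field; rewrite !gt_eqF.
have p1 : 0 <= kh u v * d v 0 / d u 0.
  by have /andP[k0 _] := kh0 u v; rewrite !mulr_ge0 ?invr_ge0 ?(ltW (d0 _)).
have p2 : 0 <= kh v u * d u 0 / d v 0.
  by have /andP[k0 _] := kh0 v u; rewrite !mulr_ge0 ?invr_ge0 ?(ltW (d0 _)).
have s1 := sigma_le1; rewrite -/sig in s1.
rewrite -[ltRHS]mulr1 ltr_pM // (lt_le_trans _ s1) //.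
Qed.

Definition consistent kh0 E0 kh E : Prop :=
  [/\ forall i j, kh0 i j <= kh i j <= kap (kerspace A) i j, E0 \subset E
    & forall i j, (i, j) \in E -> sig <= kapd i j].

(** A failed test at a cut adds an edge across it that was absent before, with
    an imbalance that exceeds the threshold; estimates therefore only grow. *)
Lemma layering_loop_inv kh0 E0 Cs (ks : seq nat) kh E kh' E' :
  E0 = edge_set kh0 d sig ->
  (forall u v, (position Cs u < position Cs v)%N -> (v, u) \notin E0) ->
  (forall u k, (u \in layers_ge Cs k) = (k <= position Cs u)%N) ->
  consistent kh0 E0 kh E -> layering_loop U d Cs ks kh E kh' E' ->
  [/\ consistent kh0 E0 kh' E', E \subset E' & forall k, k \in ks ->
    verify_lift U (layers_ge Cs k) (gamma R n) None \/
    exists i j, [/\ (i, j) \in E', i \in layers_ge Cs k & j \notin layers_ge Cs k]].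
Proof.
move=> E0E back geE; elim: ks kh E => [|k ks IH] kh E /= cons; first by case=> -> ->.
move=> [[[[i j] t]|] vl loop]; last first.
  have [c1 c2 c3] := IH _ _ cons loop; split=> // k'.
  by rewrite inE => /orP[/eqP ->|/c3 //]; left.
have [iG jG lt_t le_t] := verify_lift_fail n0 vl.
have [kcons E0E' Ecap] := cons.
have tk : t <= kapd i j by apply: le_trans le_t _; apply: kap_scale_le.
have [|c1 c2 c3] := IH _ _ _ loop; last first.
- split=> //; first by apply: subset_trans c2; apply: finset.subsetUr.
  move=> k'; rewrite inE => /orP[/eqP ->|/c3 //]; right; exists i, j; split=> //.
  by apply: (subsetP c2); rewrite !inE eqxx.
- split.
  + move=> u v; rewrite mxE; case: ifP => [/andP[/eqP -> /eqP ->]|_]; last exact: kcons.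
    apply/andP; split; last first.
      rewrite ler_pdivrMr // -ler_pdivlMr //; exact: tk.
    have : (i, j) \notin E0.
      by apply: back; move: iG jG; rewrite !geE; lia.
    rewrite E0E inE /= -ltNge => /lt_trans/(_ lt_t) lt'.
    rewrite ler_pdivlMr // -ler_pdivrMr //; exact: ltW.
  + by apply: subset_trans E0E' _; apply: finset.subsetUr.
  + move=> u v; rewrite !inE => /orP[/eqP [-> ->]|]; last exact: Ecap.
    exact: le_trans (ltW lt_t) tk.
Qed.

Lemma layering_loop_exists Cs (ks : seq nat) kh E :
  exists kh' E', layering_loop U d Cs ks kh E kh' E'.
Proof.
elim: ks kh E => [|k ks IH] kh E /=; first by exists kh, E.
have [[[[i j] t]|] vl] := verify_lift_exists U (layers_ge Cs k) gamma_gt0.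
  have [kh' [E' loop]] := IH (update_mx kh i j (t * d i 0 / d j 0)) ((i, j) |: E).
  by exists kh', E', (Some (i, j, t)).
by have [kh' [E' loop]] := IH kh E; exists kh', E', None.
Qed.

Lemma edge_set_cap kh i j : sound_estimates kh -> (i, j) \in edge_set kh d sig ->
  sig <= kapd i j.
Proof.
move=> [kh0 _]; rewrite inE /= => /le_trans; apply.
by rewrite ler_wpM2r ?invr_ge0 ?(ltW (d0 _)) // ler_wpM2r ?(ltW (d0 _)) //; case/andP: (kh0 i j).
Qed.

Lemma reachS E E' u v : E \subset E' -> reach E u v -> reach E' u v.
Proof.
move=> sE; apply: connect_sub => a b ab; apply: connect1; exact: (subsetP sE).
Qed.

Lemma total_position kh E Cs : sound_estimates kh -> edge_set kh d sig \subset E ->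
  enumerates Cs (strong_components E) ->
  (forall u v, (position Cs u < position Cs v)%N -> ~~ reach E v u) ->
  forall u v, (position Cs u < position Cs v)%N ->
    (u, v) \in edge_set kh d sig /\ (v, u) \notin E.
Proof.
move=> snd sE CsE topo u v uv; have nr := topo u v uv; split; last first.
  by apply: contra nr => vu; apply: connect1.
have /orP[//|vu] := edge_total snd u v.
by case/negP: nr; apply: connect1; apply: (subsetP sE).
Qed.

Lemma layering_exists kh : sound_estimates kh -> exists out, layering A d kh out.
Proof.
move=> snd; pose E0 := edge_set kh d sig.
have [Cs CsE topo] := topological_components E0.
have [kh' [E loop]] := layering_loop_exists Cs (iota 1 (size Cs).-1) kh E0.
have [J JE topoJ] := topological_components E.
have tp := total_position snd (subxx _) CsE topo.
have cons : consistent kh E0 kh E0.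
  split=> //; last by move=> i j; apply: edge_set_cap.
  by move=> i j; rewrite lexx; have [kh0 _] := snd; case/andP: (kh0 i j).
have [||[_ sE _] _ _] := layering_loop_inv (erefl _) _ _ cons loop.
- by move=> u v /tp [].
- by move=> u k; apply: in_layers_ge CsE u k.
have tpJ := total_position snd sE JE topoJ.
exists (J, kh'), Cs, E; split=> //; first by move=> u v /tp [].
move=> u v uv; have [uvE vuE] := tpJ u v uv.
rewrite ltnNge leq_eqVlt; apply/negP => /orP[|/tp [vuE0 _]].
  rewrite (position_eq CsE) => /andP[vu uv'].
  move: uv; rewrite ltn_neqAle (position_eq JE) /sreach.
  by rewrite !(reachS sE).
by move: vuE; rewrite (subsetP sE _ vuE0).
Qed.

(** Cuts between the layers returned are cuts where the test passed: a failed
    test would have merged the two sides by an edge against the order. *)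
Lemma layering_spec kh J kh' : sound_estimates kh -> layering A d kh (J, kh') ->
  [/\ sound_estimates kh', exists E, enumerates J (strong_components E)
    & balanced U kapd sig (position J)].
Proof.
move=> snd [Cs [E [CsE fwd loop JE JCs]]].
pose E0 := edge_set kh d sig.
have cons : consistent kh E0 kh E0.
  split=> //; last by move=> i j; apply: edge_set_cap.
  by move=> i j; rewrite lexx; have [kh0 _] := snd; case/andP: (kh0 i j).
have back u v : (position Cs u < position Cs v)%N -> (v, u) \notin E0.
  move=> uv; apply/negP => vu; move: (uv); rewrite ltn_neqAle (position_eq CsE).
  move=> /andP[/negP h _]; apply: h; apply/andP; split; apply: connect1 => //.
  exact: fwd.
have geE u k := in_layers_ge CsE u k.
have [[kc sE Ecap] _ passed] := layering_loop_inv (erefl _) back geE cons loop.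
split; last 2 first.
- by exists E.
- split.
  + move=> r; set G := [set i | _].
    have [G0|/set0Pn [i0 i0G]] := eqVneq G finset.set0.
      rewrite G0; exists 0; first exact: lifting_set0.
      by move=> i j; rewrite mxE normr0 kapd_ge0 (ltW sigma_gt0).
    case: (arg_minnP (P := mem G) (position Cs) i0G) => v vG vmin.
    have GE : layers_ge Cs (position Cs v) = G.
      apply/setP => u; rewrite geE; apply/idP/idP => [vu|uG]; last exact: vmin.
      rewrite inE ltnNge; apply/negP => ur.
      have : (position J u < position J v)%N by rewrite (leq_ltn_trans ur) //; move: vG; rewrite !inE.
      by move=> /JCs; rewrite ltnNge vu.
    have [u0 u0r] : exists u, position J u = 0%N.
      have : (0 < size J)%N by apply: leq_ltn_trans (position_lt_size JE i0).
      move=> J0; have : layer J 0 \in strong_components E.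
        by rewrite -(mem_enumerates JE) mem_nth.
      have /and3P[_ _ nset0] := components_partition E.
      have [->|/set0Pn [u uJ] _] := eqVneq (layer J 0) finset.set0.
        by move=> h; move: nset0; rewrite h.
      by exists u; apply/eqP; rewrite -(in_layer JE).
    have v1 : position Cs v \in iota 1 (size Cs).-1.
      rewrite mem_iota; have := position_lt_size CsE v.
      have : (position Cs u0 < position Cs v)%N.
        by apply: JCs; rewrite u0r; move: vG; rewrite !inE; lia.
      by lia.
    have [vl|[i [j [ijE iG jG]]]] := passed _ v1.
      have [B lB bB] := verify_lift_pass n0 (ltW gamma_gt0) vl.
      rewrite GE in lB; exists B => // i j.
      by have [b1 b2] := bB i j; split=> //; apply: le_trans b2 _; apply: kap_scale_le.
    move: iG jG; rewrite GE !inE -leqNgt => iG jG.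
    have ji : (position J j < position J i)%N by apply: leq_ltn_trans iG.
    move: (ji); rewrite ltn_neqAle (position_eq JE) /sreach.
    rewrite /reach (connect1 (_ : (i, j) \in E)) // andbT.
    by rewrite (connect1 (_ : (j, i) \in E)) // (subsetP sE) // fwd // JCs.
  + by move=> u v uv; apply: Ecap; apply: (subsetP sE); apply: fwd; apply: JCs.
  + move=> u v /eqP; rewrite (position_eq JE) => /andP[uv vu].
    have /connectP [p pth vE] := uv.
    have {vE} : last u p = v by [].
    have : forall a, reach E a v -> reach E u a -> path (fun x y => (x, y) \in E) a p ->
      last a p = v -> connect (fun a b => [&& position J a == position J u,
        position J b == position J u & sig <= kapd a b]) a v.
      elim: p {pth} => [|b p IH] a av ua /=; first by move=> _ ->; apply: connect0.
      move=> /andP[ab pth] lst.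
      have ub : reach E u b := connect_trans ua (connect1 ab).
      have bv : reach E b v by apply/connectP; exists p.
      have same c : reach E u c -> reach E c v -> position J c == position J u.
        move=> uc cv; rewrite (position_eq JE) /sreach uc andbT.
        exact: connect_trans cv vu.
      apply: connect_trans (IH b bv ub pth lst); apply: connect1.
      by rewrite !same //= Ecap.
    by apply; rewrite // /reach connect0.
- have [kh0 kh1] := snd; split=> i j.
    have /andP[h1 h2] := kc i j; have /andP[h3 _] := kh0 i j.
    by rewrite h2 (le_trans h3).
  apply: le_trans (kh1 i j) _.
  have /andP[h1 _] := kc i j; have /andP[h2 _] := kc j i.
  have /andP[h3 _] := kh0 i j; have /andP[h4 _] := kh0 j i.
  by apply: ler_pM.
Qed.

End Layering.

(** * Layered least squares *)

Section Layered.
Context {R : realType} {n : nat}.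
Implicit Types (U : {vspace 'cV[R]_n}) (h p q z u : 'cV[R]_n) (pos : 'I_n -> nat).

(** First-order optimality of the residual [p] of a layered least squares
    problem over h + U: within each layer [p] is orthogonal to the vectors of
    [U] that vanish on all later layers. *)
Definition layered U h pos p : Prop :=
  p - h \in U /\ forall r z, z \in U -> (forall i, (r < pos i)%N -> z i 0 = 0) ->
    \sum_(i | pos i == r) p i 0 * z i 0 = 0.

Lemma memv_diff U h p q : p - h \in U -> q - h \in U -> p - q \in U.
Proof. move=> pU qU; have -> : p - q = (p - h) - (q - h) by rewrite opprB addrA subrK.
by rewrite memvB. Qed.

Lemma layered_exists U h pos : exists p, layered U h pos p.
Proof.
pose N := (\max_i pos i).+1.
suff H t : (t <= N)%N -> exists2 p, p - h \in U & forall r z, (N - t <= r)%N -> z \in U ->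
    (forall i, (r < pos i)%N -> z i 0 = 0) -> \sum_(i | pos i == r) p i 0 * z i 0 = 0.
  have [p pU pO] := H N (leqnn _); exists p; split=> // r z zU z0.
  by apply: pO; rewrite // subnn.
elim: t => [_|t IH tN].
  exists h; first by rewrite subrr mem0v.
  move=> r z rN _ _; rewrite big_pred0 // => i; apply/negP => /eqP ir.
  have : (pos i < N)%N by rewrite ltnS; apply: leq_bigmax.
  by rewrite ir ltnNge; move: rN; rewrite subn0 => ->.
have [p pU pO] := IH (ltnW tN).
pose r0 := (N - t.+1)%N.
pose S := vanishing U [set i | (r0 < pos i)%N].
pose L := [set i | pos i == r0].
have [u /mem_mximage [z0 z0S uE] uO] :=
  orthv_decomp (mximage (coordproj R L) S) (coordproj R L *m p).
have /mem_vanishing [z0U z00] := z0S.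
exists (p - z0); first by rewrite addrAC memvB.
move=> r z; rewrite leq_eqVlt => /orP[/eqP <-|lt_r] zU zv; last first.
  rewrite -[RHS](pO r z) //; last by move: lt_r; rewrite /r0; lia.
  apply: eq_bigr => i /eqP ir; rewrite !mxE z00 ?subr0 // inE ir; move: lt_r; rewrite /r0; lia.
have zS : z \in S by apply/mem_vanishing; split => // i; rewrite inE => /zv.
have LzS : coordproj R L *m z \in mximage (coordproj R L) S by apply/mem_mximage; exists z.
have /mem_orthv/(_ _ LzS) e0 := uO.
rewrite -[RHS]e0 uE -mulmxBr /dot [RHS](bigID (mem L)) /= [X in _ = _ + X]big1 ?addr0.
  rewrite [LHS](eq_bigl (mem L)) => [|i]; last by rewrite !inE.
  by apply: eq_bigr => i iL; rewrite !coordprojE (_ : i \in L) // !mul1r !mxE.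
by move=> i iL; rewrite !coordprojE (negPf iL) !mul0r.
Qed.

(** The restriction of [p] to a layer extends, by zero on earlier layers, to a
    vector orthogonal to [U]; the dual residual annihilates it. *)
Lemma layered_orthogonal U h pos p q (N : nat) : (forall i, (pos i <= N)%N) ->
  layered U h pos p -> layered (orthv U) h (fun i => N - pos i)%N q -> dot p q = 0.
Proof.
move=> posN [_ pO] [_ qO].
have layer0 r : (r <= N)%N -> \sum_(i | pos i == r) p i 0 * q i 0 = 0.
  move=> rN; pose L := [set i | pos i == r]; pose F := [set i | (pos i <= r)%N].
  pose Z := lker (linfun (mulmx (coordproj R F) : 'cV[R]_n -> 'cV[R]_n)).
  have inZ x : (x \in Z) = (coordproj R F *m x == 0) by rewrite memv_ker lfunE.
  have : coordproj R L *m p \in (orthv U + Z)%VS.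
    rewrite -(orthvK (orthv U + Z)%VS); apply/mem_orthv => y /mem_orthv yO.
    have yU : y \in U.
      rewrite -[U]orthvK; apply/mem_orthv => v vU; apply: yO.
      by rewrite -[v]addr0 memv_add // mem0v.
    have y0 i : (r < pos i)%N -> y i 0 = 0.
      move=> ir; have : dot y (delta_mx i 0) = 0.
        apply: yO; rewrite -[delta_mx _ _]add0r memv_add ?mem0v // inZ.
        apply/eqP/matrixP => k k'; rewrite ord1 coordprojE !mxE eqxx andbT inE.
        by have [->|] := eqVneq k i; rewrite ?mulr0 // leqNgt ir mul0r.
      rewrite /dot (bigD1 i) //= big1 => [|k ki]; last by rewrite mxE (negPf ki) mulr0.
      by rewrite mxE !eqxx mulr1 addr0.
    rewrite -[RHS](pO r y yU y0) /dot [LHS](bigID (mem L)) /= [X in _ + X]big1 ?addr0.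
      rewrite [LHS](eq_bigl (fun i => pos i == r)) => [|i]; last by rewrite !inE.
      by apply: eq_bigr => i iL; rewrite coordprojE inE iL mul1r.
    by move=> i iL; rewrite coordprojE (negPf iL) !mul0r.
  move=> /memv_addP [v vU [x]]; rewrite inZ => /eqP xZ vE.
  have vF i : (pos i <= r)%N -> v i 0 = (coordproj R L *m p) i 0.
    move=> ir; rewrite vE mxE; have /matrixP/(_ i 0) := xZ.
    by rewrite coordprojE inE ir mul1r [in RHS]mxE => ->; rewrite addr0.
  have e : \sum_(i | (N - pos i)%N == (N - r)%N) q i 0 * v i 0 = 0.
    apply: qO => // i ir; rewrite vF; last by have := posN i; lia.
    rewrite coordprojE inE; case: eqP; rewrite ?mul0r // => ir'.
    by move: ir; rewrite ir' ltnn.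
  rewrite -[RHS]e; apply: eq_big => [i|i /eqP ir].
    by have := posN i => pN; apply/idP/idP; lia.
  by rewrite vF ?ir // coordprojE inE ir eqxx mul1r mulrC.
rewrite /dot (partition_big (fun i => inord (pos i) : 'I_N.+1) predT) //=.
apply: big1 => r _; rewrite -[RHS](layer0 r); last by rewrite -ltnS.
by apply: eq_bigl => i; rewrite -val_eqE /= inordK // ltnS.
Qed.

Lemma lifting_bound (G : {set 'I_n}) (B : 'M[R]_n) (sigma : R) u u' j :
  (forall i, `|B j i| <= sigma) -> u' j 0 = \sum_(i in G) B j i * u i 0 ->
  `|u' j 0| <= sigma * \sum_i `|u i 0|.
Proof.
move=> Bs ->; rewrite (le_trans (ler_norm_sum _ _ _)) // mulr_sumr.
rewrite [leRHS](bigID (mem G)) /= ler_wpDr //.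
  by apply: sumr_ge0 => i _; rewrite mulr_ge0 // (le_trans _ (Bs i)).
by apply: ler_sum => i _; rewrite normrM ler_wpM2r.
Qed.

(** With small liftings the layers nearly decouple [U], so the layered residual
    is close to the ordinary least squares residual. *)
Lemma layered_close U k sigma h pos p pa i :
  balanced U k sigma pos -> layered U h pos p ->
  pa - h \in U -> pa \in orthv U ->
  `|p i 0 - pa i 0| <= n%:R * sigma * \sum_j `|p j 0|.
Proof.
move=> [lft _ _] [pU pO] paU /mem_orthv paO.
pose z := p - pa.
have zU : z \in U by apply: memv_diff pU paU.
have zE j : z j 0 = p j 0 - pa j 0 by rewrite !mxE.
rewrite -zE; set P := \sum_j _.
have [i0 _ i0max] := @arg_maxP _ _ _ i predT (fun j => `|z j 0|) isT.
apply: le_trans (i0max i isT) _; set M := `|z i0 0|.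
have M0 : 0 <= M by apply: normr_ge0.
have s0 : 0 <= sigma by have [B _ /(_ i i) [h1 _]] := lft 0%N; apply: le_trans h1.
have P0 : 0 <= P by rewrite sumr_ge0.
have pz : dot p z <= n%:R * sigma * P * M.
  pose N := (\max_j pos j)%N.
  have sumz : \sum_j `|z j 0| <= n%:R * M.
    rewrite -[n in n%:R]card_ord -sum1_card natr_sum mulr_suml ler_sum // => j _.
    by rewrite mul1r; apply: i0max.
  rewrite /dot (partition_big (fun i => inord (pos i) : 'I_N.+1) predT) //=.
  rewrite /P mulr_sumr mulr_suml.
  rewrite [leRHS](partition_big (fun i => inord (pos i) : 'I_N.+1) predT) //=.
  apply: ler_sum => r _; have [B lB bB] := lft r.
  have [z' [z'U z'G z'E]] := lB z zU.
  have e j : (inord (pos j) == r :> 'I_N.+1) = (pos j == r).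
    by rewrite -val_eqE /= inordK // ltnS; apply: leq_bigmax.
  rewrite (eq_bigl _ _ e) [leRHS](eq_bigl _ _ e).
  have e0 : \sum_(j | pos j == r) p j 0 * (z - z') j 0 = 0.
    by apply: (pO _ _ (memvB zU z'U)) => j jr; rewrite mxE [X in _ + X]mxE z'G ?inE ?subrr.
  move: e0; have -> : \sum_(j | pos j == r) p j 0 * (z - z') j 0 =
      \sum_(j | pos j == r) p j 0 * z j 0 - \sum_(j | pos j == r) p j 0 * z' j 0.
    by rewrite -sumrB; apply: eq_bigr => j _; rewrite !mxE mulrBr.
  move=> /eqP; rewrite subr_eq0 => /eqP ->.
  apply: ler_sum => j /eqP jr; apply: le_trans (ler_norm _) _.
  have jG : j \notin [set i | (r < pos i)%N] by rewrite inE jr ltnn.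
  have := lifting_bound (sigma := sigma) (fun i' => (bB i' j).1) (z'E j jG).
  move=> le; rewrite normrM; apply: (le_trans (ler_wpM2l (normr_ge0 _) le)).
  have h1 : sigma * \sum_i `|z i 0| <= sigma * (n%:R * M) by apply: ler_wpM2l.
  apply: (le_trans (ler_wpM2l (normr_ge0 _) h1)).
  by rewrite le_eqVlt; apply/orP; left; apply/eqP; ring.
have zz : dot z z = dot p z.
  by rewrite {1}/z dotBl paO // subr0.
have MM : M * M <= dot z z.
  rewrite /dot (bigD1 i0) //= -expr2 /M real_normK ?num_real // expr2 lerDl.
  by apply: sumr_ge0 => j _; rewrite -expr2 sqr_ge0.
have [M1|M1] := eqVneq M 0; first by rewrite M1 !mulr_ge0.
have Mp : 0 < M by rewrite lt_def M1.
by rewrite -(ler_pM2r Mp) (le_trans MM) // zz.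
Qed.

(** Feasible points cannot be much smaller on a layer than its residual: moving
    from [p] to [z] inside the layer, after lifting the change on later layers
    at small cost, is a competitor in the layer's least squares problem. *)
Lemma layered_pin U (B : 'M[R]_n) h pos p z i :
  layered U h pos p -> z - h \in U ->
  lifting U [set j | (pos i < pos j)%N] B ->
  exists2 j, pos j = pos i &
    `|p i 0| <= n%:R * (`|z j 0|
      + \sum_(l in [set j | (pos i < pos j)%N]) `|B j l| * `|z l 0 - p l 0|).
Proof.
move=> [pU pO] zU lB; set r := pos i; set G := [set j | _].
pose u := z - p.
have uU : u \in U by apply: memv_diff zU pU.
have [u' [u'U u'G u'E]] := lB u uU.
have : \sum_(j | pos j == r) p j 0 * (u - u') j 0 = 0.
  by apply: (pO _ _ (memvB uU u'U)) => j jr; rewrite mxE [X in _ + X]mxE u'G ?inE ?subrr.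
have -> : \sum_(j | pos j == r) p j 0 * (u - u') j 0 =
    \sum_(j | pos j == r) p j 0 * (z j 0 - u' j 0) - \sum_(j | pos j == r) p j 0 ^+ 2.
  by rewrite -sumrB; apply: eq_bigr => j _; rewrite !mxE; ring.
move=> /eqP; rewrite subr_eq0 => /eqP e.
have ir : (fun j => pos j == r) i by rewrite /= eqxx.
have [i1 /eqP i1r i1max] := @arg_maxP _ _ _ i (fun j => pos j == r) (fun j => `|p j 0|) ir.
have [j /eqP jr jmax] :=
  @arg_maxP _ _ _ i (fun j => pos j == r) (fun j => `|z j 0 - u' j 0|) ir.
exists j => //; apply: le_trans (i1max i ir) _.
have H : `|p i1 0| <= n%:R * `|z j 0 - u' j 0|.
  have [->|p1] := eqVneq `|p i1 0| 0; first by rewrite mulr_ge0.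
  have pp : 0 < `|p i1 0| by rewrite lt_def p1 normr_ge0.
  rewrite -(ler_pM2l pp) -expr2 real_normK ?num_real //.
  have : p i1 0 ^+ 2 <= \sum_(j | pos j == r) p j 0 ^+ 2.
    by rewrite (bigD1 i1) ?i1r ?eqxx //= lerDl sumr_ge0 // => l _; rewrite sqr_ge0.
  move=> /le_trans; apply; rewrite -e.
  apply: (@le_trans _ _ (\sum_(l | pos l == r) `|p i1 0| * `|z j 0 - u' j 0|)).
    apply: ler_sum => l lr; apply: le_trans (ler_norm _) _; rewrite normrM.
    by apply: ler_pM => //; [exact: i1max | exact: jmax].
  rewrite mulrCA [X in _ <= X](_ : _ = \sum_(l < n) `|p i1 0| * `|z j 0 - u' j 0|).
    rewrite [leRHS](bigID (fun l => pos l == r)) /= lerDl sumr_ge0 // => l _.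
    by rewrite mulr_ge0.
  by rewrite sumr_const card_ord mulr_natl.
apply: le_trans H _; rewrite ler_wpM2l // (le_trans (ler_normB _ _)) // lerD2l.
rewrite u'E; last by rewrite inE jr ltnn.
rewrite (le_trans (ler_norm_sum _ _ _)) // ler_sum // => l _.
by rewrite normrM !mxE.
Qed.

End Layered.

(** * Steps of the interior point method *)

Section NormTriangle.
Context {R : realType} {n : nat}.
Implicit Types (u v : 'cV[R]_n).

Lemma dot_le_norm2 u v : dot u v <= norm2 u * norm2 v.
Proof.
have [u0|u0] := eqVneq (norm2 u) 0.
  have u00 i : u i 0 = 0.
    by apply/eqP; rewrite -normr_le0 -u0; exact: coord_le_norm2.
  by rewrite u0 mul0r /dot big1 // => i _; rewrite u00 mul0r.
have up : 0 < norm2 u by rewrite lt_def u0 norm2_ge0.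
apply: le_trans (ler_norm _) _.
rewrite -ler_sqr ?nnegrE ?mulr_ge0 ?norm2_ge0 // real_normK ?num_real // exprMn.
have : 0 <= \sum_i (norm2 u ^+ 2 * v i 0 - dot u v * u i 0) ^+ 2.
  by apply: sumr_ge0 => i _; rewrite sqr_ge0.
have key D : \sum_i (norm2 u ^+ 2 * v i 0 - D * u i 0) ^+ 2 =
    norm2 u ^+ 2 * (norm2 u ^+ 2 * norm2 v ^+ 2 - 2 * D * dot u v + D ^+ 2).
  transitivity (norm2 u ^+ 2 * (norm2 u ^+ 2) * (\sum_i v i 0 ^+ 2)
    - 2 * norm2 u ^+ 2 * D * (\sum_i u i 0 * v i 0) + D ^+ 2 * (\sum_i u i 0 ^+ 2)).
    rewrite !mulr_sumr -sumrB -big_split /=.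
    by apply: eq_bigr => i _; ring.
  by rewrite -!sqr_norm2 -/(dot u v); ring.
rewrite key pmulr_rge0 ?exprn_gt0 //; nra.
Qed.

Lemma norm2D u v : norm2 (u + v) <= norm2 u + norm2 v.
Proof.
rewrite norm2_le ?addr_ge0 ?norm2_ge0 //.
have -> : \sum_i (u + v) i 0 ^+ 2 = norm2 u ^+ 2 + 2 * dot u v + norm2 v ^+ 2.
  by rewrite !sqr_norm2 /dot mulr_sumr -!big_split /=; apply: eq_bigr => i _; rewrite !mxE; ring.
have := dot_le_norm2 u v; nra.
Qed.

Lemma norm2Z a v : norm2 (a *: v) = `|a| * norm2 v.
Proof.
rewrite /norm2 -sqrtr_sqr -sqrtrM ?sqr_ge0 // mulr_sumr; congr Num.sqrt.
by apply: eq_bigr => i _; rewrite mxE exprMn.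
Qed.

End NormTriangle.

(** Two positive quantities moving linearly with a positive product cannot
    change sign, as the first one to vanish would make the product vanish. *)
Lemma line_gt0 (R : realType) (x s a b t : R) : 0 < x -> 0 < s -> 0 <= t ->
  (forall r, 0 <= r <= t -> 0 < (x + r * a) * (s + r * b)) -> 0 < x + t * a.
Proof.
move=> x0 s0 t0 H; rewrite ltNge; apply/negP => xa.
have a0 : a < 0 by rewrite ltNge; apply/negP => a0; have := mulr_ge0 t0 a0; lra.
have := H (x / - a); rewrite (_ : x + x / - a * a = 0) ?mul0r ?ltxx; last first.
  by field; rewrite lt_eqF.
suff -> : 0 <= x / - a <= t by move/(_ isT).
rewrite divr_ge0 ?oppr_ge0 ?(ltW x0) ?(ltW a0) //=.
by rewrite ler_pdivrMr ?oppr_gt0 // mulrN; lra.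
Qed.

Section InteriorPoint.
Context {R : realType} {m n : nat} (A : 'M[R]_(m, n)) (b : 'cV[R]_m) (c : 'cV[R]_n).
Hypothesis n0 : (0 < n)%N.
Implicit Types (w d : pdpoint R m n).

Local Notation mu := Defs.mu.

Let nR : 0 < n%:R :> R. Proof. by rewrite ltr0n. Qed.

Lemma muE w : n%:R * mu w = \sum_i xpart w i 0 * spart w i 0.
Proof. by rewrite mulrC /Defs.mu divfK // gt_eqF. Qed.

Lemma mu_gt0 w : strictly_feasible A b c w -> 0 < mu w.
Proof.
move=> [_ x0 _ s0]; rewrite divr_gt0 // /dot (bigD1 (Ordinal n0)) //= ltr_wpDr ?mulr_gt0 //.
by apply: sumr_ge0 => i _; rewrite mulr_ge0 ?ltW.
Qed.

Lemma neighborhood_coord (beta : R) w i : neighborhood A b c beta w ->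
  (1 - beta) * mu w <= xpart w i 0 * spart w i 0 <= (1 + beta) * mu w.
Proof.
move=> [sf nb]; have m0 := mu_gt0 sf.
have := le_trans (coord_le_norm2 _ i) nb; rewrite !mxE ler_norml => /andP[h1 h2].
move: h1 h2; rewrite mulrC => h1 h2.
by apply/andP; split; [rewrite -ler_pdivlMr // | rewrite -ler_pdivrMr //]; lra.
Qed.

Lemma feasible_orth (x x' s s' : 'cV[R]_n) (y y' : 'cV[R]_m) :
  A *m x = b -> A *m x' = b -> A^T *m y + s = c -> A^T *m y' + s' = c ->
  dot (x - x') (s - s') = 0.
Proof.
move=> xb xb' sc sc'.
have -> : s - s' = A^T *m (y' - y).
  by rewrite mulmxBr -[s](addKr (A^T *m y)) sc -sc' addrA [- _ + _]addrC addrK.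
by rewrite -dot_mulmx mulmxBr xb xb' subrr dot0l.
Qed.

(** Orthogonality of x - x' and s - s' bounds the mixed products, so later
    points of the neighborhood cannot grow by more than a factor of order n. *)
Lemma near_monotone w w' (lo : R) : strictly_feasible A b c w ->
  strictly_feasible A b c w' -> mu w' <= mu w -> 0 < lo ->
  (forall i, lo * mu w <= xpart w i 0 * spart w i 0) ->
  lo * (\sum_i xpart w' i 0 / xpart w i 0) <= 2 * n%:R /\
  lo * (\sum_i spart w' i 0 / spart w i 0) <= 2 * n%:R.
Proof.
move=> sf sf' le lo0 near; have m0 := mu_gt0 sf.
have [xb x0 sc s0] := sf; have [xb' x0' sc' s0'] := sf'.
have orth := feasible_orth xb xb' sc sc'.
have tot : \sum_i (xpart w' i 0 * spart w i 0) + \sum_i (xpart w i 0 * spart w' i 0)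
    <= 2 * n%:R * mu w.
  apply: (@le_trans _ _ (n%:R * mu w + n%:R * mu w')); last first.
    by have := ler_wpM2l (ltW nR) le; lra.
  rewrite !muE -[leLHS]addr0 -[X in _ + X]orth /dot -!big_split /=.
  by apply: ler_sum => i _; rewrite !mxE le_eqVlt; apply/orP; left; apply/eqP; ring.
have p1 : 0 <= \sum_i (xpart w' i 0 * spart w i 0).
  by apply: sumr_ge0 => i _; rewrite mulr_ge0 ?ltW.
have p2 : 0 <= \sum_i (xpart w i 0 * spart w' i 0).
  by apply: sumr_ge0 => i _; rewrite mulr_ge0 ?ltW.
split; rewrite -(ler_pM2r m0) mulrAC mulr_sumr.
- apply: le_trans (_ : _ <= \sum_i (xpart w' i 0 * spart w i 0)) _; last lra.
  apply: ler_sum => i _.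
  have -> : lo * mu w * (xpart w' i 0 / xpart w i 0) =
      (lo * mu w) * (xpart w i 0)^-1 * xpart w' i 0 by ring.
  by rewrite [leRHS]mulrC ler_wpM2r ?(ltW (x0' i)) // ler_pdivrMr // [leRHS]mulrC near.
- apply: le_trans (_ : _ <= \sum_i (xpart w i 0 * spart w' i 0)) _; last lra.
  apply: ler_sum => i _.
  have -> : lo * mu w * (spart w' i 0 / spart w i 0) =
      (lo * mu w) * (spart w i 0)^-1 * spart w' i 0 by ring.
  by rewrite ler_wpM2r ?(ltW (s0' i)) // ler_pdivrMr // near.
Qed.

Definition direction d : Prop := A *m xpart d = 0 /\ A^T *m ypart d + spart d = 0.

Lemma direction_orth d : direction d -> dot (xpart d) (spart d) = 0.
Proof.
move=> [dx ds]; have -> : spart d = A^T *m (- ypart d).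
  by rewrite mulmxN; apply/eqP; rewrite -addr_eq0 addrC ds.
by rewrite -dot_mulmx dx dot0l.
Qed.

Lemma direction_step w d (t : R) : A *m xpart w = b -> A^T *m ypart w + spart w = c ->
  direction d -> A *m xpart (w + t *: d) = b /\
  A^T *m ypart (w + t *: d) + spart (w + t *: d) = c.
Proof.
move=> xb sc [dx ds]; split; first by rewrite /= mulmxDr -scalemxAr dx scaler0 addr0.
rewrite /= mulmxDr -scalemxAr addrACA sc -scalerDr ds scaler0 addr0 //.
Qed.

Lemma mu_step w d (t : R) : direction d ->
  mu (w + t *: d) = mu w + t * ((dot (spart w) (xpart d) + dot (xpart w) (spart d)) / n%:R).
Proof.
move=> dd; rewrite /Defs.mu /= dotDl !dotDr !dotZl !dotZr (direction_orth dd).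
by rewrite !mulr0 addr0 (dotC (xpart d)); ring.
Qed.

(** The second-order term of a step is bounded by a weighted norm of the right
    hand side of the Newton equation, since the two parts are orthogonal. *)
Lemma second_order_bound w d (r : 'cV[R]_n) :
  (forall i, 0 < xpart w i 0) -> (forall i, 0 < spart w i 0) -> direction d ->
  cmul (spart w) (xpart d) + cmul (xpart w) (spart d) = r ->
  \sum_i `|xpart d i 0 * spart d i 0|
    <= 2^-1 * \sum_i r i 0 ^+ 2 / (xpart w i 0 * spart w i 0).
Proof.
move=> x0 s0 /direction_orth dd rE.
rewrite -[leRHS]subr0 -[X in _ <= _ - X]dd mulr_sumr /dot -sumrB; apply: ler_sum => i _.
have -> : r i 0 = spart w i 0 * xpart d i 0 + xpart w i 0 * spart d i 0.
  by rewrite -rE !mxE.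
move: (xpart w i 0) (spart w i 0) (xpart d i 0) (spart d i 0) (x0 i) (s0 i) => x s dx ds xp sp.
have xs : 0 < x * s by rewrite mulr_gt0.
rewrite -(ler_pM2r xs).
have -> : (2^-1 * ((s * dx + x * ds) ^+ 2 / (x * s)) - dx * ds) * (x * s) =
    2^-1 * ((s * dx) ^+ 2 + (x * ds) ^+ 2) by field; rewrite !gt_eqF.
rewrite -[x * s in leLHS](gtr0_norm xs) -normrM.
rewrite (_ : dx * ds * (x * s) = (s * dx) * (x * ds)); last ring.
move: (s * dx) (x * ds) => u v.
have h1 := sqr_ge0 (u + v); have h2 := sqr_ge0 (u - v).
by rewrite ler_norml; apply/andP; split; nra.
Qed.

Lemma optimal_of_mu0 w : A *m xpart w = b -> A^T *m ypart w + spart w = c ->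
  (forall i, 0 <= xpart w i 0) -> (forall i, 0 <= spart w i 0) -> mu w = 0 ->
  optimal A b c w.
Proof.
move=> xb sc x0 s0 m0.
have gap x y s : A *m x = b -> A^T *m y + s = c -> dot c x = dot b y + dot x s.
  by move=> <- <-; rewrite dotDl (dotC _ x) -dot_mulmx (dotC _ y) (dotC s).
have dxs : dot (xpart w) (spart w) = 0.
  by move/eqP: m0; rewrite mulf_eq0 invr_eq0 (gt_eqF nR) orbF => /eqP.
split; rewrite /primal_feasible /dual_feasible //.
- move=> x [xb' x0']; rewrite (gap _ _ _ xb sc) (gap _ _ _ xb' sc) dxs addr0 lerDl.
  by apply: sumr_ge0 => i _; rewrite mulr_ge0.
- move=> y s [sc' s0'].
  have e1 := gap _ _ _ xb sc; have e2 := gap _ _ _ xb sc'.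
  have : 0 <= dot (xpart w) s by apply: sumr_ge0 => i _; rewrite mulr_ge0.
  by rewrite dxs in e1; lra.
Qed.

(** The bound is assumed for all shorter steps as well: at the end point alone it
    could not exclude that x_i and s_i have changed sign together. *)
Lemma predictor_step w d (a : R) : neighborhood A b c (1 / 8) w -> direction d ->
  dot (spart w) (xpart d) + dot (xpart w) (spart d) = - (n%:R * mu w) ->
  0 <= a <= 1 ->
  (forall t, 0 <= t <= a ->
    norm2 (cmul (xpart w + t *: xpart d) (spart w + t *: spart d)
           - (1 - t) *: cmul (xpart w) (spart w)) <= (1 - t) * mu w / 8) ->
  [/\ mu (w + a *: d) = (1 - a) * mu w,
      a < 1 -> neighborhood A b c (1 / 4) (w + a *: d)
    & a = 1 -> optimal A b c (w + a *: d)].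
Proof.
move=> nb dd lin /andP[a0 a1] H.
have [sf nbn] := nb; have [xb x0 sc s0] := sf; have m0 := mu_gt0 sf.
have muE' t : mu (w + t *: d) = (1 - t) * mu w.
  by rewrite mu_step // lin mulNr mulrAC mulfV ?mul1r ?gt_eqF //; ring.
have near t : 0 <= t <= a -> t < 1 ->
    norm2 ((mu (w + t *: d))^-1 *: cmul (xpart (w + t *: d)) (spart (w + t *: d))
           - const_mx 1) <= 1 / 4.
  move=> ta t1; have mt : 0 < (1 - t) * mu w by rewrite mulr_gt0 // subr_gt0.
  rewrite muE'.
  have -> : ((1 - t) * mu w)^-1 *: cmul (xpart (w + t *: d)) (spart (w + t *: d)) - const_mx 1
    = ((mu w)^-1 *: cmul (xpart w) (spart w) - const_mx 1) +
      ((1 - t) * mu w)^-1 *: (cmul (xpart w + t *: xpart d) (spart w + t *: spart d)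
           - (1 - t) *: cmul (xpart w) (spart w)).
    apply/matrixP => i j; rewrite !mxE; field; by rewrite !gt_eqF // subr_gt0.
  apply: le_trans (norm2D _ _) _.
  rewrite (_ : 1 / 4 = 1 / 8 + 1 / 8 :> R); last lra.
  apply: lerD => //; rewrite norm2Z ger0_norm ?invr_ge0 ?(ltW mt) //.
  by rewrite ler_pdivrMl // (le_trans (H t ta)) //; lra.
have prod t i : 0 <= t <= a -> t < 1 ->
    0 < (xpart w i 0 + t * xpart d i 0) * (spart w i 0 + t * spart d i 0).
  move=> ta t1; have mt : 0 < (1 - t) * mu w by rewrite mulr_gt0 // subr_gt0.
  have := le_trans (coord_le_norm2 _ i) (near t ta t1).
  rewrite muE' !mxE ler_norml => /andP[h _].
  rewrite -(pmulr_rgt0 _ (_ : 0 < ((1 - t) * mu w)^-1)) ?invr_gt0 //; lra.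
have posx t : 0 <= t <= a -> t < 1 -> forall i, 0 < xpart w i 0 + t * xpart d i 0.
  move=> /andP[t0 ta] t1 i; apply: (line_gt0 (b := spart d i 0) (x0 i) (s0 i) t0).
  by move=> r /andP[r0 rt]; apply: prod; [rewrite r0 (le_trans rt) | apply: le_lt_trans t1].
have poss t : 0 <= t <= a -> t < 1 -> forall i, 0 < spart w i 0 + t * spart d i 0.
  move=> /andP[t0 ta] t1 i; apply: (line_gt0 (b := xpart d i 0) (s0 i) (x0 i) t0).
  move=> r /andP[r0 rt]; rewrite mulrC.
  by apply: prod; [rewrite r0 (le_trans rt) | apply: le_lt_trans t1].
have [xb' sc'] := direction_step a xb sc dd.
have aa : 0 <= a <= a by rewrite a0 lexx.
split; first exact: muE'.
- move=> lt1; split; last exact: near.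
  by split => // i; rewrite !mxE; [apply: posx | apply: poss].
- move=> e; apply: optimal_of_mu0 => //; last by rewrite muE' e subrr mul0r.
    move=> i; rewrite !mxE e mul1r leNgt; apply/negP => neg.
    have xd : xpart d i 0 < 0 by have := x0 i; lra.
    have q1 : xpart w i 0 / - xpart d i 0 < 1 by rewrite ltr_pdivrMr ?oppr_gt0 //; lra.
    have q0 : 0 <= xpart w i 0 / - xpart d i 0 by rewrite divr_ge0 ?oppr_ge0 ?(ltW xd) ?(ltW (x0 i)).
    have := posx (xpart w i 0 / - xpart d i 0); rewrite q0 e (ltW q1) => /(_ isT q1 i).
    by rewrite (_ : _ + _ = 0) ?ltxx //; field; rewrite lt_eqF.
  move=> i; rewrite !mxE e mul1r leNgt; apply/negP => neg.
  have xd : spart d i 0 < 0 by have := s0 i; lra.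
  have q1 : spart w i 0 / - spart d i 0 < 1 by rewrite ltr_pdivrMr ?oppr_gt0 //; lra.
  have q0 : 0 <= spart w i 0 / - spart d i 0 by rewrite divr_ge0 ?oppr_ge0 ?(ltW xd) ?(ltW (s0 i)).
  have := poss (spart w i 0 / - spart d i 0); rewrite q0 e (ltW q1) => /(_ isT q1 i).
  by rewrite (_ : _ + _ = 0) ?ltxx //; field; rewrite lt_eqF.
Qed.

(** The right hand side is split along the kernel and its orthogonal complement,
    both rescaled by delta. *)
Lemma newton_solvable w (r : 'cV[R]_n) :
  (forall i, 0 < xpart w i 0) -> (forall i, 0 < spart w i 0) ->
  exists d, direction d /\ cmul (spart w) (xpart d) + cmul (xpart w) (spart d) = r.
Proof.
move=> x0 s0; set W := kerspace A.
have sx i : 0 < Num.sqrt (xpart w i 0) by rewrite sqrtr_gt0.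
have ss i : 0 < Num.sqrt (spart w i 0) by rewrite sqrtr_gt0.
have del0 i : 0 < Defs.delta w i 0 by rewrite mxE divr_gt0.
pose v : 'cV[R]_n := \col_i (r i 0 / (Num.sqrt (xpart w i 0) * Num.sqrt (spart w i 0))).
have [u uU] := orthv_decomp (scalev (Defs.delta w) W) v.
move/mem_scalevP: uU => [dx dxW uE]; rewrite orthv_scale // => /mem_scalevP [ds].
rewrite -rangespace_tr => /mem_rangespaceP [y dsE] vuE.
exists (dx, - y, ds); split; first split => /=.
- by apply/eqP; rewrite -mem_kerspace.
- by rewrite mulmxN -dsE addNr.
apply/matrixP => i j; rewrite ord1 !mxE /=.
have /matrixP/(_ i 0) := vuE; rewrite uE !mxE.
have := sqr_sqrtr (ltW (x0 i)); have := sqr_sqrtr (ltW (s0 i)).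
move: (sx i) (ss i).
set X := Num.sqrt (xpart w i 0); set S := Num.sqrt (spart w i 0).
move: X S => X S X0 S0 sE xE e; rewrite -sE -xE.
have -> : ds i 0 = (r i 0 / (X * S) - S / X * dx i 0) * (S / X).
  by rewrite e mulrAC mulVf ?mul1r // mulf_neq0 ?invr_eq0 ?gt_eqF.
by field; rewrite !gt_eqF.
Qed.

(** The step removes the first-order part of the deviation from the central path;
    what remains is the product of its two halves, which is quadratic in that
    deviation. *)
Lemma corrector_step w d : neighborhood A b c (1 / 4) w -> centrality_direction A w d ->
  neighborhood A b c (1 / 8) (w + d) /\ mu (w + d) = mu w.
Proof.
move=> nb [dx ds rE]; have [sf nbn] := nb; have [xb x0 sc s0] := sf; have m0 := mu_gt0 sf.
have dd : direction d by [].
set r := _ - _ in rE.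
have sumr : \sum_i r i 0 = 0.
  rewrite /r (eq_bigr (fun i => mu w - xpart w i 0 * spart w i 0)) => [|i _]; last by rewrite !mxE mulr1.
  by rewrite sumrB -muE sumr_const card_ord mulr_natl subrr.
have muE' : mu (w + d) = mu w.
  rewrite -[d]scale1r mu_step // mul1r -[RHS]addr0; congr (_ + _).
  have -> : dot (spart w) (xpart d) + dot (xpart w) (spart d) = \sum_i r i 0.
    by rewrite /dot -big_split; apply: eq_bigr => i _; rewrite -rE !mxE.
  by rewrite sumr mul0r.
have lo i := neighborhood_coord i nb.
have so : \sum_i `|xpart d i 0 * spart d i 0| <= mu w / 24.
  apply: le_trans (second_order_bound x0 s0 dd rE) _.
  have rr : \sum_i r i 0 ^+ 2 <= (mu w / 4) ^+ 2.
    have h : norm2 r <= mu w / 4.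
      have -> : r = (- mu w) *: ((mu w)^-1 *: cmul (xpart w) (spart w) - const_mx 1).
        by apply/matrixP => i j; rewrite !mxE; field; rewrite gt_eqF.
      rewrite norm2Z normrN gtr0_norm // ler_wpM2l ?(ltW m0) //.
      by move: nbn; rewrite div1r.
    by rewrite -norm2_le // divr_ge0 ?(ltW m0).
  apply: (@le_trans _ _ (2^-1 * (\sum_i r i 0 ^+ 2 / (3 / 4 * mu w)))).
    rewrite ler_wpM2l ?invr_ge0 // ler_sum // => i _.
    have q1 : 0 < 3 / 4 * mu w by lra.
    have q2 : 0 < xpart w i 0 * spart w i 0 by rewrite mulr_gt0.
    rewrite ler_wpM2l ?sqr_ge0 // lef_pV2 ?posrE //.
    by have /andP[h _] := lo i; lra.
  have q1 : 0 < 3 / 4 * mu w by lra.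
  by rewrite -mulr_suml mulrA ler_pdivrMr //; nra.
have soi i : `|xpart d i 0 * spart d i 0| <= mu w / 24.
  by apply: le_trans so; rewrite (bigD1 i) //= lerDl sumr_ge0.
have ri i : spart w i 0 * xpart d i 0 + xpart w i 0 * spart d i 0
    = mu w - xpart w i 0 * spart w i 0.
  by move/matrixP: rE => /(_ i 0); rewrite /r !mxE mulr1.
have prod t i : 0 <= t <= 1 ->
    0 < (xpart w i 0 + t * xpart d i 0) * (spart w i 0 + t * spart d i 0).
  move=> /andP[t0 t1].
  have -> : (xpart w i 0 + t * xpart d i 0) * (spart w i 0 + t * spart d i 0) =
      (1 - t) * (xpart w i 0 * spart w i 0) + t * mu w
      + t ^+ 2 * (xpart d i 0 * spart d i 0).
    transitivity (xpart w i 0 * spart w i 0 + t * (spart w i 0 * xpart d i 0 + xpart w i 0 * spart d i 0) + t ^+ 2 * (xpart d i 0 * spart d i 0)); first by ring.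
    by rewrite ri; ring.
  have := soi i; have /andP[] := lo i; rewrite ler_norml.
  move: (xpart w i 0 * _) (xpart d i 0 * _) (mu w) m0 => u v M M0 h1 h2 /andP[h3 h4].
  have h5 : (1 - t) * ((1 - 1/4) * M) <= (1 - t) * u by rewrite ler_wpM2l // subr_ge0.
  have h6 : t ^+ 2 * (- (M / 24)) <= t ^+ 2 * v by rewrite ler_wpM2l ?sqr_ge0.
  have h7 : t ^+ 2 * M <= 1 * M by rewrite ler_wpM2r ?(ltW M0) // expr_le1.
  have h8 : (1 - t) * ((1 - 1/4) * M) + t * M >= (1 - 1/4) * M by nra.
  nra.
have [xb' sc'] := direction_step 1 xb sc dd; rewrite scale1r in xb' sc'.
have le11 : (0 : R) <= 1 by [].
split=> //; split.
  split => // i; rewrite mxE.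
    rewrite -[xpart d i 0]mul1r; apply: (line_gt0 (b := spart d i 0) (x0 i) (s0 i)) => // t; exact: prod.
  rewrite -[spart d i 0]mul1r; apply: (line_gt0 (b := xpart d i 0) (s0 i) (x0 i)) => // t.
  by rewrite mulrC; exact: prod.
rewrite muE'.
have -> : (mu w)^-1 *: cmul (xpart (w + d)) (spart (w + d)) - const_mx 1 =
    (mu w)^-1 *: cmul (xpart d) (spart d).
  apply/matrixP => i j; rewrite ord1 !mxE.
  have -> : (xpart w i 0 + xpart d i 0) * (spart w i 0 + spart d i 0) =
     mu w + xpart d i 0 * spart d i 0.
    transitivity (xpart w i 0 * spart w i 0 + (spart w i 0 * xpart d i 0 + xpart w i 0 * spart d i 0) + xpart d i 0 * spart d i 0); first by ring.
    by rewrite ri; ring.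
  by field; rewrite gt_eqF.
rewrite norm2Z ger0_norm ?invr_ge0 ?(ltW m0) // ler_pdivrMl //.
apply: le_trans (norm2_le_sum _) _; rewrite (eq_bigr (fun i => `|xpart d i 0 * spart d i 0|)).
  by apply: le_trans so _; lra.
by move=> i _; rewrite !mxE.
Qed.

Lemma affine_step w d : neighborhood A b c (1 / 8) w -> affine_direction A w d ->
  forall a, a = Num.max (1 / (8 * Num.sqrt n%:R))
             (1 - 8 * norm2 (cmul (xpart d) (spart d)) / mu w) ->
  [/\ 1 / (8 * Num.sqrt n%:R) <= a <= 1, mu (w + a *: d) = (1 - a) * mu w,
      a < 1 -> neighborhood A b c (1 / 4) (w + a *: d)
    & a = 1 -> optimal A b c (w + a *: d)].
Proof.
move=> nb [dx ds rE] a aE; have [sf nbn] := nb; have [xb x0 sc s0] := sf; have m0 := mu_gt0 sf.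
have dd : direction d by [].
set q := norm2 _ in aE.
have q0 : 0 <= q by apply: norm2_ge0.
have sn1 : 1 <= Num.sqrt n%:R :> R by rewrite -[leLHS]sqrtr1 ler_wsqrtr // ler1n.
have sn : 0 < Num.sqrt n%:R :> R by apply: lt_le_trans sn1.
have a_lo : 1 / (8 * Num.sqrt n%:R) <= a by rewrite aE le_max lexx.
have lo0 : 0 < 1 / (8 * Num.sqrt n%:R) :> R by rewrite divr_gt0 ?mulr_gt0.
have lo1 : 1 / (8 * Num.sqrt n%:R) <= 1 / 8 :> R.
  by rewrite ler_pdivrMr ?mulr_gt0 // mulrA; nra.
have a_hi : a <= 1.
  rewrite aE ge_max; apply/andP; split; first lra.
  by rewrite gerDl oppr_le0 divr_ge0 ?(ltW m0) // mulr_ge0.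
have ri i : spart w i 0 * xpart d i 0 + xpart w i 0 * spart d i 0
    = - (xpart w i 0 * spart w i 0).
  by move/matrixP: rE => /(_ i 0); rewrite !mxE.
have qn : q <= n%:R * mu w / 2.
  apply: le_trans (norm2_le_sum _) _.
  apply: le_trans (_ : _ <= \sum_i `|xpart d i 0 * spart d i 0|) _.
    by apply: ler_sum => i _; rewrite mxE.
  apply: le_trans (second_order_bound x0 s0 dd rE) _.
  rewrite muE mulrC ler_wpM2r ?invr_ge0 // ler_sum // => i _.
  by rewrite !mxE sqrrN expr2 mulfK // mulf_neq0 ?gt_eqF.
have H : a ^+ 2 * q <= (1 - a) * mu w / 8.
  have [e|e] : a = 1 / (8 * Num.sqrt n%:R) \/ a = 1 - 8 * q / mu w.
    by rewrite aE /Num.max; case: ifP; [right|left].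
  - have a1 : a <= 1 / 8 by rewrite e.
    have a2 : a ^+ 2 = 1 / (64 * n%:R).
      rewrite e expr_div_n exprMn sqr_sqrtr ?ler0n // expr1n; congr (_ / (_ * _)); ring.
    have h1 : a ^+ 2 * q <= 1 / (64 * n%:R) * (n%:R * mu w / 2).
      by rewrite a2 ler_wpM2l // divr_ge0 ?mulr_ge0 ?(ltW nR).
    apply: le_trans h1 _.
    rewrite (_ : 1 / (64 * n%:R) * (n%:R * mu w / 2) = mu w / 128); last by field; rewrite gt_eqF.
    by nra.
  - have -> : (1 - a) * mu w / 8 = q by rewrite e; field; rewrite gt_eqF.
    rewrite ler_piMl // expr_le1 //; exact: le_trans (ltW lo0) a_lo.
have a0 : 0 <= a by apply: le_trans (ltW lo0) a_lo.
have a01 : 0 <= a <= 1 by rewrite a0.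
have lin : dot (spart w) (xpart d) + dot (xpart w) (spart d) = - (n%:R * mu w).
  by rewrite /dot -big_split /= muE -sumrN; apply: eq_bigr => i _; exact: ri.
have [|e1 e2 e3] := predictor_step nb dd lin a01; last by split; rewrite ?a_lo.
move=> t /andP[t0 ta].
have -> : cmul (xpart w + t *: xpart d) (spart w + t *: spart d)
         - (1 - t) *: cmul (xpart w) (spart w) = t ^+ 2 *: cmul (xpart d) (spart d).
  apply/matrixP => i j; rewrite ord1 !mxE.
  transitivity (t * (spart w i 0 * xpart d i 0 + xpart w i 0 * spart d i 0)
    + t ^+ 2 * (xpart d i 0 * spart d i 0) + t * (xpart w i 0 * spart w i 0)); first by ring.
  by rewrite ri; ring.
rewrite norm2Z ger0_norm ?sqr_ge0 // -/q.
apply: le_trans (_ : _ <= a ^+ 2 * q) _.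
  by rewrite ler_wpM2r // ler_sqr ?nnegrE.
apply: le_trans H _; rewrite ler_wpM2r ?invr_ge0 // ler_wpM2r ?(ltW m0) //; lra.
Qed.

End InteriorPoint.

(** * From layered least squares directions to residuals *)

Section Stages.
Context {R : realType} {n : nat}.
Implicit Types (V : {vspace 'cV[R]_n}) (rho v d e p : 'cV[R]_n) (pos : 'I_n -> nat).

Lemma norm2_coordproj (J : {set 'I_n}) v :
  norm2 (coordproj R J *m v) = Num.sqrt (\sum_(i in J) v i 0 ^+ 2).
Proof.
rewrite /norm2; congr Num.sqrt; rewrite (bigID (mem J)) /= [X in _ + X]big1 => [|i iJ].
  by rewrite addr0; apply: eq_bigr => i iJ; rewrite coordprojE iJ mul1r.
by rewrite coordprojE (negPf iJ) mul0r expr0n.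
Qed.

Lemma layer_minimizerP V rho v d0 (J F : {set 'I_n}) d :
  layer_minimizer V rho v d0 J F d <->
  [/\ d \in V, forall i, i \in F -> d i 0 = d0 i 0
    & forall e, e \in V -> (forall i, i \in F -> e i 0 = 0) ->
      \sum_(i in J) (rho i 0 * (v i 0 + d i 0)) * (rho i 0 * e i 0) = 0].
Proof.
have normE (f : 'cV[R]_n) : norm2 (coordproj R J *m cmul rho (v + f)) =
    Num.sqrt (\sum_(i in J) (rho i 0 * (v i 0 + f i 0)) ^+ 2).
  by rewrite norm2_coordproj; congr Num.sqrt; apply: eq_bigr => i _; rewrite !mxE.
have sq0 (f : 'I_n -> R) : 0 <= \sum_(i in J) f i ^+ 2.
  by apply: sumr_ge0 => i _; rewrite sqr_ge0.
split=> [[[dV /coordproj_eqP dF] dmin]|[dV dF dopt]]; last first.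
  split; first by split=> //; apply/coordproj_eqP.
  move=> e [eV /coordproj_eqP eF]; rewrite !normE ler_wsqrtr //.
  have := dopt (e - d); rewrite memvB // => /(_ isT) opt0.
  have {}opt0 : \sum_(i in J) (rho i 0 * (v i 0 + d i 0)) * (rho i 0 * (e - d) i 0) = 0.
    by apply: opt0 => i iF; rewrite !mxE eF // dF // subrr.
  have -> : \sum_(i in J) (rho i 0 * (v i 0 + e i 0)) ^+ 2 =
      \sum_(i in J) (rho i 0 * (v i 0 + d i 0)) ^+ 2 +
      2 * (\sum_(i in J) (rho i 0 * (v i 0 + d i 0)) * (rho i 0 * (e - d) i 0)) +
      \sum_(i in J) (rho i 0 * (e - d) i 0) ^+ 2.
    by rewrite mulr_sumr -!big_split /=; apply: eq_bigr => i _; rewrite !mxE; ring.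
  by rewrite opt0 mulr0 addr0 lerDl.
split=> // e eV e0.
set C := \sum_(i in J) _; pose B := \sum_(i in J) (rho i 0 * e i 0) ^+ 2.
have B0 : 0 <= B := sq0 _.
have quad t : 0 <= 2 * t * C + t ^+ 2 * B.
  have adm : d + t *: e \in V /\ coordproj R F *m (d + t *: e) = coordproj R F *m d0.
    split; first by rewrite memvD // memvZ.
    by apply/coordproj_eqP => i iF; rewrite !mxE dF // e0 // mulr0 addr0.
  have := dmin _ adm; rewrite !normE ler_sqrt ?sq0 //.
  have -> : \sum_(i in J) (rho i 0 * (v i 0 + (d + t *: e) i 0)) ^+ 2 =
      \sum_(i in J) (rho i 0 * (v i 0 + d i 0)) ^+ 2 + (2 * t * C + t ^+ 2 * B).
    rewrite /C /B !mulr_sumr -!big_split /=.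
    by apply: eq_bigr => i _; rewrite !mxE; ring.
  by rewrite lerDl.
have B1 : 0 < B + 1 by lra.
apply/eqP/negPn/negP => C0.
have := quad (- C / (B + 1)).
have -> : 2 * (- C / (B + 1)) * C + (- C / (B + 1)) ^+ 2 * B =
    - (C ^+ 2 * ((B + 2) / (B + 1) ^+ 2)) by field; rewrite gt_eqF.
rewrite oppr_ge0 leNgt => /negP; apply.
have p : 0 < (B + 2) / (B + 1) ^+ 2 by rewrite divr_gt0 ?exprn_gt0 //; lra.
by rewrite mulr_gt0 // exprn_even_gt0.
Qed.

(** The stages of a layered least squares problem, with the layers given by
    [pos] and treated from the last to the first. *)
Definition stages V rho v d pos : Prop := forall i0, exists2 dm,
  layer_minimizer V rho v d [set i | pos i == pos i0] [set i | (pos i0 < pos i)%N] dm &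
  forall i, pos i = pos i0 -> dm i 0 = d i 0.

Lemma stages_layered V rho v d pos (a : R) : (0 < n)%N -> (forall i, 0 < rho i 0) ->
  stages V rho v d pos ->
  layered (scalev rho V) (a *: cmul rho v) pos (a *: cmul rho (v + d)).
Proof.
move=> n0 rho0 st.
have dV : d \in V.
  have [i0 _ i0min] := @arg_minnP _ (Ordinal n0) predT pos isT.
  have [dm /layer_minimizerP [dmV dmF _] dmE] := st i0.
  suff -> : d = dm by [].
  apply/matrixP => i j; rewrite ord1; have := i0min i isT; rewrite leq_eqVlt => /orP[/eqP e|lt].
    by rewrite dmE.
  by rewrite dmF // inE.
split.
  have -> : a *: cmul rho (v + d) - a *: cmul rho v = cmul rho (a *: d).
    by apply/matrixP => i j; rewrite !mxE; ring.
  by rewrite scalev_cmul // memvZ.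
move=> r z /mem_scalevP [e eV ->] z0.
have [/existsP [i0 /eqP i0r]|/existsPn none] := boolP [exists i, pos i == r]; last first.
  by rewrite big_pred0 // => i; apply/negbTE/none.
have [dm /layer_minimizerP [dmV dmF dmO] dmE] := st i0.
have e0 i : i \in [set i | (pos i0 < pos i)%N] -> e i 0 = 0.
  rewrite inE i0r => /z0; rewrite mxE => /eqP.
  by rewrite mulf_eq0 gt_eqF //= => /eqP.
have := dmO e eV e0 => e1.
rewrite -[RHS](mulr0 a) -[in RHS]e1 mulr_sumr.
apply: eq_big => [i|i ir]; first by rewrite inE i0r.
have ir' : pos i = pos i0 by rewrite i0r; apply/eqP.
by rewrite !mxE dmE // -!mulrA.
Qed.

Lemma layered_stages V rho v d pos (a : R) : 0 < a -> (forall i, 0 < rho i 0) ->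
  layered (scalev rho V) (a *: cmul rho v) pos (a *: cmul rho (v + d)) ->
  stages V rho v d pos.
Proof.
move=> a0 rho0 [dU opt] i0; exists d => //; apply/layer_minimizerP; split=> //.
  have : a^-1 *: (a *: cmul rho (v + d) - a *: cmul rho v) \in scalev rho V by rewrite memvZ.
  rewrite mem_scalev // (_ : cmul _ _ = d) //.
  by apply/matrixP => i j; rewrite ord1 !mxE; field; rewrite !gt_eqF.
move=> e eV e0.
have := opt (pos i0) (cmul rho e) (scalev_cmul rho eV) _ => /(_ _) H.
have {}H : \sum_(i | pos i == pos i0) (a *: cmul rho (v + d)) i 0 * cmul rho e i 0 = 0.
  by apply: H => i ii0; rewrite mxE e0 ?mulr0 // inE.
apply: (mulfI (lt0r_neq0 a0)); rewrite mulr0 -[RHS]H mulr_sumr.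
by apply: eq_big => [i|i _]; rewrite ?inE // !mxE -!mulrA.
Qed.

End Stages.

Section Residuals.
Context {R : realType} {m n : nat} (A : 'M[R]_(m, n)) (w : pdpoint R m n).
Hypotheses (n0 : (0 < n)%N) (x0 : forall i, 0 < xpart w i 0) (s0 : forall i, 0 < spart w i 0).
Implicit Types (d : pdpoint R m n) (J : seq {set 'I_n}).

Local Notation mu := Defs.mu.
Local Notation delta := Defs.delta.
Let W := kerspace A.

(** The vector sqrt (x s / mu) ([hvec_sqr]): the common image of x and of s in the
    local metric, close to 1 in every coordinate. *)
Definition hvec : 'cV[R]_n := (Num.sqrt (mu w))^-1 *: cmul (delta w) (xpart w).

Let mu0 : 0 < mu w.
Proof.
rewrite divr_gt0 ?ltr0n // /dot (bigD1 (Ordinal n0)) //= ltr_wpDr ?mulr_gt0 //.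
by apply: sumr_ge0 => i _; rewrite mulr_ge0 ?ltW.
Qed.

Lemma delta_gt0 i : 0 < delta w i 0.
Proof. by rewrite mxE divr_gt0 ?sqrtr_gt0. Qed.

Let M0 : 0 < Num.sqrt (mu w). Proof. by rewrite sqrtr_gt0. Qed.
Let MM : Num.sqrt (mu w) ^+ 2 = mu w. Proof. by rewrite sqr_sqrtr // ltW. Qed.

Local Ltac sqrt_field i :=
  have := sqr_sqrtr (ltW (x0 i)); have := sqr_sqrtr (ltW (s0 i)); have := MM;
  have := M0; have : 0 < Num.sqrt (xpart w i 0) by [rewrite sqrtr_gt0];
  have : 0 < Num.sqrt (spart w i 0) by [rewrite sqrtr_gt0];
  move: (Num.sqrt (mu w)) (Num.sqrt (xpart w i 0)) (Num.sqrt (spart w i 0));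
  move=> ? ? ? ? ? ?;
  do 3 (let e := fresh "e" in intro e; try (rewrite -e); clear e); field; rewrite !gt_eqF //.

Lemma hvec_gt0 i : 0 < hvec i 0.
Proof. by rewrite !mxE !mulr_gt0 ?invr_gt0 ?divr_gt0 ?sqrtr_gt0. Qed.

Lemma hvec_s : hvec = (Num.sqrt (mu w))^-1 *: cmul (cinv (delta w)) (spart w).
Proof.
apply/matrixP => i j; rewrite ord1 !mxE.
by sqrt_field i.
Qed.

Lemma hvec_sqr i : hvec i 0 ^+ 2 = xpart w i 0 * spart w i 0 / mu w.
Proof.
by rewrite !mxE; sqrt_field i.
Qed.

Lemma residual_x_sub d i : residual_x w d i 0 - hvec i 0 =
  (Num.sqrt (mu w))^-1 * delta w i 0 * xpart d i 0.
Proof. by rewrite !mxE; ring. Qed.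

Lemma residual_s_sub d i : residual_s w d i 0 - hvec i 0 =
  (Num.sqrt (mu w))^-1 * (delta w i 0)^-1 * spart d i 0.
Proof. by rewrite hvec_s !mxE; ring. Qed.

Lemma hvec_residual_x d i : hvec i 0 * (residual_x w d i 0 - hvec i 0) =
  spart w i 0 * xpart d i 0 / mu w.
Proof.
rewrite residual_x_sub hvec_s !mxE.
by sqrt_field i.
Qed.

Lemma hvec_residual_s d i : hvec i 0 * (residual_s w d i 0 - hvec i 0) =
  xpart w i 0 * spart d i 0 / mu w.
Proof.
rewrite residual_s_sub !mxE.
by sqrt_field i.
Qed.

Lemma residual_prod d i : (residual_x w d i 0 - hvec i 0) * (residual_s w d i 0 - hvec i 0) =
  xpart d i 0 * spart d i 0 / mu w.
Proof.
rewrite residual_s_sub residual_x_sub !mxE.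
by sqrt_field i.
Qed.

Lemma hvec_dot : dot hvec hvec = n%:R.
Proof.
have -> : dot hvec hvec = \sum_i xpart w i 0 * spart w i 0 / mu w.
  by apply: eq_bigr => i _; rewrite -hvec_sqr expr2.
by rewrite -mulr_suml -muE // mulfK // gt_eqF.
Qed.

Lemma hvec_feasible (x : 'cV[R]_n) : x - xpart w \in W ->
  (Num.sqrt (mu w))^-1 *: cmul (delta w) x - hvec \in scalev (delta w) W.
Proof.
move=> xW; have -> : (Num.sqrt (mu w))^-1 *: cmul (delta w) x - hvec =
    cmul (delta w) ((Num.sqrt (mu w))^-1 *: (x - xpart w)).
  by apply/matrixP => i j; rewrite ord1 !mxE; ring.
by rewrite scalev_cmul // memvZ.
Qed.

Lemma hvec_dual_feasible (s : 'cV[R]_n) : s - spart w \in orthv W ->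
  (Num.sqrt (mu w))^-1 *: cmul (cinv (delta w)) s - hvec \in orthv (scalev (delta w) W).
Proof.
move=> sW; have -> : (Num.sqrt (mu w))^-1 *: cmul (cinv (delta w)) s - hvec =
    cmul (cinv (delta w)) ((Num.sqrt (mu w))^-1 *: (s - spart w)).
  by rewrite hvec_s; apply/matrixP => i j; rewrite ord1 !mxE; ring.
by rewrite orthv_scale ?scalev_cmul ?memvZ //; apply: delta_gt0.
Qed.

Lemma direction_mem d : direction A d -> xpart d \in W /\ spart d \in orthv W.
Proof.
move=> [dx ds]; split; first by rewrite mem_kerspace dx.
rewrite /W -rangespace_tr; apply/mem_rangespaceP; exists (- ypart d).
by rewrite mulmxN; apply/eqP; rewrite -addr_eq0 addrC ds.
Qed.

Lemma residuals_mem d : direction A d ->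
  residual_x w d - hvec \in scalev (delta w) W /\
  residual_s w d - hvec \in orthv (scalev (delta w) W).
Proof.
move=> /direction_mem [dx ds]; split.
  by apply: hvec_feasible; rewrite addrC addKr.
by apply: hvec_dual_feasible; rewrite addrC addKr.
Qed.

Lemma affine_residuals d : affine_direction A w d ->
  residual_x w d + residual_s w d = hvec.
Proof.
move=> [_ _ rE]; apply/matrixP => i j; rewrite ord1.
have e : hvec i 0 * (residual_x w d i 0 + residual_s w d i 0 - 2 * hvec i 0) =
    - hvec i 0 ^+ 2.
  transitivity (hvec i 0 * (residual_x w d i 0 - hvec i 0) +
    hvec i 0 * (residual_s w d i 0 - hvec i 0)); first by ring.
  rewrite hvec_residual_x hvec_residual_s -mulrDl hvec_sqr.
  move/matrixP: rE => /(_ i 0); rewrite !mxE => ->.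
  by rewrite mulNr.
have h0 := hvec_gt0 i; apply: (mulfI (lt0r_neq0 h0)).
by rewrite [(residual_x w d + residual_s w d) i 0]mxE; lra.
Qed.

Section LLS.
Variables (E : {set 'I_n * 'I_n}) (J : seq {set 'I_n}).
Hypothesis JE : enumerates J (strong_components E).

Lemma lls_stagesP d : lls_direction A J w d <->
  [/\ stages W (delta w) (xpart w) (xpart d) (position J),
      stages (orthv W) (cinv (delta w)) (spart w) (spart d)
        (fun i => size J - position J i)%N
    & A^T *m ypart d = - spart d].
Proof.
have posS i := position_lt_size JE i.
have layE k : layer J k = [set i | position J i == k].
  by apply/setP => i; rewrite inE (in_layer JE).
have gtE k : layers_gt J k = [set i | (k < position J i)%N].
  by apply/setP => i; rewrite inE (in_layers_ge JE).
have layE' i0 : layer J (position J i0) =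
    [set i | (size J - position J i)%N == (size J - position J i0)%N].
  by apply/setP => i; rewrite inE (in_layer JE); have := posS i; have := posS i0; lia.
have ltE i0 : layers_lt J (position J i0) =
    [set i | (size J - position J i0 < size J - position J i)%N].
  by apply/setP => i; rewrite inE (in_layers_lt JE); have := posS i; have := posS i0; lia.
have nonempty k : (k < size J)%N -> exists i0, position J i0 = k.
  move=> kJ; have : layer J k \in strong_components E.
    by rewrite -(mem_enumerates JE) mem_nth.
  have /and3P[_ _ nset0] := components_partition E.
  have [->|/set0Pn [i iJ] _] := eqVneq (layer J k) finset.set0.
    by move=> h; move: nset0; rewrite h.
  by exists i; apply/eqP; rewrite -(in_layer JE).
rewrite /lls_direction rangespace_tr -/W; split=> -[st st' dy]; split=> //.
- move=> i0; have [dm dmM dmE] := st _ (posS i0); exists dm.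
    by rewrite -layE -gtE.
  by move=> i ii0; move/coordproj_eqP: dmE => ->; rewrite // layE inE ii0.
- move=> i0; have [dm dmM dmE] := st' _ (posS i0); exists dm.
    by rewrite -layE' -ltE.
  move=> i ii0; move/coordproj_eqP: dmE => ->; rewrite // layE' inE ii0 //.
- move=> k /nonempty [i0 <-]; have [dm dmM dmE] := st i0; exists dm.
    by rewrite layE gtE.
  by apply/coordproj_eqP => i; rewrite layE inE => /eqP/dmE.
- move=> k /nonempty [i0 <-]; have [dm dmM dmE] := st' i0; exists dm.
    by rewrite layE' ltE.
  by apply/coordproj_eqP => i; rewrite layE' inE => /eqP/dmE.
Qed.

Lemma lls_residuals d : lls_direction A J w d ->
  [/\ direction A d, layered (scalev (delta w) W) hvec (position J) (residual_x w d)
    & layered (orthv (scalev (delta w) W)) hvec (fun i => size J - position J i)%N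
        (residual_s w d)].
Proof.
move=> /lls_stagesP [st st' dy].
have l1 := stages_layered (Num.sqrt (mu w))^-1 n0 delta_gt0 st.
have l2 := stages_layered (Num.sqrt (mu w))^-1 n0 (cinv_gt0 delta_gt0) st'.
rewrite -orthv_scale -?hvec_s in l2; last exact: delta_gt0.
split=> //; split; last by rewrite dy addNr.
have [xU _] := l1; apply/eqP; rewrite -mem_kerspace.
have : Num.sqrt (mu w) *: (residual_x w d - hvec) \in scalev (delta w) W by rewrite memvZ.
rewrite mem_scalev; last exact: delta_gt0.
rewrite (_ : cmul _ _ = xpart d) //.
by apply/matrixP => i j; rewrite ord1 !mxE; sqrt_field i.
Qed.

Lemma lls_exists : exists d, lls_direction A J w d.
Proof.
have [p pL] := layered_exists (scalev (delta w) W) hvec (position J).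
have [q qL] := layered_exists (orthv (scalev (delta w) W)) hvec
  (fun i => size J - position J i)%N.
pose dx := cmul (cinv (delta w)) (Num.sqrt (mu w) *: p) - xpart w.
pose ds := cmul (delta w) (Num.sqrt (mu w) *: q) - spart w.
have D0 i : delta w i 0 != 0 by rewrite gt_eqF // delta_gt0.
have pE : p = (Num.sqrt (mu w))^-1 *: cmul (delta w) (xpart w + dx).
  apply/matrixP => i j; rewrite ord1 /dx [xpart w + _]addrC subrK.
  rewrite mxE mxE [cmul (cinv _) _ i 0]mxE [cinv _ i 0]mxE [(_ *: p) i 0]mxE.
  by field; rewrite D0 gt_eqF.
have qE : q = (Num.sqrt (mu w))^-1 *: cmul (cinv (delta w)) (spart w + ds).
  apply/matrixP => i j; rewrite ord1 /ds [spart w + _]addrC subrK.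
  rewrite mxE mxE [cinv _ i 0]mxE [cmul (delta w) _ i 0]mxE [(_ *: q) i 0]mxE.
  by field; rewrite D0 gt_eqF.
have st : stages W (delta w) (xpart w) dx (position J).
  apply: (layered_stages (a := (Num.sqrt (mu w))^-1)); rewrite ?invr_gt0 //; first exact: delta_gt0.
  by rewrite -pE.
have st' : stages (orthv W) (cinv (delta w)) (spart w) ds (fun i => size J - position J i)%N.
  apply: (layered_stages (a := (Num.sqrt (mu w))^-1)); rewrite ?invr_gt0 //; first exact: cinv_gt0 delta_gt0.
  by rewrite -qE -hvec_s -orthv_scale //; apply: delta_gt0.
have dsW : ds \in orthv W.
  have [qU _] := qL.
  have : Num.sqrt (mu w) *: (q - hvec) \in orthv (scalev (delta w) W) by rewrite memvZ.
  rewrite orthv_scale; last exact: delta_gt0.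
  rewrite mem_scalev; last exact: cinv_gt0 delta_gt0.
  rewrite (_ : cmul _ _ = ds) //.
  by apply/matrixP => i j; rewrite ord1 hvec_s /ds !mxE; sqrt_field i.
have : ds \in rangespace A^T by rewrite rangespace_tr.
move=> /mem_rangespaceP [y dsE]; exists (dx, - y, ds).
by apply/lls_stagesP; split=> //=; rewrite mulmxN -dsE.
Qed.

End LLS.
End Residuals.

(** * Layered residuals are close to affine scaling residuals *)

Section Closeness.
Context {R : realType} {n : nat} (n3 : (2 < n)%N).
Implicit Types (U : {vspace 'cV[R]_n}) (h p q pa qa : 'cV[R]_n).

Local Notation g := (gamma R n).

Let n0 : (0 < n)%N. Proof. exact: leq_trans n3. Qed.
Lemma natn_ge3 : 3 <= n%:R :> R. Proof. by rewrite ler_nat. Qed.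

Lemma sqrt_n : 1 <= Num.sqrt (n%:R : R) /\ Num.sqrt (n%:R : R) <= n%:R.
Proof.
have nR := natn_ge3.
have s1 : 1 <= Num.sqrt (n%:R : R) by rewrite -[leLHS]sqrtr1 ler_sqrt //; lra.
by split=> //; rewrite -[leRHS]sqr_sqrtr ?expr2 ?ler_peMr //; lra.
Qed.

(** All the numerical slack of the analysis comes from the high power of n in
    the definition of gamma. *)
Lemma gamma_pow (k : nat) : (k <= 5)%N -> g * n%:R ^+ k <= 8192^-1.
Proof.
move=> k5; have nR := natn_ge3; have gs := gamma_small (R := R) n0; have g0 := gamma_gt0 (R := R) n0.
have e : (2 : R) ^+ 13 = 8192 by rewrite -natrX.
rewrite e in gs.
have : g * n%:R ^+ k <= g * n%:R ^+ 5.
  by rewrite ler_wpM2l ?(ltW g0) // ler_weXn2l //; lra.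
by lra.
Qed.

Lemma sum_abs_le (v : 'cV[R]_n) : dot v v <= n%:R -> \sum_i `|v i 0| <= n%:R :> R.
Proof.
move=> vv; have : \sum_i `|v i 0| <= \sum_i (1 + v i 0 * v i 0) / 2.
  apply: ler_sum => i _; have e := real_normK (num_real (v i 0)); rewrite -expr2 -e.
  by have := sqr_ge0 (`|v i 0| - 1); nra.
rewrite -mulr_suml big_split /= sumr_const card_ord -/(dot v v); lra.
Qed.

(** What the analysis uses about the layered residuals [p], [q] as compared to
    the affine scaling residuals [pa], [qa]. *)
Record lls_close p q pa qa : Prop := LlsClose {
  close_x : forall i, `|p i 0 - pa i 0| <= 101 / 100 * g * n%:R;
  close_s : forall i, `|q i 0 - qa i 0| <= 101 / 100 * g * n%:R;
  close_sum_x : \sum_i `|p i 0| <= 101 / 100 * n%:R;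
  close_sum_s : \sum_i `|q i 0| <= 101 / 100 * n%:R;
  close_orth : dot p q = 0;
  close_sq : dot p p + dot q q <= 101 / 100 * n%:R
}.

Lemma layered_close_gamma U k h pos p pa : balanced U k (g / n%:R) pos ->
  layered U h pos p -> pa - h \in U -> pa \in orthv U -> dot pa pa <= n%:R ->
  [/\ forall i, `|p i 0 - pa i 0| <= 101 / 100 * g * n%:R,
      \sum_i `|p i 0| <= 101 / 100 * n%:R
    & dot p p <= dot pa pa + n%:R * (101 / 100 * g * n%:R) ^+ 2].
Proof.
move=> bal pL paU paO pan; have nR := natn_ge3; have g0 := gamma_gt0 (R := R) n0.
have cl i := layered_close i bal pL paU paO.
have e : n%:R * (g / n%:R) = g by rewrite mulrC divfK // gt_eqF //; lra.
set S := \sum_j `|p j 0| in cl *.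
have S0 : 0 <= S by rewrite sumr_ge0.
have sum : S <= 101 / 100 * n%:R.
  have : S <= \sum_j `|pa j 0| + \sum_(j < n) g * S.
    rewrite -big_split /=; apply: ler_sum => j _.
    have := cl j; rewrite e => cj; rewrite -lerBlDl.
    by apply: le_trans cj; rewrite lerBlDr -{1}(subrK (pa j 0) (p j 0)) ler_normD.
  rewrite sumr_const card_ord -[(g * S) *+ n]mulr_natl.
  have h1 := sum_abs_le pan; have := gamma_pow (k := 1) isT; rewrite expr1 => h2 h3.
  have h4 : (g * n%:R) * S <= 8192^-1 * S by rewrite ler_wpM2r.
  by lra.
have cl' i : `|p i 0 - pa i 0| <= 101 / 100 * g * n%:R.
  apply: le_trans (cl i) _; rewrite e.
  have := ler_wpM2l (ltW g0) sum; lra.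
split=> //.
have zU : p - pa \in U by apply: memv_diff paU; have [] := pL.
have -> : dot p p = dot pa pa + dot (p - pa) (p - pa).
  have /mem_orthv/(_ _ zU) z0 := paO.
  rewrite dotBr [dot (p - pa) pa]dotC z0 subr0 dotBl.
  by move: z0; rewrite dotBr (dotC pa p); lra.
rewrite lerD2l -[n in n%:R * _]card_ord -sum1_card natr_sum mulr_suml.
apply: ler_sum => i _; rewrite mul1r -expr2 -(real_normK (num_real _)).
rewrite ler_sqr ?nnegrE //; first by rewrite !mxE; apply: cl'.
by have gn : 0 <= g * n%:R by [rewrite mulr_ge0 ?(ltW g0)]; lra.
Qed.

(** The affine scaling residuals [pa], [qa] are the orthogonal projections of [h],
    hence the residuals of the problem with a single layer. *)
Lemma lls_closeness U k h pos (N : nat) p q pa qa : dot h h = n%:R ->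
  balanced U k (g / n%:R) pos -> (forall i j, 0 <= k i j) -> (forall i, (pos i <= N)%N) ->
  layered U h pos p -> layered (orthv U) h (fun i => N - pos i)%N q ->
  pa - h \in U -> qa - h \in orthv U -> pa + qa = h ->
  lls_close p q pa qa.
Proof.
move=> hh bal k0 posN pL qL paU qaU paqa.
have g0 := gamma_gt0 (R := R) n0; have s0 := sigma_gt0 (R := R) n0.
have paO : pa \in orthv U.
  by rewrite -memvN (_ : - pa = qa - h) // -paqa opprD addrCA subrr addr0.
have qaO : qa \in orthv (orthv U).
  by rewrite orthvK -memvN (_ : - qa = pa - h) // -paqa opprD addrA subrr add0r.
have orth : dot pa qa = 0.
  by move/mem_orthv: paO; apply; rewrite -(orthvK U).
have sqs : dot pa pa + dot qa qa = n%:R.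
  by rewrite -hh -paqa dotDl !dotDr (dotC qa pa) orth; lra.
have p0 := dot_ge0 pa; have q0 := dot_ge0 qa.
have bal' := balanced_dual (ltW s0) k0 posN bal.
have pan : dot pa pa <= n%:R by lra.
have qan : dot qa qa <= n%:R by lra.
have [h1 h2 h3] := layered_close_gamma bal pL paU paO pan.
have [h4 h5 h6] := layered_close_gamma bal' qL qaU qaO qan.
split=> //; first exact: layered_orthogonal posN pL qL.
have nR := natn_ge3.
have small : n%:R * (101 / 100 * g * n%:R) ^+ 2 <= 1 / 1000 * n%:R.
  rewrite [leRHS]mulrC ler_wpM2l //.
  have t1 := gamma_pow (k := 1) isT; rewrite expr1 in t1.
  have t0 : 0 <= g * n%:R by rewrite mulr_ge0 ?(ltW g0) //; lra.
  have -> : (101 / 100 * g * n%:R) ^+ 2 = (101 / 100) ^+ 2 * (g * n%:R) ^+ 2 by ring.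
  have : (g * n%:R) ^+ 2 <= 8192^-1 * (g * n%:R) by rewrite expr2 ler_wpM2r.
  by move: t0 t1; clear => t0 t1 h; lra.
lra.
Qed.

End Closeness.

Section LlsStep.
Context {R : realType} {m n : nat} (A : 'M[R]_(m, n)) (b : 'cV[R]_m) (c : 'cV[R]_n).
Hypothesis n3 : (2 < n)%N.
Implicit Types (w d : pdpoint R m n).

Local Notation g := (gamma R n).
Local Notation mu := Defs.mu.
Local Notation delta := Defs.delta.

Let n0 : (0 < n)%N. Proof. exact: leq_trans n3. Qed.

Lemma epsilon_ge0 w d : 0 <= epsilon w d.
Proof. exact: bigmax_ge_id. Qed.

Lemma epsilon_ge w d i :
  Num.min `|residual_x w d i 0| `|residual_s w d i 0| <= epsilon w d.
Proof. exact: (le_bigmax 0 (fun i => Num.min `|residual_x w d i 0| `|residual_s w d i 0|)). Qed.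

Lemma epsilon_attained w d :
  exists i, epsilon w d = Num.min `|residual_x w d i 0| `|residual_s w d i 0|.
Proof.
apply: contrapT => none.
suff : epsilon w d < epsilon w d by rewrite ltxx.
have lt i : Num.min `|residual_x w d i 0| `|residual_s w d i 0| < epsilon w d.
  rewrite lt_neqAle epsilon_ge andbT; apply/eqP => e; apply: none; by exists i.
rewrite {1}/epsilon; apply: bigmax_lt => //.
by apply: le_lt_trans (lt (Ordinal n0)); rewrite le_min !normr_ge0.
Qed.

Lemma powR_3half : n%:R `^ (3 / 2) = n%:R * Num.sqrt n%:R :> R.
Proof.
have -> : 3 / 2 = 1 + 2^-1 :> R by lra.
rewrite powRD; last by apply/implyP => _; rewrite pnatr_eq0 -lt0n.
by rewrite powRr1 ?ler0n // powR12_sqrt ?ler0n.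
Qed.

Lemma hvec_bounds w i : neighborhood A b c (1 / 8) w -> 93 / 100 <= hvec w i 0 <= 107 / 100.
Proof.
move=> nb; have [[_ x0 _ s0] _] := nb; have m0 := mu_gt0 n0 (proj1 nb).
have h0 := hvec_gt0 n0 x0 s0 i; have := hvec_sqr n0 x0 s0 i.
have /andP[] := neighborhood_coord n0 i nb.
move=> lo hi e.
have h1 : 7 / 8 <= hvec w i 0 ^+ 2 by rewrite e ler_pdivlMr //; lra.
have h2 : hvec w i 0 ^+ 2 <= 9 / 8 by rewrite e ler_pdivrMr //; lra.
by apply/andP; split; rewrite leNgt; apply/negP => lt; nra.
Qed.

(** The layered step is accepted only when the affine residuals are small; then
    the second-order error is governed by the products p_i q_i, one factor of
    which is at most epsilon. *)
Lemma lls_step w d da :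
  neighborhood A b c (1 / 8) w -> direction A d -> affine_direction A w da ->
  lls_close (residual_x w d) (residual_s w d) (residual_x w da) (residual_s w da) ->
  epsilon w da < 10 * (n%:R `^ (3 / 2)) * g ->
  let a := 1 - 24 * Num.sqrt n%:R * epsilon w d in
  [/\ epsilon w d <= 12 * n%:R * Num.sqrt n%:R * g, 0 <= a <= 1,
      mu (w + a *: d) = (1 - a) * mu w,
      a < 1 -> neighborhood A b c (1 / 4) (w + a *: d)
    & a = 1 -> optimal A b c (w + a *: d)].
Proof.
move=> nb dd aff cl small a.
have nR := natn_ge3 (R := R) n3; have g0 := gamma_gt0 (R := R) n0.
have [[_ x0 _ s0] _] := nb; have m0 := mu_gt0 n0 (proj1 nb).
set p := residual_x w d in cl *; set q := residual_s w d in cl *.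
set h := hvec w.
have sn1 : 1 <= Num.sqrt n%:R :> R by rewrite -[leLHS]sqrtr1 ler_wsqrtr // ler1n.
have snn : Num.sqrt n%:R ^+ 2 = n%:R :> R by rewrite sqr_sqrtr ?ler0n.
have e0 := epsilon_ge0 w d.
have paqa := affine_residuals n0 x0 s0 aff.
have [i ei] := epsilon_attained w d.
have e_hi : epsilon w d <= 12 * n%:R * Num.sqrt n%:R * g.
  have := le_lt_trans (epsilon_ge w da i) small; rewrite powR_3half.
  have cx := close_x cl i; have cs := close_s cl i.
  have gn : 0 <= g * n%:R by rewrite mulr_ge0 ?(ltW g0).
  have gnn : g * n%:R <= g * n%:R * Num.sqrt n%:R by rewrite ler_peMr.
  rewrite gt_min => /orP[lt|lt].
  - apply: (@le_trans _ _ `|p i 0|); first by rewrite ei ge_min lexx.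
    rewrite -(subrK (residual_x w da i 0) (p i 0)).
    apply: le_trans (ler_normD _ _) _; lra.
  - apply: (@le_trans _ _ `|q i 0|); first by rewrite ei ge_min lexx orbT.
    rewrite -(subrK (residual_s w da i 0) (q i 0)).
    apply: le_trans (ler_normD _ _) _; lra.
have gp2 := gamma_pow (R := R) n3 (k := 2) isT.
have a0 : 0 <= a.
  have : 24 * Num.sqrt n%:R * epsilon w d <= 24 * Num.sqrt n%:R * (12 * n%:R * Num.sqrt n%:R * g).
    by rewrite ler_wpM2l ?mulr_ge0 ?sqrtr_ge0.
  have -> : 24 * Num.sqrt n%:R * (12 * n%:R * Num.sqrt n%:R * g) = 288 * (g * n%:R ^+ 2).
    transitivity (288 * (g * (n%:R * Num.sqrt n%:R ^+ 2))); first by ring.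
    by rewrite snn -expr2.
  rewrite /a; lra.
have a1 : a <= 1 by rewrite /a gerBl !mulr_ge0 ?sqrtr_ge0.
have hp := hvec_residual_x n0 x0 s0 d; have hq := hvec_residual_s n0 x0 s0 d.
have pq := residual_prod n0 x0 s0 d.
have hh := hvec_dot n0 x0 s0.
rewrite -/p -/q -/h in hp hq pq hh.
have sumpq : dot (p - h) (q - h) = 0.
  have -> : dot (p - h) (q - h) = (\sum_i xpart d i 0 * spart d i 0) / mu w.
    rewrite mulr_suml; apply: eq_bigr => j _; rewrite -pq !mxE //.
  by rewrite -[X in X / _]/(dot (xpart d) (spart d)) (direction_orth dd) mul0r.
have hpq : dot h p + dot h q = n%:R.
  move: sumpq; rewrite dotBl !dotBr (close_orth cl) hh (dotC p h); lra.
have lin : dot (spart w) (xpart d) + dot (xpart w) (spart d) = - (n%:R * mu w).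
  have e1 : dot (spart w) (xpart d) = mu w * (dot h p - n%:R).
    rewrite -hh -dotBr /dot mulr_sumr; apply: eq_bigr => j _.
    have -> : (p - h) j 0 = p j 0 - h j 0 by rewrite !mxE.
    by rewrite (hp j) [RHS]mulrC divfK // gt_eqF.
  have e2 : dot (xpart w) (spart d) = mu w * (dot h q - n%:R).
    rewrite -hh -dotBr /dot mulr_sumr; apply: eq_bigr => j _.
    have -> : (q - h) j 0 = q j 0 - h j 0 by rewrite !mxE.
    by rewrite (hq j) [RHS]mulrC divfK // gt_eqF.
  have e3 : dot h p - n%:R + (dot h q - n%:R) = - n%:R by lra.
  by rewrite e1 e2 -mulrDr e3 mulrN mulrC.
pose he : 'cV[R]_n := \col_j (h j 0 * (p j 0 + q j 0 - h j 0)).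
have he_small : norm2 he <= 1 / 1000.
  apply: le_trans (norm2_le_sum _) _.
  apply: (@le_trans _ _ (\sum_(j < n) 3 * (g * n%:R))).
    apply: ler_sum => j _; rewrite mxE normrM.
    have /andP[h1 h2] := hvec_bounds j nb.
    have e2 : `|p j 0 + q j 0 - h j 0| <= 202 / 100 * (g * n%:R).
      rewrite /h -paqa [(residual_x w da + _) j 0]mxE.
      have -> : p j 0 + q j 0 - (residual_x w da j 0 + residual_s w da j 0) =
        (p j 0 - residual_x w da j 0) + (q j 0 - residual_s w da j 0) by ring.
      apply: le_trans (ler_normD _ _) _.
      have := close_x cl j; have := close_s cl j; lra.
    have gn : 0 <= g * n%:R by rewrite mulr_ge0 ?(ltW g0).
    apply: le_trans (ler_pM (normr_ge0 _) (normr_ge0 _) (_ : _ <= 107 / 100) e2) _.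
      by rewrite ger0_norm //; lra.
    lra.
  rewrite sumr_const card_ord -[(3 * _) *+ n]mulr_natl; lra.
have pq_small : norm2 (cmul p q) <= 15 / 10 * Num.sqrt n%:R * epsilon w d.
  have k0 : 0 <= 15 / 10 * Num.sqrt n%:R * epsilon w d.
    by rewrite mulr_ge0 // mulr_ge0 ?sqrtr_ge0 // divr_ge0.
  rewrite norm2_le // [leRHS]exprMn [(15 / 10 * _) ^+ 2]exprMn snn.
  apply: (@le_trans _ _ (\sum_j (p j 0 ^+ 2 + q j 0 ^+ 2) * epsilon w d ^+ 2)).
    apply: ler_sum => j _; rewrite mxE -(real_normK (num_real (p j 0 * q j 0))) normrM.
    rewrite -(real_normK (num_real (p j 0))) -(real_normK (num_real (q j 0))).
    have := epsilon_ge w d j; rewrite -/p -/q.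
    move: (normr_ge0 (p j 0)) (normr_ge0 (q j 0)) e0.
    move: `|p j 0| `|q j 0| (epsilon w d) => u v e u0 v0 ee; rewrite ge_min exprMn => /orP[le|le].
      have := ler_wpM2r (sqr_ge0 v) (_ : u ^+ 2 <= e ^+ 2); rewrite ler_sqr ?nnegrE // => /(_ le).
      move=> le2; rewrite mulrDl [v ^+ 2 * _]mulrC (le_trans le2) // lerDr.
      by rewrite mulr_ge0 ?sqr_ge0.
    have := ler_wpM2l (sqr_ge0 u) (_ : v ^+ 2 <= e ^+ 2); rewrite ler_sqr ?nnegrE // => /(_ le).
    move=> le2; rewrite mulrDl (le_trans le2) // lerDl.
    by rewrite mulr_ge0 ?sqr_ge0.
  rewrite -mulr_suml ler_wpM2r ?sqr_ge0 // big_split /=.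
  apply: (@le_trans _ _ (dot p p + dot q q)).
    by rewrite le_eqVlt; apply/orP; left; apply/eqP; congr (_ + _); apply: eq_bigr => j _; rewrite expr2.
  have := close_sq cl; lra.
have a01 : 0 <= a <= 1 by rewrite a0.
have [|e1 e2 e3] := predictor_step n0 nb dd lin a01; last by split.
move=> t /andP[t0 ta].
have -> : cmul (xpart w + t *: xpart d) (spart w + t *: spart d)
    - (1 - t) *: cmul (xpart w) (spart w) =
    mu w *: ((t * (1 - t)) *: he + (t ^+ 2) *: cmul p q).
  apply/matrixP => j k; rewrite ord1.
  have hj := hvec_sqr n0 x0 s0 j; have hpj := hp j; have hqj := hq j; have pqj := pq j.
  rewrite -/h in hj hpj hqj pqj.
  have X1 : xpart w j 0 * spart w j 0 = mu w * h j 0 ^+ 2 by rewrite hj [RHS]mulrC divfK // gt_eqF.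
  have X2 : spart w j 0 * xpart d j 0 = mu w * (h j 0 * (p j 0 - h j 0)).
    by rewrite hpj [RHS]mulrC divfK // gt_eqF.
  have X3 : xpart w j 0 * spart d j 0 = mu w * (h j 0 * (q j 0 - h j 0)).
    by rewrite hqj [RHS]mulrC divfK // gt_eqF.
  have X4 : xpart d j 0 * spart d j 0 = mu w * ((p j 0 - h j 0) * (q j 0 - h j 0)).
    by rewrite pqj [RHS]mulrC divfK // gt_eqF.
  have -> : (cmul (xpart w + t *: xpart d) (spart w + t *: spart d)
    - (1 - t) *: cmul (xpart w) (spart w)) j 0 = t * (xpart w j 0 * spart w j 0) +
     t * (spart w j 0 * xpart d j 0 + xpart w j 0 * spart d j 0) + t ^+ 2 * (xpart d j 0 * spart d j 0).
    by rewrite !mxE; ring.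
  have -> : (mu w *: ((t * (1 - t)) *: he + (t ^+ 2) *: cmul p q)) j 0 =
      mu w * ((t * (1 - t)) * (h j 0 * (p j 0 + q j 0 - h j 0)) + t ^+ 2 * (p j 0 * q j 0)).
    rewrite [LHS]mxE; congr (_ * _); rewrite [LHS]mxE; congr (_ + _); rewrite mxE.
      by rewrite mxE.
    by rewrite cmulE.
  by rewrite X1 X2 X3 X4; ring.
have t1 : t <= 1 by apply: le_trans ta a1.
rewrite norm2Z gtr0_norm // [leRHS](_ : _ = mu w * ((1 - t) / 8)); last by ring.
rewrite ler_wpM2l ?(ltW m0) //; apply: le_trans (norm2D _ _) _; rewrite !norm2Z.
have u0 : 0 <= 1 - t by rewrite subr_ge0.
rewrite !ger0_norm ?sqr_ge0 ?mulr_ge0 //.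
have eps_t : 24 * Num.sqrt n%:R * epsilon w d <= 1 - t.
  by move: ta; rewrite /a lerBrDr lerBrDl.
have b1 : t * (1 - t) * norm2 he <= (1 - t) * (1 / 1000).
  rewrite -mulrA mulrCA ler_wpM2l //.
  have h1 : t * norm2 he <= 1 * norm2 he by rewrite ler_wpM2r ?norm2_ge0.
  by rewrite mul1r in h1; apply: le_trans h1 he_small.
have b2 : t ^+ 2 * norm2 (cmul p q) <= 1 * (15 / 10 * Num.sqrt n%:R * epsilon w d).
  by rewrite ler_pM ?sqr_ge0 ?norm2_ge0 // expr_le1.
lra.
Qed.

End LlsStep.

(** * Variables that are pinned at their order of magnitude *)

(** The scaled situation at an iterate. The family [zx], [zs] stands for the
    later points of the neighborhood, rescaled so that the current one is [h];
    [mt] is their duality measure. [eta] witnesses that the imbalances [k] are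
    those of a well-balanced subspace up to rescaling. The record is symmetric
    under exchanging primal and dual. *)
Record setting (R : realType) n (U : {vspace 'cV[R]_n}) (h : 'cV[R]_n)
    (pos : 'I_n -> nat) (N : nat) (k : 'I_n -> 'I_n -> R) (eta : 'I_n -> R) (K0 : R)
    (p q : 'cV[R]_n) (T : Type) (zx zs : T -> 'cV[R]_n) (mt : T -> R) : Prop := Setting {
  st_bal : balanced U k (gamma R n / n%:R) pos;
  st_N : forall i, (pos i <= N)%N;
  st_k0 : forall i j, 0 <= k i j;
  st_k : forall i j, k i j <= K0 * (eta j / eta i);
  st_kk : forall i j, 1 <= k i j * k j i;
  st_eta : forall i, 0 < eta i;
  st_K0 : 1 <= K0;
  st_p : layered U h pos p;
  st_q : layered (orthv U) h (fun i => N - pos i)%N q;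
  st_zx : forall t, zx t - h \in U;
  st_zs : forall t, zs t - h \in orthv U;
  st_zx0 : forall t i, 0 < zx t i 0;
  st_zs0 : forall t i, 0 < zs t i 0;
  st_monox : forall t t', mt t' <= mt t -> forall i, zx t' i 0 <= 3 * n%:R * zx t i 0;
  st_monos : forall t t', mt t' <= mt t -> forall i, zs t' i 0 <= 3 * n%:R * zs t i 0;
  st_sumx : forall t, \sum_i zx t i 0 <= 5 / 2 * n%:R;
  st_sums : forall t, \sum_i zs t i 0 <= 5 / 2 * n%:R;
  st_sump : \sum_i `|p i 0| <= 101 / 100 * n%:R;
  st_sumq : \sum_i `|q i 0| <= 101 / 100 * n%:R
}.

(** What one iteration contributes to the potential argument. The last condition
    says that [k i j] makes up for the decrease of the duality measure to [mplus]
    times the current one. The powers of M share their exponent |S| because a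
    path inside [S] multiplies the error by a constant at each step. *)
Definition event (R : realType) n (M : R) (k : 'I_n -> 'I_n -> R) (T : Type)
    (zx zs : T -> 'cV[R]_n) (mplus : R) : Prop :=
  exists (S : {set 'I_n}) (i j : 'I_n) (thx ths : R),
    [/\ i \in S, j \in S, forall l, l \in S -> k i l <= M ^+ #|S| / 2 /\ k l j <= M ^+ #|S| / 2,
        [/\ 0 < thx, 0 < ths, forall t, thx <= zx t i 0 <= M * thx
          & forall t, ths <= zs t j 0 <= M * ths]
      & mplus <= k i j * thx * ths * M ^+ #|S|].

Lemma setting_dual (R : realType) n U h pos N k eta (K0 : R) p q T zx zs mt :
  (0 < n)%N -> @setting R n U h pos N k eta K0 p q T zx zs mt ->
  setting (orthv U) h (fun i => N - pos i)%N N (fun i j => k j i) (fun i => (eta i)^-1)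
    K0 q p zs zx mt.
Proof.
move=> n0 [bal posN k0 kb kk eta0 K01 pL qL zxU zsU zx0 zs0 mx ms sx ss sp sq].
split=> //.
- exact: balanced_dual (ltW (sigma_gt0 n0)) k0 posN bal.
- by move=> i; apply: leq_subr.
- by move=> i j; rewrite invrK [_^-1 * _]mulrC.
- by move=> i; rewrite invr_gt0.
- rewrite orthvK (_ : (fun i => N - (N - pos i))%N = pos) //.
  by apply/funext => i; rewrite subKn.
- by move=> t; rewrite orthvK.
Qed.

Lemma event_dual (R : realType) n (M : R) k T (zx zs : T -> 'cV[R]_n) mplus :
  event M (fun i j => k j i) zs zx mplus -> event M k zx zs mplus.
Proof.
move=> [S [i [j [thx [ths [iS jS a [x0 s0 bx bs] c]]]]]].
exists S, j, i, ths, thx; split=> //; first by move=> l /a [].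
by rewrite (mulrAC (k j i)).
Qed.

Section Pins.
Context {R : realType} {n : nat} (n3 : (2 < n)%N).
Variables (U : {vspace 'cV[R]_n}) (h : 'cV[R]_n) (pos : 'I_n -> nat) (N : nat)
  (k : 'I_n -> 'I_n -> R) (eta : 'I_n -> R) (K0 : R) (p q : 'cV[R]_n)
  (T : Type) (zx zs : T -> 'cV[R]_n) (mt : T -> R).
Hypothesis st : setting U h pos N k eta K0 p q zx zs mt.

Local Notation g := (gamma R n).
Let sigma := g / n%:R.

Let n0 : (0 < n)%N. Proof. exact: leq_trans n3. Qed.

(** The index may first depend on the point; a point that comes last among
    finitely many counterexamples shows that one index serves for all. *)
Lemma uniform_pin (L : pred 'I_n) (e : R) :
  (forall t, exists2 i, L i & e <= zx t i 0) ->
  (exists i, L i) -> exists2 i, L i & forall t, e / (3 * n%:R) <= zx t i 0.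
Proof.
move=> H [i1 Li1]; apply: contrapT => none.
have nR : 0 < 3 * n%:R :> R by rewrite mulr_gt0 // ltr0n.
have bad i : exists t, L i -> zx t i 0 < e / (3 * n%:R).
  have [Li|] := boolP (L i); last first.
    move=> nLi; apply: contrapT => no; have [] : False.
    apply: none; exists i1 => // t; exfalso; apply: no; exists t => //.
  apply: contrapT => no; apply: none; exists i => // t.
  by rewrite leNgt; apply/negP => lt; apply: no; exists t.
have [f fP] := choice bad.
have [i Li imin] := @arg_minP _ _ _ i1 L (fun i => mt (f i)) Li1.
have [j Lj ej] := H (f i).
have := st_monox st (imin j Lj) j.
have := fP j Lj; rewrite ltr_pdivlMr // mulrC => h1 h2.
by have := lt_le_trans h1 ej; rewrite ltNge h2.
Qed.

Lemma z_bound t i : `|zx t i 0| = zx t i 0 /\ zx t i 0 <= 5 / 2 * n%:R.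
Proof.
split; first by rewrite gtr0_norm // (st_zx0 st).
apply: le_trans (st_sumx st t); rewrite (bigD1 i) //= lerDl sumr_ge0 // => l _.
exact: ltW (st_zx0 st t l).
Qed.

Lemma sum_diff t : \sum_l `|zx t l 0 - p l 0| <= 351 / 100 * n%:R.
Proof.
apply: (@le_trans _ _ (\sum_l (zx t l 0 + `|p l 0|))).
  by apply: ler_sum => l _; have [e _] := z_bound t l; rewrite -{2}e ler_normB.
rewrite big_split /=; have := st_sumx st t; have := st_sump st; lra.
Qed.

Lemma pin_large i0 : 8 * (g * n%:R) <= `|p i0 0| ->
  exists2 i, pos i = pos i0 & forall t, sigma <= zx t i 0.
Proof.
move=> big; have g0 := gamma_gt0 (R := R) n0; have nR := natn_ge3 (R := R) n3.
have [||i /eqP iL Hi] := @uniform_pin (fun i => pos i == pos i0) (4 * g); last first.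
- exists i => // t; apply: le_trans (Hi t).
  rewrite /sigma ler_pdivlMr; last lra.
  rewrite (_ : g / n%:R * (3 * n%:R) = 3 * g); last by field; rewrite gt_eqF //; lra.
  lra.
- by exists i0.
move=> t; have [lft _ _] := st_bal st; have [B lB bB] := lft (pos i0).
have [j jr le] := layered_pin (st_p st) (st_zx st t) lB.
exists j; first by rewrite jr.
have [e _] := z_bound t j; rewrite e in le.
have B_le : \sum_(l in [set j | (pos i0 < pos j)%N]) `|B j l| * `|zx t l 0 - p l 0|
    <= sigma * (351 / 100 * n%:R).
  apply: (@le_trans _ _ (sigma * \sum_l `|zx t l 0 - p l 0|)).
    rewrite mulr_sumr [leRHS](bigID (mem [set j | (pos i0 < pos j)%N])) /= ler_wpDr //.
      by apply: sumr_ge0 => l _; rewrite mulr_ge0 // ltW // sigma_gt0.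
    by apply: ler_sum => l _; rewrite ler_wpM2r //; have [] := bB l j.
  by rewrite ler_wpM2l ?sum_diff // ltW // sigma_gt0.
have sn : sigma * (351 / 100 * n%:R) = 351 / 100 * g.
  by rewrite /sigma; field; rewrite gt_eqF //; lra.
rewrite sn in B_le.
have := le_trans big le; rewrite -subr_ge0.
have -> : n%:R * (zx t j 0 + \sum_(l in [set j | (pos i0 < pos j)%N]) `|B j l| * `|zx t l 0 - p l 0|)
   - 8 * (g * n%:R) = n%:R * (zx t j 0 + \sum_(l in [set j | (pos i0 < pos j)%N]) `|B j l| * `|zx t l 0 - p l 0| - 8 * g) by ring.
rewrite pmulr_rge0; last lra.
lra.
Qed.

Let Q := K0 / sigma.

Lemma Q_ge1 : 1 <= Q.
Proof.
rewrite /Q ler_pdivlMr ?sigma_gt0 // mul1r (le_trans (sigma_le1 n0)) //.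
exact: st_K0 st.
Qed.

Lemma edge_eta u v : sigma <= k u v -> eta u <= Q * eta v.
Proof.
move=> ge; have s0 := sigma_gt0 (R := R) n0.
have := le_trans ge (st_k st u v); rewrite mulrA ler_pdivlMr ?(st_eta st) //.
by move=> le; rewrite /Q -mulrA [_^-1 * _]mulrC mulrA ler_pdivlMr // mulrC.
Qed.

(** Along an edge the potential [eta] drops by a factor at most Q, so along a
    simple path inside a set it drops by at most a power of Q. *)
Lemma layer_eta (S : {set 'I_n}) i j : pos i = pos j ->
  (forall l, pos l = pos i -> l \in S) -> eta i <= Q ^+ #|S|.-1 * eta j.
Proof.
move=> ij LS; have [_ _ conn] := st_bal st.
have /connectP [s pth jE] := conn i j ij.
case/shortenP: pth jE => s' pth uq _ jE.
have [Q1 e0] := (Q_ge1, st_eta st).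
pose E := fun u v => [&& pos u == pos i, pos v == pos i & g / n%:R <= k u v].
have gen a s0 : path E a s0 -> all (fun l => pos l == pos i) s0 /\
    eta a <= Q ^+ size s0 * eta (last a s0).
  elim: s0 a => [|b s0 IH] a /=; first by rewrite expr0 mul1r.
  move=> /andP[/and3P[_ pb kab] /IH [al le]]; rewrite pb al; split=> //.
  rewrite exprS -mulrA; apply: le_trans (edge_eta kab) _.
  by rewrite ler_wpM2l //; lra.
have [al le] := gen i s' pth; rewrite -jE in le.
have szS : (size s' <= #|S|.-1)%N.
  have : (size (i :: s') <= #|S|)%N.
    rewrite -(card_uniqP uq); apply: subset_leq_card; apply/subsetP => l.
    by rewrite inE => /orP[/eqP ->|/(allP al) /eqP]; exact: LS.
  by rewrite /=; case: #|S|.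
apply: le_trans le _.
by rewrite ler_wpM2r ?(ltW (e0 j)) // ler_weXn2l.
Qed.

Lemma k_le (i j : 'I_n) (c : R) : eta j <= c * eta i -> k i j <= K0 * c.
Proof.
move=> le; apply: le_trans (st_k st i j) _; have := st_K0 st => K1.
by rewrite ler_wpM2l ?ler_pdivrMr ?(st_eta st) //; lra.
Qed.

Lemma k_ge (i j : 'I_n) (c : R) : k j i <= c -> 1 <= k i j * c.
Proof.
by move=> le; apply: le_trans (st_kk st i j) _; rewrite ler_wpM2l ?(st_k0 st).
Qed.

(** The power of Q beyond the first pays for the lower bounds sigma of two pinned
    variables, the power of n for the losses in the pinning. *)
Definition Mbound : R := 500 * n%:R ^+ 3 * Q ^+ 3.

(* Mbound = Q * B: inside S a factor Q is lost per index, and B is left over *)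
Let B := 500 * n%:R ^+ 3 * Q ^+ 2.

Lemma n_cube : n%:R <= n%:R ^+ 3 :> R /\ 27 <= n%:R ^+ 3 :> R.
Proof.
have nR := natn_ge3 (R := R) n3; split.
  by rewrite -[leLHS]expr1 ler_weXn2l //; lra.
have -> : 27 = 3 ^+ 3 :> R by rewrite -natrX.
by rewrite lerXn2r // nnegrE; lra.
Qed.

Lemma Q_sigma : Q * sigma = K0.
Proof. by rewrite divfK // gt_eqF // sigma_gt0. Qed.

Lemma n_le_Q : n%:R <= Q.
Proof.
have g0 := gamma_gt0 (R := R) n0; have nR := natn_ge3 (R := R) n3; have K1 := st_K0 st.
rewrite /Q /sigma invfM invrK mulrA [leRHS]mulrC -[leLHS]mulr1 ler_wpM2l //.
rewrite ler_pdivlMr // mul1r; apply: le_trans K1.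
by have := gamma_pow (R := R) n3 (k := 0) isT; rewrite expr0 mulr1; lra.
Qed.

Lemma pow_half (a c : R) (s : nat) : (0 < s)%N -> 0 <= a -> a <= c / 2 ->
  a ^+ s <= c ^+ s / 2.
Proof.
case: s => // s _ a0 ac; rewrite !exprS [leRHS]mulrAC.
apply: ler_pM => //; first by rewrite exprn_ge0.
by rewrite lerXn2r ?nnegrE //; lra.
Qed.

Lemma Qpow_le (s : nat) : (0 < s)%N -> Q ^+ s <= Mbound ^+ s / 2.
Proof.
have Q1 := Q_ge1; have q1 : 1 <= Q ^+ 2 by rewrite exprn_ege1.
have [_ h27] := n_cube.
move=> s0; apply: pow_half => //; first lra.
have -> : Mbound / 2 = Q * (500 * n%:R ^+ 3 * Q ^+ 2 / 2) by rewrite /Mbound; ring.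
by rewrite ler_peMr //; [lra | nra].
Qed.

Lemma Mpow_ge (s : nat) : (0 < s)%N -> Q ^+ s * B <= Mbound ^+ s.
Proof.
move=> s0; have -> : Mbound = Q * B by rewrite /Mbound /B; ring.
have Q1 := Q_ge1; have [_ h27] := n_cube; have q1 : 1 <= Q ^+ 2 by rewrite exprn_ege1.
have -> : (Q * B) ^+ s = Q ^+ s * B ^+ s by rewrite exprMn.
have Qs : 0 <= Q ^+ s by rewrite exprn_ge0 //; lra.
apply: (ler_wpM2l Qs).
by rewrite -[leLHS]expr1 ler_weXn2l // /B; nra.
Qed.

Lemma k_layer (S : {set 'I_n}) i j : pos i = pos j ->
  (forall l, pos l = pos i -> l \in S) -> k i j <= Q ^+ #|S|.
Proof.
move=> ij LS; have := layer_eta (esym ij) (fun l e => LS l (etrans e (esym ij))).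
move=> /k_le le; apply: le_trans le _.
have S0 : (0 < #|S|)%N by apply/card_gt0P; exists i; apply: LS.
have Q1 := Q_ge1; have s0 := sigma_gt0 (R := R) n0.
rewrite -[X in _ <= _ ^+ X](prednK S0) exprS ler_wpM2r ?exprn_ge0 //; first lra.
rewrite -Q_sigma ler_piMr //; first lra.
exact: sigma_le1.
Qed.

(** Since M = Q B, an imbalance that is only bounded below by c Q^-|S| still
    leaves c B after multiplication by M^|S|; by [B_sigma2] this covers
    lower bounds sigma of both pinned variables. *)
Lemma weight_bound (s : nat) (c kk : R) : (0 < s)%N -> 0 <= kk -> 0 <= c ->
  c <= kk * Q ^+ s -> c * B <= kk * Mbound ^+ s.
Proof.
move=> s0 kk0 c0 le; have [_ h27] := n_cube; have Q1 := Q_ge1.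
have q1 : 1 <= Q ^+ 2 by rewrite exprn_ege1.
have B0 : 0 <= B by rewrite /B; nra.
apply: le_trans (ler_wpM2r B0 le) _; rewrite -mulrA.
by rewrite ler_wpM2l ?Mpow_ge.
Qed.

Lemma B_sigma2 : 500 * n%:R ^+ 3 <= sigma ^+ 2 * B.
Proof.
have -> : sigma ^+ 2 * B = 500 * n%:R ^+ 3 * (Q * sigma) ^+ 2 by rewrite /B; ring.
rewrite Q_sigma; have K1 := st_K0 st; have [_ h27] := n_cube.
have : 1 <= K0 ^+ 2 by rewrite exprn_ege1.
nra.
Qed.

Lemma upper_sigma t i : zx t i 0 <= Mbound * sigma.
Proof.
have [_ le] := z_bound t i; apply: le_trans le _.
have -> : Mbound * sigma = 500 * n%:R ^+ 3 * Q ^+ 2 * (Q * sigma) by rewrite /Mbound; ring.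
rewrite Q_sigma; have K1 := st_K0 st; have [h3 h27] := n_cube.
have q1 : 1 <= Q ^+ 2 by rewrite exprn_ege1 // Q_ge1.
have : 1 <= Q ^+ 2 * K0 by rewrite mulr_ege1.
nra.
Qed.

End Pins.

Section Events.
Context {R : realType} {n : nat} (n3 : (2 < n)%N).
Implicit Types (pos : 'I_n -> nat) (k : 'I_n -> 'I_n -> R).

Local Notation g := (gamma R n).

Let n0 : (0 < n)%N. Proof. exact: leq_trans n3. Qed.

Lemma mplus_le (eps : R) : 0 <= eps ->
  24 * Num.sqrt n%:R * eps <= eps / (16 * n%:R ^+ 2) * (500 * n%:R ^+ 3).
Proof.
move=> e0; have nR := natn_ge3 (R := R) n3.
have -> : eps / (16 * n%:R ^+ 2) * (500 * n%:R ^+ 3) = 125 / 4 * n%:R * eps.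
  by field; rewrite gt_eqF //; lra.
have [_ sn] := sqrt_n (R := R) n3.
by apply: ler_wpM2r => //; lra.
Qed.

(** Inside a layer all imbalances are at most Q^|S|, that of (j, i) too, and
    this bounds the imbalance of (i, j) from below. *)
Lemma event_same_layer U (h : 'cV[R]_n) pos N k eta (K0 : R) p q T (zx zs : T -> 'cV[R]_n) mt
    mplus i0 j0 :
  setting U h pos N k eta K0 p q zx zs mt -> pos i0 = pos j0 ->
  8 * (g * n%:R) <= `|p i0 0| -> 8 * (g * n%:R) <= `|q j0 0| -> mplus <= 1 ->
  event (Mbound (n := n) K0) k zx zs mplus.
Proof.
move=> st ij0 pi0 qj0 m1.
have st' := setting_dual n0 st.
have [i ii0 Hi] := pin_large n3 st pi0.
have [j jj0' Hj] := pin_large n3 st' qj0.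
have jj0 : pos j = pos j0 by have := st_N st j; have := st_N st j0; lia.
set s := g / n%:R in Hi Hj; have s0 : 0 < s by apply: sigma_gt0.
pose S := [set l | pos l == pos i0].
have inS l : (l \in S) = (pos l == pos i0) by rewrite inE.
have iS : i \in S by rewrite inS ii0.
have jS : j \in S by rewrite inS jj0 ij0.
have cS : (0 < #|S|)%N by apply/card_gt0P; exists i.
have kb u v : u \in S -> v \in S -> k u v <= (K0 / s) ^+ #|S|.
  rewrite !inS => /eqP uS /eqP vS; apply: (k_layer n3 st); first by rewrite uS.
  by move=> l lu; rewrite inS lu uS.
exists S, i, j, s, s; split=> //.
- move=> l lS; split; apply: le_trans (Qpow_le n3 st cS); exact: kb.
- split=> // t; first by rewrite Hi (upper_sigma n3 st).
  by rewrite Hj (upper_sigma n3 st').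
- have k1 := k_ge st (kb j i jS iS).
  have := weight_bound n3 st cS (st_k0 st i j) ler01 k1; rewrite mul1r => le.
  have := B_sigma2 n3 st; rewrite -/s => Bs; have [_ h27] := n_cube (R := R) n3.
  rewrite (_ : k i j * s * s * _ = s ^+ 2 * (k i j * Mbound (n := n) K0 ^+ #|S|)); last by ring.
  by apply: le_trans (ler_wpM2l (sqr_ge0 s) le); apply: le_trans Bs; lra.
Qed.

(** The imbalance of (i1, j1) points against the order of the layers. The
    potential [eta] transfers it, along paths inside the two layers, to the pair
    that is pinned there; in the order of the layers imbalances are large
    anyway. *)
Lemma event_crossover U (h : 'cV[R]_n) pos N k eta (K0 : R) p q T (zx zs : T -> 'cV[R]_n) mt
    (eps : R) i0 j0 i1 j1 :
  setting U h pos N k eta K0 p q zx zs mt -> (pos j0 < pos i0)%N -> 0 < eps ->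
  8 * (g * n%:R) <= `|p i0 0| -> 8 * (g * n%:R) <= `|q j0 0| ->
  pos i1 = pos i0 -> pos j1 = pos j0 -> eps / (16 * n%:R ^+ 2) <= k i1 j1 ->
  event (Mbound (n := n) K0) k zx zs (24 * Num.sqrt n%:R * eps).
Proof.
move=> st ji0 eps0 pi0 qj0 i10 j10 kij1.
have st' := setting_dual n0 st; have nR := natn_ge3 (R := R) n3.
have [i ii0 Hi] := pin_large n3 st pi0.
have [j jj0' Hj] := pin_large n3 st' qj0.
have jj0 : pos j = pos j0 by have := st_N st j; have := st_N st j0; lia.
set s := g / n%:R in Hi Hj; have s0 : 0 < s by apply: sigma_gt0.
pose S := [set l | (pos j0 <= pos l)%N && (pos l <= pos i0)%N].
have inS l : (l \in S) = (pos j0 <= pos l)%N && (pos l <= pos i0)%N by rewrite inE.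
have iS : i \in S by rewrite inS ii0 leqnn ltnW.
have jS : j \in S by rewrite inS jj0 leqnn ltnW.
have cS : (0 < #|S|)%N by apply/card_gt0P; exists i.
pose Q := K0 / s.
have Q1 : 1 <= Q := Q_ge1 n3 st.
have KQ : K0 <= Q.
  have K1 := st_K0 st; rewrite /Q ler_pdivlMr // ler_piMr //; first lra.
  exact: sigma_le1.
pose La := [set l | pos l == pos i0]; pose Lb := [set l | pos l == pos j0].
have cab : (#|La| + #|Lb| <= #|S|)%N.
  rewrite -cardsUI (_ : La :&: Lb = finset.set0) ?cards0 ?addn0.
    apply: subset_leq_card; apply/subsetP => l; rewrite !inE => /orP[/eqP -> | /eqP ->].
      by rewrite leqnn ltnW.
    by rewrite leqnn ltnW.
  by apply/setP => l; rewrite !inE; apply/negP => /andP[/eqP -> /eqP e]; move: ji0; rewrite e ltnn.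
have ca : (0 < #|La|)%N by apply/card_gt0P; exists i0; rewrite inE.
have cb : (0 < #|Lb|)%N by apply/card_gt0P; exists j0; rewrite inE.
have c2 : (1 < #|S|)%N by exact: leq_trans (leq_add ca cb) cab.
have fwd u v : (pos u < pos v)%N -> k v u <= Q ^+ #|S|.
  move=> uv; have := edge_eta n3 st (bal_fwd (st_bal st) uv) => /(k_le st) le.
  apply: le_trans le _; rewrite -/s -/Q.
  apply: (@le_trans _ _ (Q ^+ 2)); first by rewrite expr2 ler_wpM2r //; lra.
  by rewrite ler_weXn2l.
have kb_i l : l \in S -> k i l <= Q ^+ #|S|.
  rewrite inS => /andP[h1]; rewrite leq_eqVlt => /orP[/eqP e|lt].
    apply: (k_layer n3 st); first by rewrite ii0.
    by move=> l' e'; rewrite inS e' ii0 leqnn ltnW.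
  by apply: fwd; rewrite ii0.
have kb_j l : l \in S -> k l j <= Q ^+ #|S|.
  rewrite inS => /andP[]; rewrite leq_eqVlt => /orP[/eqP e _|lt _].
    apply: (k_layer n3 st); first by rewrite jj0.
    by move=> l' e'; rewrite inS e' -e leqnn ltnW.
  by apply: fwd; rewrite jj0.
exists S, i, j, s, s; split=> //.
- by move=> l lS; split; apply: le_trans (Qpow_le n3 st cS); rewrite -/s -/Q; [exact: kb_i | exact: kb_j].
- split=> // t; first by rewrite Hi (upper_sigma n3 st).
  by rewrite Hj (upper_sigma n3 st').
- pose tau := eps / (16 * n%:R ^+ 2).
  have n2 : 0 < 16 * n%:R ^+ 2 :> R by rewrite mulr_gt0 // exprn_gt0 //; lra.
  have tau0 : 0 < tau by rewrite divr_gt0.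
  have e_i : eta i <= Q ^+ #|La|.-1 * eta i1.
    by apply: (layer_eta n3 st); [rewrite ii0 | move=> l e; rewrite inE e ii0].
  have e_j : eta j1 <= Q ^+ #|Lb|.-1 * eta j.
    by apply: (layer_eta n3 st); [rewrite jj0 | move=> l e; rewrite inE e j10].
  have e_1 : tau * eta i1 <= K0 * eta j1.
    have := le_trans kij1 (st_k st i1 j1); rewrite mulrA ler_pdivlMr ?(st_eta st) //.
  have K1 := st_K0 st; have et := st_eta st.
  have qp r : 0 <= Q ^+ r by rewrite exprn_ge0 //; lra.
  have kji : k j i <= Q ^+ #|S| / tau.
    have le : eta i <= (Q ^+ #|La|.-1 * K0 * Q ^+ #|Lb|.-1 / tau) * eta j.
      rewrite mulrAC ler_pdivlMr // [leLHS]mulrC.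
      have h1 := ler_wpM2l (ltW tau0) e_i.
      have h2 := ler_wpM2l (qp #|La|.-1) e_1.
      have h3 := ler_wpM2l (mulr_ge0 (qp #|La|.-1) (le_trans ler01 K1)) e_j.
      apply: le_trans h1 _; rewrite mulrCA; apply: le_trans h2 _.
      by rewrite mulrA; apply: le_trans h3 _; rewrite mulrA.
    apply: le_trans (k_le st le) _.
    rewrite (_ : K0 * _ = K0 * K0 * (Q ^+ #|La|.-1 * Q ^+ #|Lb|.-1) / tau); last by ring.
    rewrite ler_pM2r ?invr_gt0 // -exprD.
    apply: (@le_trans _ _ (Q ^+ 2 * Q ^+ (#|La|.-1 + #|Lb|.-1))).
      by apply: ler_wpM2r => //; rewrite expr2; apply: ler_pM => //; lra.
    have cc : (2 + (#|La|.-1 + #|Lb|.-1) <= #|S|)%N by move: ca cb cab; clear; lia.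
    by rewrite -exprD ler_weXn2l.
  have k1 := k_ge st kji; rewrite mulrA ler_pdivlMr // mul1r in k1.
  have le := weight_bound n3 st cS (st_k0 st i j) (ltW tau0) k1.
  have Bs := B_sigma2 n3 st; rewrite -/s in Bs.
  rewrite (_ : k i j * s * s * _ = s ^+ 2 * (k i j * Mbound (n := n) K0 ^+ #|S|)); last by ring.
  apply: le_trans (ler_wpM2l (sqr_ge0 s) le); rewrite mulrCA.
  by apply: le_trans (mplus_le (ltW eps0)) _; exact: (ler_wpM2l (ltW tau0) Bs).
Qed.

(** The layer of [i0] is pure: its primal residuals are at most [eps] while a dual
    residual is large. If no imbalance couples it with a later layer having large
    primal residuals, then the pin at [i0] sees only changes that are small
    compared with [eps], so a primal variable of this layer has order [eps]. *)
Lemma event_pure_layer U (h : 'cV[R]_n) pos N k eta (K0 : R) p q T (zx zs : T -> 'cV[R]_n) mt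
    (eps : R) i0 j0 :
  setting U h pos N k eta K0 p q zx zs mt -> 0 < eps ->
  eps <= `|p i0 0| -> (forall l, pos l = pos i0 -> `|p l 0| <= eps) ->
  pos j0 = pos i0 -> 8 * (g * n%:R) <= `|q j0 0| ->
  (forall t l, `|p l 0| <= eps -> zx t l 0 <= 80 * n%:R ^+ 2 * eps) ->
  (forall l j, (pos i0 < pos l)%N -> eps < `|p l 0| -> pos j = pos i0 ->
    k l j <= eps / (16 * n%:R ^+ 2)) ->
  event (Mbound (n := n) K0) k zx zs (24 * Num.sqrt n%:R * eps).
Proof.
move=> st eps0 pi0 small j0i qj0 up cross.
have st' := setting_dual n0 st; have nR := natn_ge3 (R := R) n3.
have n2 : 0 < n%:R ^+ 2 :> R by rewrite exprn_gt0 //; lra.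
set s := g / n%:R; have s0 : 0 < s by apply: sigma_gt0.
have tau0 : 0 <= eps / (16 * n%:R ^+ 2).
  by rewrite divr_ge0 ?(ltW eps0) // mulr_ge0 // ltW.
have [t||i /eqP ii0 Hi] := @uniform_pin _ _ n3 _ _ _ _ _ _ _ _ _ _ _ _ _ st
    (fun i => pos i == pos i0) (eps / (2 * n%:R)); last first.
- have [j jj0' Hj] := pin_large n3 st' qj0.
  have jj0 : pos j = pos i0 by have := st_N st j; have := st_N st j0; lia.
  rewrite -/s in Hj.
  pose S := [set l | pos l == pos i0].
  have inS l : (l \in S) = (pos l == pos i0) by rewrite inE.
  have iS : i \in S by rewrite inS ii0.
  have jS : j \in S by rewrite inS jj0.
  have cS : (0 < #|S|)%N by apply/card_gt0P; exists i.
  have kb u v : u \in S -> v \in S -> k u v <= (K0 / s) ^+ #|S|.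
    rewrite !inS => /eqP uS /eqP vS; apply: (k_layer n3 st); first by rewrite uS.
    by move=> l lu; rewrite inS lu uS.
  have Q1 := Q_ge1 n3 st; have nQ := n_le_Q n3 st; rewrite -/s in Q1 nQ.
  have [h3 h27] := n_cube (R := R) n3.
  have te : eps / (2 * n%:R) / (3 * n%:R) = eps / (6 * n%:R ^+ 2).
    by field; rewrite gt_eqF //; lra.
  rewrite te in Hi.
  have th0 : 0 < eps / (6 * n%:R ^+ 2) by rewrite divr_gt0 // mulr_gt0.
  exists S, i, j, (eps / (6 * n%:R ^+ 2)), s; split=> //.
  + move=> l lS; split; apply: le_trans (Qpow_le n3 st cS); exact: kb.
  + split=> // t; last by rewrite Hj (upper_sigma n3 st').
    rewrite Hi; apply: le_trans (up t i (small i ii0)) _.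
    have -> : 80 * n%:R ^+ 2 * eps = 480 * n%:R ^+ 3 * n%:R * (eps / (6 * n%:R ^+ 2)).
      by field; rewrite gt_eqF //; lra.
    rewrite ler_pM2r // /Mbound -/s.
    have q3 : n%:R <= (K0 / s) ^+ 3.
      by apply: le_trans nQ _; rewrite -[leLHS]expr1 ler_weXn2l.
    by apply: ler_pM => //; lra.
  + have k1 := k_ge st (kb j i jS iS).
    have := weight_bound n3 st cS (st_k0 st i j) ler01 k1; rewrite mul1r => le.
    have := B_sigma2 n3 st; rewrite -/s => Bs.
    rewrite (_ : k i j * _ * s * _ =
      eps / (6 * n%:R ^+ 2) * (s * (k i j * Mbound (n := n) K0 ^+ #|S|))); last by ring.
    apply: le_trans (mplus_le (ltW eps0)) _; apply: ler_pM => //.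
    * by rewrite mulr_ge0 ?exprn_ge0 //; lra.
    * have s6 : 0 < 6 * n%:R ^+ 2 :> R by rewrite mulr_gt0.
      have s16 : 0 < 16 * n%:R ^+ 2 :> R by rewrite mulr_gt0.
      by rewrite ler_pM2l // lef_pV2 ?posrE // ler_pM2r // ler_nat.
    apply: le_trans Bs _; rewrite expr2 -mulrA; apply: ler_wpM2l; first exact: ltW.
    apply: le_trans le; rewrite ler_piMl //; last exact: sigma_le1.
    have q2 : 1 <= (K0 / s) ^+ 2 by rewrite exprn_ege1.
    by apply: mulr_ge0; lra.
- by exists i0.
have [lft _ _] := st_bal st; have [B lB bB] := lft (pos i0).
have [j jr le] := layered_pin (st_p st) (st_zx st t) lB.
exists j; first by rewrite jr.
have [e _] := z_bound st t j; rewrite e in le.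
have B_le : \sum_(l in [set j | (pos i0 < pos j)%N]) `|B j l| * `|zx t l 0 - p l 0|
    <= eps / (2 * n%:R).
  apply: (@le_trans _ _ (\sum_(l < n) (s * (81 * n%:R ^+ 2 * eps)
      + eps / (16 * n%:R ^+ 2) * `|zx t l 0 - p l 0|))).
    have h1 : 0 <= 81 * n%:R ^+ 2 * eps by rewrite !mulr_ge0 ?(ltW eps0) // ltW.
    have h2 : 0 <= s * (81 * n%:R ^+ 2 * eps) by apply: mulr_ge0 h1; apply: ltW.
    have t0 l : 0 <= s * (81 * n%:R ^+ 2 * eps) + eps / (16 * n%:R ^+ 2) * `|zx t l 0 - p l 0|.
      by rewrite addr_ge0 // mulr_ge0.
    rewrite [leRHS](bigID (mem [set j | (pos i0 < pos j)%N])) /= ler_wpDr //.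
      by apply: sumr_ge0.
    apply: ler_sum => l; rewrite inE => il; have [b1 b2] := bB l j.
    have [ple|plt] := leP `|p l 0| eps; last first.
      apply: ler_wpDl h2 _.
      by rewrite ler_wpM2r // (le_trans b2) ?cross.
    apply: ler_wpDr; first by rewrite mulr_ge0.
    apply: ler_pM => //; apply: le_trans (ler_normB _ _) _.
    have [-> _] := z_bound st t l; have := up t l ple.
    have : 1 * eps <= n%:R ^+ 2 * eps by rewrite ler_pM2r // exprn_ege1 //; lra.
    lra.
  rewrite big_split /= sumr_const card_ord -mulr_sumr -[_ *+ n]mulr_natr.
  have sd := ler_wpM2l tau0 (sum_diff st t).
  have g5 := gamma_pow (R := R) n3 (k := 5) isT.
  have -> : s * (81 * n%:R ^+ 2 * eps) * n%:R = 81 * (g * n%:R ^+ 5) * eps / n%:R ^+ 3.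
    by rewrite /s; field; rewrite gt_eqF //; lra.
  have -> : eps / (2 * n%:R) = eps / n%:R ^+ 3 * (n%:R ^+ 2 / 4) + eps / (4 * n%:R).
    by field; rewrite gt_eqF //; lra.
  apply: lerD.
    have en : 0 < eps / n%:R ^+ 3 by rewrite divr_gt0 // exprn_gt0 //; lra.
    rewrite -mulrA mulrC ler_pM2l //; nra.
  apply: le_trans sd _.
  have -> : eps / (16 * n%:R ^+ 2) * (351 / 100 * n%:R) = eps / (4 * n%:R) * (351 / 400).
    by field; rewrite gt_eqF //; lra.
  by rewrite ler_piMr ?divr_ge0 ?(ltW eps0) ?mulr_ge0 //; lra.
have le2 := le_trans pi0 le.
have : n%:R * (zx t j 0 + eps / (2 * n%:R)) >= eps.
  by apply: le_trans le2 _; rewrite ler_wpM2l // lerD2l.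
rewrite mulrDr (_ : n%:R * (eps / (2 * n%:R)) = eps / 2); last by field; rewrite gt_eqF //; lra.
rewrite ler_pdivrMr; last lra.
lra.
Qed.

(** Any primal residual above [eps] in the layer of [i0] is large and meets the
    large dual residual of [i0]; otherwise the layer is pure. *)
Lemma event_small_primal U (h : 'cV[R]_n) pos N k eta (K0 : R) p q T
    (zx zs : T -> 'cV[R]_n) mt (eps : R) i0 :
  setting U h pos N k eta K0 p q zx zs mt -> 0 < eps ->
  24 * Num.sqrt n%:R * eps <= 1 ->
  eps <= `|p i0 0| -> `|p i0 0| <= eps -> 8 * (g * n%:R) <= `|q i0 0| ->
  (forall l, eps < `|p l 0| -> 8 * (g * n%:R) <= `|p l 0|) ->
  (forall t l, `|p l 0| <= eps -> zx t l 0 <= 80 * n%:R ^+ 2 * eps) ->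
  event (Mbound (n := n) K0) k zx zs (24 * Num.sqrt n%:R * eps).
Proof.
move=> st eps0 e1 pi0 pi0' qi0 large up.
have [[l [li pl]]|same] := pselect (exists l, pos l = pos i0 /\ eps < `|p l 0|).
  exact: event_same_layer st li (large l pl) qi0 e1.
have [[l [j [il pl ji kl]]]|cross] := pselect (exists l j,
    [/\ (pos i0 < pos l)%N, eps < `|p l 0|, pos j = pos i0 & eps / (16 * n%:R ^+ 2) <= k l j]).
  exact: (event_crossover st il eps0 (large l pl) qi0 erefl ji kl).
apply: (event_pure_layer st eps0 pi0 _ erefl qi0 up) => [l li|l j il pl ji].
  by rewrite leNgt; apply/negP => lt; apply: same; exists l.
by rewrite leNgt; apply/negP => /ltW lt; apply: cross; exists l, j.
Qed.

(** [eps] is attained by a primal or by a dual residual, and duality exchanges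
    the two cases. *)
Lemma event_small U (h : 'cV[R]_n) pos N k eta (K0 : R) p q T
    (zx zs : T -> 'cV[R]_n) mt (eps : R) i0 :
  setting U h pos N k eta K0 p q zx zs mt -> 0 < eps ->
  24 * Num.sqrt n%:R * eps <= 1 -> Num.min `|p i0 0| `|q i0 0| = eps ->
  (forall l, `|p l 0| <= eps /\ 8 * (g * n%:R) <= `|q l 0| \/
             `|q l 0| <= eps /\ 8 * (g * n%:R) <= `|p l 0|) ->
  (forall t l, `|p l 0| <= eps -> zx t l 0 <= 80 * n%:R ^+ 2 * eps) ->
  (forall t l, `|q l 0| <= eps -> zs t l 0 <= 80 * n%:R ^+ 2 * eps) ->
  event (Mbound (n := n) K0) k zx zs (24 * Num.sqrt n%:R * eps).
Proof.
move=> st eps0 e1 em dich upx ups.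
have largep l : eps < `|p l 0| -> 8 * (g * n%:R) <= `|p l 0|.
  by have [[le _]|[]] := dich l => //; rewrite ltNge le.
have largeq l : eps < `|q l 0| -> 8 * (g * n%:R) <= `|q l 0|.
  by have [[]|[le _]] := dich l => //; rewrite [_ < _]ltNge le.
have [pq|qp] := leP `|p i0 0| `|q i0 0|.
  rewrite (min_idPl pq) in em.
  apply: (event_small_primal st eps0 e1 _ _ _ largep upx (i0 := i0)); rewrite ?em //.
  have [[_ ->]|[_ le]] := dich i0 => //; exact: le_trans le pq.
rewrite (min_idPr (ltW qp)) in em.
apply: event_dual.
apply: (event_small_primal (setting_dual n0 st) eps0 e1 _ _ _ largeq ups (i0 := i0)); rewrite ?em //.
have [[_ le]|[_ ->]] := dich i0 => //; exact: le_trans le (ltW qp).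
Qed.

End Events.

(** * One iteration: progress of the duality measure and a pinned pair *)

Section Iteration.
Context {R : realType} {m n : nat} (A : 'M[R]_(m, n)) (b : 'cV[R]_m) (c : 'cV[R]_n).
Hypotheses (n3 : (2 < n)%N) (Aconn : connectedv (kerspace A)).
Variables (e : 'cV[R]_n) (K0 : R).
Hypotheses (e0 : forall i, 0 < e i 0) (K01 : 1 <= K0)
  (eK : forall i j, kap (kerspace A) i j * e j 0 / e i 0 <= K0).
Implicit Types (w d : pdpoint R m n).

Local Notation g := (gamma R n).
Local Notation mu := Defs.mu.
Local Notation delta := Defs.delta.
Local Notation W := (kerspace A).
Local Notation M := (Mbound (n := n) K0).

Let n0 : (0 < n)%N. Proof. exact: leq_trans n3. Qed.

(** Later iterates satisfy this for every earlier value [t] of the duality measure;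
    quantifying over all such points keeps the algorithm out of the argument. *)
Definition near_path (t : R) w : Prop := neighborhood A b c (1 / 8) w /\ mu w <= t.

(** The imbalance of the pair seen from [w]; on the neighborhood it is, up to a
    constant factor, the imbalance of (i, j) in the rescaled kernel. *)
Definition weight w i j : R := kap W i j * (xpart w i 0 * spart w j 0) / mu w.

Lemma weightE w i j : weight w i j = kap W i j * (xpart w i 0 * spart w j 0) / mu w.
Proof. by []. Qed.

(** The counterpart of [event] in the original coordinates, which do not change
    from one iterate to the next. *)
Definition pinned_pair w (t : R) (S : {set 'I_n}) (i j : 'I_n) : Prop :=
  exists thx ths : R,
    [/\ i \in S, j \in S,
        forall l, l \in S -> weight w i l <= M ^+ #|S| /\ weight w l j <= M ^+ #|S|,
        [/\ 0 < thx, 0 < ths, forall w', near_path t w' -> thx <= xpart w' i 0 <= M * thx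
          & forall w', near_path t w' -> ths <= spart w' j 0 <= M * ths]
      & t <= kap W i j * thx * ths * M ^+ #|S|].

Lemma coord_of_sum (u v : 'cV[R]_n) (s : R) i : (forall i, 0 < u i 0) ->
  (forall i, 0 < v i 0) -> \sum_i v i 0 / u i 0 <= s -> v i 0 <= s * u i 0.
Proof.
move=> u0 v0 le; rewrite -ler_pdivrMr //; apply: le_trans le.
rewrite (bigD1 i) //= lerDl sumr_ge0 // => l _.
by rewrite divr_ge0 ?ltW.
Qed.

Lemma later_le w1 w2 i : neighborhood A b c (1 / 4) w1 -> strictly_feasible A b c w2 ->
  mu w2 <= mu w1 ->
  xpart w2 i 0 <= 3 * n%:R * xpart w1 i 0 /\ spart w2 i 0 <= 3 * n%:R * spart w1 i 0.
Proof.
move=> N1 F2 le; have [F1 _] := N1; have nR := natn_ge3 (R := R) n3.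
have lo : forall i, 3 / 4 * mu w1 <= xpart w1 i 0 * spart w1 i 0.
  by move=> l; have /andP[] := neighborhood_coord n0 l N1; lra.
have [|sx ss] := near_monotone n0 F1 F2 le _ lo; first lra.
have [_ x10 _ s10] := F1; have [_ x20 _ s20] := F2.
by split; apply: coord_of_sum => //; lra.
Qed.

Lemma neighborhood_weaken w : neighborhood A b c (1 / 8) w -> neighborhood A b c (1 / 4) w.
Proof. by move=> [F le]; split=> //; apply: le_trans le _; lra. Qed.

Lemma small_epsilon (eps : R) : 0 < eps -> eps <= 12 * n%:R * Num.sqrt n%:R * g ->
  24 * Num.sqrt n%:R * eps <= 1 / 4 /\ eps <= 1 / 100.
Proof.
move=> eps0 epsu.
have g0 := gamma_gt0 (R := R) n0; have nR := natn_ge3 (R := R) n3; have [r1 rn] := sqrt_n (R := R) n3.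
have gn0 : 0 <= g * n%:R by rewrite mulr_ge0 //; lra.
have eps_g2 : eps <= 12 * (g * n%:R ^+ 2).
  apply: le_trans epsu _.
  rewrite (_ : 12 * _ * _ * g = 12 * (g * n%:R) * Num.sqrt n%:R); last by ring.
  rewrite (_ : 12 * (g * n%:R ^+ 2) = 12 * (g * n%:R) * n%:R); last by ring.
  by rewrite ler_wpM2l //; lra.
split; last by have := gamma_pow (R := R) n3 (k := 2) isT; lra.
apply: (@le_trans _ _ (288 * (g * n%:R ^+ 3))).
  rewrite (_ : 288 * (g * n%:R ^+ 3) = 24 * n%:R * (12 * (g * n%:R ^+ 2))); last by ring.
  have s0 : 0 <= 24 * Num.sqrt (n%:R : R) by lra.
  have sn : 24 * Num.sqrt (n%:R : R) <= 24 * n%:R by lra.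
  exact: ler_pM s0 (ltW eps0) sn eps_g2.
by have := gamma_pow (R := R) n3 (k := 3) isT; lra.
Qed.

(** The residuals of an index add up to almost 1, so one of them is large. *)
Lemma other_residual (u v h eps : R) : 93 / 100 <= h ->
  `|u + v - h| <= 202 / 100 * (g * n%:R) -> eps <= 1 / 100 -> `|u| <= eps ->
  8 * (g * n%:R) <= `|v|.
Proof.
move=> h1 h2 e1 h3; have gp1 := gamma_pow (R := R) n3 (k := 1) isT; rewrite expr1 in gp1.
have := ler_norm (- (u + v - h)); rewrite normrN => t1.
have := ler_norm u; have := ler_norm v; lra.
Qed.

(** The step takes x_i to (1 - a) h_i + a p_i in the local metric, with 1 - a of
    order sqrt n * eps; later points exceed this by a factor of order n at most. *)
Lemma step_bound (z h p eps : R) : 0 < eps -> 24 * Num.sqrt n%:R * eps <= 1 -> h <= 107 / 100 ->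
  `|p| <= eps ->
  z <= 3 * n%:R * (24 * Num.sqrt n%:R * eps * h + (1 - 24 * Num.sqrt n%:R * eps) * p) ->
  z <= 80 * n%:R ^+ 2 * eps.
Proof.
move=> eps0 a1 h1 h2 le; have nR := natn_ge3 (R := R) n3; have [r1 rn] := sqrt_n (R := R) n3.
have a0 : 0 <= 24 * Num.sqrt n%:R * eps by rewrite !mulr_ge0 ?(ltW eps0) //; lra.
have ap : (1 - 24 * Num.sqrt n%:R * eps) * p <= eps.
  apply: le_trans (ler_norm _) _; rewrite normrM; apply: le_trans h2.
  by rewrite ler_piMl // ler_norml; lra.
have ah : 24 * Num.sqrt n%:R * eps * h <= 24 * Num.sqrt n%:R * eps * (107 / 100).
  by rewrite ler_wpM2l.
have se : Num.sqrt n%:R * eps <= n%:R * eps by rewrite ler_pM2r.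
have ne : 3 * eps <= n%:R * eps by rewrite ler_pM2r.
apply: le_trans le _.
rewrite (_ : 80 * n%:R ^+ 2 * eps = 3 * n%:R * (80 / 3 * (n%:R * eps))); last by field.
by rewrite ler_wpM2l //; lra.
Qed.

Section AtIterate.
Variable w : pdpoint R m n.
Hypothesis wN : neighborhood A b c (1 / 8) w.

Let wF : strictly_feasible A b c w. Proof. by have [] := wN. Qed.
Let x0 : forall i, 0 < xpart w i 0. Proof. by have [] := wF. Qed.
Let s0 : forall i, 0 < spart w i 0. Proof. by have [] := wF. Qed.
Let mu0 : 0 < mu w. Proof. exact: mu_gt0 wF. Qed.

Definition scaled_x (x : 'cV[R]_n) : 'cV[R]_n := (Num.sqrt (mu w))^-1 *: cmul (delta w) x.
Definition scaled_s (s : 'cV[R]_n) : 'cV[R]_n :=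
  (Num.sqrt (mu w))^-1 *: cmul (cinv (delta w)) s.

Lemma scaled_x_coord x i : scaled_x x i 0 = (Num.sqrt (mu w))^-1 * (delta w i 0 * x i 0).
Proof. by rewrite /scaled_x mxE [cmul _ _ _ _]mxE. Qed.

Lemma scaled_s_coord s i : scaled_s s i 0 = (Num.sqrt (mu w))^-1 * ((delta w i 0)^-1 * s i 0).
Proof. by rewrite /scaled_s mxE [cmul _ _ _ _]mxE [cinv _ _ _]mxE. Qed.

Lemma hvecE : (hvec w = scaled_x (xpart w)) * (hvec w = scaled_s (spart w)).
Proof. by split; [|exact: hvec_s n0 x0 s0]. Qed.

Lemma scaled_xE x i : scaled_x x i 0 = hvec w i 0 * (x i 0 / xpart w i 0).
Proof.
have M0 : 0 < Num.sqrt (mu w) by rewrite sqrtr_gt0.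
by rewrite hvecE.1 !scaled_x_coord; field; rewrite !gt_eqF.
Qed.

Lemma scaled_sE s i : scaled_s s i 0 = hvec w i 0 * (s i 0 / spart w i 0).
Proof.
have M0 : 0 < Num.sqrt (mu w) by rewrite sqrtr_gt0.
have d0 := delta_gt0 x0 s0 i.
by rewrite hvecE.2 !scaled_s_coord; field; rewrite !gt_eqF.
Qed.

Lemma scaled_x_homo (f : R) (u v : 'cV[R]_n) i : v i 0 <= f * u i 0 ->
  scaled_x v i 0 <= f * scaled_x u i 0.
Proof.
move=> le; rewrite !scaled_x_coord [leRHS]mulrCA ler_pM2l ?invr_gt0 ?sqrtr_gt0 // [leRHS]mulrCA.
by rewrite ler_pM2l // delta_gt0.
Qed.

Lemma scaled_s_homo (f : R) (u v : 'cV[R]_n) i : v i 0 <= f * u i 0 ->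
  scaled_s v i 0 <= f * scaled_s u i 0.
Proof.
move=> le; rewrite !scaled_s_coord [leRHS]mulrCA ler_pM2l ?invr_gt0 ?sqrtr_gt0 // [leRHS]mulrCA.
by rewrite ler_pM2l // invr_gt0 delta_gt0.
Qed.

Lemma direct_diff w' : strictly_feasible A b c w' ->
  xpart w' - xpart w \in W /\ spart w' - spart w \in orthv W.
Proof.
move=> [Ax' _ As' _]; have [Ax _ As _] := wF.
apply: (@direction_mem R m n A (xpart w' - xpart w, ypart w' - ypart w, spart w' - spart w)).
split=> /=; first by rewrite mulmxBr Ax Ax' subrr.
by rewrite mulmxBr addrACA As' -opprD As subrr.
Qed.

Lemma scaled_sums w' : strictly_feasible A b c w' -> mu w' <= mu w ->
  \sum_i scaled_x (xpart w') i 0 <= 5 / 2 * n%:R /\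
  \sum_i scaled_s (spart w') i 0 <= 5 / 2 * n%:R.
Proof.
move=> F' le; have nR := natn_ge3 (R := R) n3.
have lo : forall i, 7 / 8 * mu w <= xpart w i 0 * spart w i 0.
  by move=> l; have /andP[] := neighborhood_coord n0 l wN; lra.
have [|sx ss] := near_monotone n0 wF F' le _ lo; first lra.
have [_ x10 _ s10] := F'.
have bnd (u v : 'cV[R]_n) : (forall i, 0 < u i 0) -> (forall i, 0 < v i 0) ->
    \sum_i hvec w i 0 * (v i 0 / u i 0) <= 107 / 100 * \sum_i v i 0 / u i 0.
  move=> u0 v0; rewrite mulr_sumr; apply: ler_sum => i _.
  by have /andP[_ h2] := hvec_bounds n3 i wN; rewrite ler_wpM2r // divr_ge0 // ltW.
split.
  under eq_bigr => i _ do rewrite scaled_xE.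
  by apply: le_trans (bnd _ _ x0 x10) _; lra.
under eq_bigr => i _ do rewrite scaled_sE.
by apply: le_trans (bnd _ _ s0 s10) _; lra.
Qed.

(** The ratio of the local scaling to the balancing weights turns the bound on
    the balanced imbalances into one on the rescaled imbalances. *)
Definition dscale i : R := delta w i 0 / e i 0.

Definition below (t : R) := {w' : pdpoint R m n | near_path t w'}.

Lemma current_setting (t : R) kh J kh' d da : t <= mu w -> sound_estimates A kh ->
  layering A (delta w) kh (J, kh') -> affine_direction A w da -> lls_direction A J w d ->
  [/\ lls_close (residual_x w d) (residual_s w d) (residual_x w da) (residual_s w da),
      direction A d &
  setting (scalev (delta w) W) (hvec w) (position J) (size J) (kapd A (delta w)) dscale K0
    (residual_x w d) (residual_s w d) (T := below t)
    (fun v => scaled_x (xpart (sval v))) (fun v => scaled_s (spart (sval v)))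
    (fun v => mu (sval v))].
Proof.
move=> tm khS ly daA dL; have d0 := delta_gt0 x0 s0.
have [kh'S [E JE] bal] := layering_spec n0 d0 khS ly.
have posN i : (position J i <= size J)%N by rewrite ltnW // (position_lt_size JE).
have k0 i j : 0 <= kapd A (delta w) i j by apply: kapd_ge0.
have [dD pL qL] := lls_residuals n0 x0 s0 JE dL.
have daD : direction A da by have [? ? _] := daA.
have [pa qa] := residuals_mem n0 x0 s0 daD.
have cl := lls_closeness n3 (hvec_dot n0 x0 s0) bal k0 posN pL qL pa qa
  (affine_residuals n0 x0 s0 daA).
split=> //; split=> //.
- move=> i j; rewrite /kapd /dscale; have := ler_wpM2r (_ : 0 <= delta w j 0 / e j 0 / (delta w i 0 / e i 0)) (eK i j).
  have -> : kap W i j * e j 0 / e i 0 * (delta w j 0 / e j 0 / (delta w i 0 / e i 0)) =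
      kap W i j * delta w j 0 / delta w i 0 by field; rewrite !gt_eqF.
  by apply; rewrite !divr_ge0 // ltW.
- move=> i j; rewrite /kapd.
  have -> : kap W i j * delta w j 0 / delta w i 0 * (kap W j i * delta w i 0 / delta w j 0) =
      kap W i j * kap W j i by field; rewrite !gt_eqF.
  exact: kap_mul_ge1.
- by move=> i; rewrite /dscale divr_gt0.
- move=> [w' [[F' _] _]] /=; apply: hvec_feasible.
  by have [] := direct_diff F'.
- move=> [w' [[F' _] _]] /=; apply: (hvec_dual_feasible n0 x0 s0).
  by have [] := direct_diff F'.
- move=> [w' [[[_ x'0 _ _] _] _]] i /=.
  by rewrite scaled_xE mulr_gt0 ?divr_gt0 //; apply: hvec_gt0.
- move=> [w' [[[_ _ _ s'0] _] _]] i /=.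
  by rewrite scaled_sE mulr_gt0 ?divr_gt0 //; apply: hvec_gt0.
- move=> [w1 [N1 ?]] [w2 [N2 ?]] /= le i; apply: scaled_x_homo.
  by have [] := later_le i (neighborhood_weaken N1) N2.1 le.
- move=> [w1 [N1 ?]] [w2 [N2 ?]] /= le i; apply: scaled_s_homo.
  by have [] := later_le i (neighborhood_weaken N1) N2.1 le.
- by move=> [w' [[F' _] le]] /=; have [] := scaled_sums F' (le_trans le tm).
- by move=> [w' [[F' _] le]] /=; have [] := scaled_sums F' (le_trans le tm).
- exact: close_sum_x cl.
- exact: close_sum_s cl.
Qed.

Lemma weight_kapd i j : weight w i j = kapd A (delta w) i j * (hvec w i 0 * hvec w j 0).
Proof.
have d0 := delta_gt0 x0 s0; have M0 : 0 < Num.sqrt (mu w) by rewrite sqrtr_gt0.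
rewrite /weight /kapd [in hvec w i 0]hvecE.1 hvecE.2 scaled_x_coord scaled_s_coord.
rewrite -{1}(sqr_sqrtr (ltW mu0)); field.
by rewrite !gt_eqF // d0.
Qed.

Lemma pinned_of_event (t : R) :
  event M (kapd A (delta w)) (T := below t)
    (fun v => scaled_x (xpart (sval v))) (fun v => scaled_s (spart (sval v))) (t / mu w) ->
  exists S i j, pinned_pair w t S i j.
Proof.
move=> [S [i [j [thx [ths [iS jS a [x1 s1 bx bs] cc]]]]]].
have d0 := delta_gt0 x0 s0; have M0 : 0 < Num.sqrt (mu w) by rewrite sqrtr_gt0.
have fx : 0 < Num.sqrt (mu w) / delta w i 0 by rewrite divr_gt0.
have fs : 0 < Num.sqrt (mu w) * delta w j 0 by rewrite mulr_gt0.
have zxE w' : xpart w' i 0 = scaled_x (xpart w') i 0 * (Num.sqrt (mu w) / delta w i 0).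
  by rewrite scaled_x_coord; field; rewrite !gt_eqF ?d0.
have zsE w' : spart w' j 0 = scaled_s (spart w') j 0 * (Num.sqrt (mu w) * delta w j 0).
  by rewrite scaled_s_coord; field; rewrite !gt_eqF ?d0.
have hb u v : kapd A (delta w) u v <= M ^+ #|S| / 2 -> weight w u v <= M ^+ #|S|.
  move=> le; rewrite weight_kapd.
  have /andP[u1 u2] := hvec_bounds n3 u wN; have /andP[v1 v2] := hvec_bounds n3 v wN.
  have hh : hvec w u 0 * hvec w v 0 <= 107 / 100 * (107 / 100) by apply: ler_pM => //; lra.
  have hh0 : 0 <= hvec w u 0 * hvec w v 0 by rewrite mulr_ge0 //; lra.
  have k0 : 0 <= kapd A (delta w) u v by apply: kapd_ge0.
  have := ler_pM k0 hh0 le hh; lra.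
exists S, i, j, (thx * (Num.sqrt (mu w) / delta w i 0)), (ths * (Num.sqrt (mu w) * delta w j 0)).
split=> //.
- by move=> l /a [h1 h2]; split; apply: hb.
- split; try by rewrite mulr_gt0.
    move=> w' nw; have := bx (exist _ w' nw); rewrite /= zxE mulrA.
    by rewrite !ler_pM2r.
  move=> w' nw; have := bs (exist _ w' nw); rewrite /= zsE mulrA.
  by rewrite !ler_pM2r.
- rewrite ler_pdivrMr // in cc; apply: le_trans cc _.
  rewrite /kapd -{1}(sqr_sqrtr (ltW mu0)) le_eqVlt; apply/orP; left; apply/eqP.
  by field; rewrite !gt_eqF ?d0.
Qed.

(** The layering and the layered direction are not computed in this case, but
    they exist; an index where both affine residuals are large has both layered
    residuals large. *)
Lemma affine_event (t : R) kh da : t <= mu w -> sound_estimates A kh ->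
  affine_direction A w da -> 10 * (n%:R `^ (3 / 2)) * g <= epsilon w da ->
  exists S i j, pinned_pair w t S i j.
Proof.
move=> tm khS daA big; have d0 := delta_gt0 x0 s0.
have [[J kh'] ly] := layering_exists n0 d0 khS.
have [_ [E JE] _] := layering_spec n0 d0 khS ly.
have [d dL] := lls_exists A n0 x0 s0 JE.
have [cl _ st] := current_setting tm khS ly daA dL.
have [i ei] := epsilon_attained n3 w da.
have g0 := gamma_gt0 (R := R) n0; have nR := natn_ge3 (R := R) n3.
have [r1 _] := sqrt_n (R := R) n3.
have gn0 : 0 < g * n%:R by rewrite mulr_gt0 //; lra.
have {}big : 10 * (g * n%:R) * Num.sqrt n%:R
    <= Num.min `|residual_x w da i 0| `|residual_s w da i 0|.
  rewrite -ei; apply: le_trans big; rewrite (powR_3half n3).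
  by rewrite le_eqVlt; apply/orP; left; apply/eqP; ring.
have big' : 10 * (g * n%:R) <= 10 * (g * n%:R) * Num.sqrt n%:R.
  by rewrite ler_peMr //; lra.
have /andP[bp bq] : (10 * (g * n%:R) <= `|residual_x w da i 0|)
    && (10 * (g * n%:R) <= `|residual_s w da i 0|).
  by rewrite -le_min; apply: le_trans big' big.
apply: pinned_of_event; apply: (event_same_layer n3 st (i0 := i) (j0 := i)) => //.
- have := close_x cl i; have := lerB_dist (residual_x w da i 0) (residual_x w d i 0).
  rewrite distrC; lra.
- have := close_s cl i; have := lerB_dist (residual_s w da i 0) (residual_s w d i 0).
  rewrite distrC; lra.
- by rewrite ler_pdivrMr // mul1r.
Qed.

Lemma scaled_step d (a : R) l :
  scaled_x (xpart (w + a *: d)) l 0 = (1 - a) * hvec w l 0 + a * residual_x w d l 0 /\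
  scaled_s (spart (w + a *: d)) l 0 = (1 - a) * hvec w l 0 + a * residual_s w d l 0.
Proof.
have rx : residual_x w d l 0 = scaled_x (xpart w + xpart d) l 0 by [].
have rs : residual_s w d l 0 = scaled_s (spart w + spart d) l 0 by [].
rewrite {1}hvecE.1 hvecE.2 rx rs !scaled_x_coord !scaled_s_coord.
have e1 u v : (u + a *: v : 'cV[R]_n) l 0 = u l 0 + a * v l 0.
  by rewrite mxE [X in _ + X]mxE.
have e2 u v : (u + v : 'cV[R]_n) l 0 = u l 0 + v l 0 by rewrite mxE.
by rewrite /= !e1 !e2; split; ring.
Qed.

(** Where the primal residual is at most eps, the step brings x_i down to the
    order of eps; [later_le], applied at the point reached before the
    correction, makes this an upper bound for all later points. *)
Lemma lls_event kh J kh' d da : sound_estimates A kh ->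
  layering A (delta w) kh (J, kh') -> affine_direction A w da -> lls_direction A J w d ->
  let eps := epsilon w d in let a := 1 - 24 * Num.sqrt n%:R * eps in
  0 < eps -> eps <= 12 * n%:R * Num.sqrt n%:R * g ->
  mu (w + a *: d) = (1 - a) * mu w -> neighborhood A b c (1 / 4) (w + a *: d) ->
  exists S i j, pinned_pair w (mu (w + a *: d)) S i j.
Proof.
move=> khS ly daA dL eps a eps0 epsu mua Na.
have [small small'] := small_epsilon eps0 epsu.
have a1 : 1 - a = 24 * Num.sqrt n%:R * eps by rewrite /a; ring.
have le1 : 24 * Num.sqrt n%:R * eps <= 1 by apply: le_trans small _; lra.
have tm : mu (w + a *: d) <= mu w.
  by rewrite mua ler_piMl ?(ltW mu0) // a1.
have [cl dD st] := current_setting tm khS ly daA dL.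
apply: pinned_of_event; rewrite [X in X / _]mua mulfK ?gt_eqF // a1.
have [i ei] := epsilon_attained n3 w d.
have hb l := hvec_bounds n3 l wN.
have sum l : `|residual_x w d l 0 + residual_s w d l 0 - hvec w l 0| <= 202 / 100 * (g * n%:R).
  rewrite -(affine_residuals n0 x0 s0 daA) [X in _ - X]mxE opprD addrACA.
  apply: le_trans (ler_normD _ _) _.
  apply: le_trans (lerD (close_x cl l) (close_s cl l)) _.
  by rewrite le_eqVlt; apply/orP; left; apply/eqP; field.
have mid v : near_path (mu (w + a *: d)) v ->
    (forall l, `|residual_x w d l 0| <= eps -> scaled_x (xpart v) l 0 <= 80 * n%:R ^+ 2 * eps) /\
    (forall l, `|residual_s w d l 0| <= eps -> scaled_s (spart v) l 0 <= 80 * n%:R ^+ 2 * eps).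
  move=> [[Fv _] vle]; split=> l pl.
    have /andP[_ h2] := hb l; apply: (step_bound eps0 le1 h2 pl).
    have := scaled_x_homo (later_le l Na Fv vle).1.
    by rewrite (scaled_step d a l).1 a1.
  have /andP[_ h2] := hb l; apply: (step_bound eps0 le1 h2 pl).
  have := scaled_s_homo (later_le l Na Fv vle).2.
  by rewrite (scaled_step d a l).2 a1.
apply: (event_small n3 st eps0 le1 (esym ei)).
- move=> l; have := epsilon_ge w d l; have /andP[h2 _] := hb l.
  rewrite ge_min => /orP[h1|h1]; [left|right]; split=> //.
    exact: other_residual h2 (sum l) small' h1.
  by apply: other_residual h2 _ small' h1; rewrite [residual_s w d l 0 + _]addrC; apply: sum.
- by move=> [v nv] l /= h1; have [h2 _] := mid v nv; apply: h2.
- by move=> [v nv] l /= h1; have [_ h2] := mid v nv; apply: h2.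
Qed.

Lemma move_correct (ret : pdpoint R m n -> Prop) (next : pdpoint R m n -> 'M[R]_n -> Prop)
    d (a : R) kh :
  (forall v, optimal A b c v -> ret v) ->
  (forall v, neighborhood A b c (1 / 8) v -> mu v <= (1 - 1 / (8 * Num.sqrt n%:R)) * mu w ->
    (exists S i j, pinned_pair w (mu v) S i j) -> next v kh) ->
  1 / (8 * Num.sqrt n%:R) <= a <= 1 -> mu (w + a *: d) = (1 - a) * mu w ->
  (a < 1 -> neighborhood A b c (1 / 4) (w + a *: d)) ->
  (a = 1 -> optimal A b c (w + a *: d)) ->
  (a < 1 -> exists S i j, pinned_pair w (mu (w + a *: d)) S i j) ->
  if mu (w + a *: d) == 0 then ret (w + a *: d)
  else Defs.choose (centrality_direction A (w + a *: d)) (fun dc => next (w + a *: d + dc) kh).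
Proof.
move=> retP nextP /andP[a1 a2] mua Na Oa ev; case: eqP => [mu_eq|/eqP mu_ne].
  apply/retP/Oa/eqP; move: mu_eq; rewrite mua => /eqP.
  by rewrite mulf_eq0 (gt_eqF mu0) orbF subr_eq0 eq_sym.
have alt : a < 1.
  by rewrite lt_neqAle a2 andbT; apply: contra mu_ne => /eqP a_eq; rewrite mua a_eq subrr mul0r.
have [[_ xa0 _ sa0] _] := Na alt; split.
  have [dc [[dx ds] e1]] := newton_solvable A
    (mu (w + a *: d) *: const_mx 1 - cmul (xpart (w + a *: d)) (spart (w + a *: d))) xa0 sa0.
  by exists dc.
move=> dc dcP; have [Nv muv] := corrector_step n0 (Na alt) dcP.
apply: nextP => //; rewrite muv; last exact: ev.
by rewrite mua ler_pM2r //; lra.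
Qed.

Lemma iteration_progress kh (ret : pdpoint R m n -> Prop)
    (next : pdpoint R m n -> 'M[R]_n -> Prop) :
  sound_estimates A kh -> (forall v, optimal A b c v -> ret v) ->
  (forall v kh', neighborhood A b c (1 / 8) v -> sound_estimates A kh' ->
    mu v <= (1 - 1 / (8 * Num.sqrt n%:R)) * mu w ->
    (exists S i j, pinned_pair w (mu v) S i j) -> next v kh') ->
  iteration A w kh ret next.
Proof.
move=> khS retP nextP; have d0 := delta_gt0 x0 s0; have [r1 _] := sqrt_n (R := R) n3; split.
  have [da [[dx ds] e1]] := newton_solvable A (- cmul (xpart w) (spart w)) x0 s0.
  by exists da.
move=> da daA; case: ifPn => [small|]; last first.
  rewrite -leNgt => big; have [a12 mua Na Oa] := affine_step n0 wN daA erefl.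
  apply: move_correct => //; first by move=> v Nv mv; apply: nextP.
  move=> alt; apply: affine_event khS daA big.
  by rewrite mua ler_piMl ?(ltW mu0) //; have := divr_ge0 ler01 (_ : 0 <= 8 * Num.sqrt n%:R :> R); lra.
split; first by have := layering_exists n0 d0 khS.
move=> [J kh'] ly /=; have [kh'S [E JE] _] := layering_spec n0 d0 khS ly.
split; first by have := lls_exists A n0 x0 s0 JE.
move=> d dL; have [cl dD _] := current_setting (lexx _) khS ly daA dL.
have [epsu /andP[a0 a1] mua Na Oa] := lls_step n3 wN dD daA cl small.
have ep0 := epsilon_ge0 w d.
apply: move_correct => //; first by move=> v Nv mv; apply: nextP.
  rewrite a1 andbT; have : 1 / (8 * Num.sqrt n%:R) <= 1 / 8 :> R.
    by rewrite ler_pM2l // lef_pV2 ?posrE //; lra.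
  have := ep0; rewrite le_eqVlt => /orP[/eqP <-|ep1]; first by rewrite mulr0; lra.
  by have [] := small_epsilon ep1 epsu; lra.
move=> alt; apply: (lls_event khS ly daA dL _ epsu mua (Na alt)).
rewrite lt_neqAle ep0 andbT; apply: contraTneq alt => <-.
by rewrite mulr0 subr0 ltxx.
Qed.

End AtIterate.
End Iteration.

(** * The potential: pairs whose imbalance has become large for good *)

Section Potential.
Context {R : realType} {m n : nat} (A : 'M[R]_(m, n)) (b : 'cV[R]_m) (c : 'cV[R]_n).
Hypotheses (n3 : (2 < n)%N) (Aconn : connectedv (kerspace A)).
Variables (K0 : R).
Hypotheses (K01 : 1 <= K0).
Implicit Types (w : pdpoint R m n) (t : R) (S : {set 'I_n}).

Local Notation g := (gamma R n).
Local Notation mu := Defs.mu.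
Local Notation W := (kerspace A).
Local Notation M := (Mbound (n := n) K0).
Local Notation weight := (weight A).
Local Notation near_path := (near_path A b c).

Let n0 : (0 < n)%N. Proof. exact: leq_trans n3. Qed.

Lemma Mbound_ge : 4 * n%:R <= M.
Proof.
have s0 := sigma_gt0 (R := R) n0; have s1 := sigma_le1 (R := R) n0.
have q1 : 1 <= (K0 / (g / n%:R)) ^+ 3.
  by rewrite exprn_ege1 // ler_pdivlMr // mul1r; apply: le_trans s1 K01.
have [h1 h2] := n_cube (R := R) n3; rewrite /Mbound.
have : 500 * n%:R ^+ 3 * 1 <= 500 * n%:R ^+ 3 * (K0 / (g / n%:R)) ^+ 3 by rewrite ler_wpM2l //; lra.
lra.
Qed.

Let M12 : 12 <= M.
Proof. by have := Mbound_ge; have := natn_ge3 (R := R) n3; lra. Qed.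

Let Mgt1 : 1 < M. Proof. by have h := M12; lra. Qed.
Let M0 : 0 < M. Proof. by have h := M12; lra. Qed.
Let Mp0 k : 0 < M ^+ k. Proof. by rewrite exprn_gt0 // M0. Qed.

Definition levels : nat := (trunc_log 2 n).+2.

(** Thresholds M^(2^e) need only logarithmically many levels: weights rise from
    M^|S| to M^(2|S|), and some 2^e lies in between. *)
Definition heavy t (x : 'I_n * 'I_n * 'I_levels) : Prop :=
  forall w, near_path t w -> M ^+ (2 ^ x.2) <= weight w x.1.1 x.1.2.

Definition potential t : nat := #|[set x | `[< heavy t x >]]|.

Lemma heavy_le t t' x : t' <= t -> heavy t x -> heavy t' x.
Proof. by move=> le H w [Nw mw]; apply: H; split=> //; apply: le_trans mw le. Qed.

Lemma potential_max t : (potential t <= n * n * levels)%N.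
Proof. by rewrite (leq_trans (max_card _)) // !card_prod !card_ord. Qed.

Lemma weight_ge0 w i j : neighborhood A b c (1 / 8) w -> 0 <= weight w i j.
Proof.
move=> [F _]; have [_ x0 _ s0] := F.
rewrite divr_ge0 ?(ltW (mu_gt0 n0 F)) // mulr_ge0 ?kap_ge0 //.
by rewrite mulr_ge0 // ltW.
Qed.

(** Imbalances satisfy the triangle inequality, and on the neighborhood the
    factors of an intermediate index cancel. *)
Lemma weight_triangle w i l j : neighborhood A b c (1 / 8) w ->
  7 / 8 * weight w i j <= weight w i l * weight w l j.
Proof.
move=> Nw; have [F _] := Nw; have [_ x0 _ s0] := F; have mu0 := mu_gt0 n0 F.
have /andP[lo _] := neighborhood_coord n0 l Nw.
have lo' : 7 / 8 <= xpart w l 0 * spart w l 0 / mu w by rewrite ler_pdivlMr //; lra.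
have tri := kap_triangle Aconn i l j.
have -> : weight w i l * weight w l j = (kap W i l * kap W l j) *
    ((xpart w i 0 * spart w j 0 / mu w) * (xpart w l 0 * spart w l 0 / mu w)).
  by rewrite !weightE; field; rewrite gt_eqF.
have -> : 7 / 8 * weight w i j = kap W i j * ((xpart w i 0 * spart w j 0 / mu w) * (7 / 8)).
  by rewrite !weightE; field; rewrite gt_eqF.
have p0 : 0 <= xpart w i 0 * spart w j 0 / mu w.
  by rewrite divr_ge0 ?(ltW mu0) // mulr_ge0 // ltW.
by apply: ler_pM => //; [exact: kap_ge0 | rewrite mulr_ge0 //; lra | apply: ler_wpM2l].
Qed.

Lemma ratio_later w1 w2 l : neighborhood A b c (1 / 8) w1 -> neighborhood A b c (1 / 8) w2 ->
  mu w2 <= mu w1 ->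
  xpart w1 l 0 / mu w1 <= 4 * n%:R * (xpart w2 l 0 / mu w2) /\
  spart w1 l 0 / mu w1 <= 4 * n%:R * (spart w2 l 0 / mu w2).
Proof.
move=> N1 N2 le; have [F1 _] := N1; have [F2 _] := N2.
have [_ x10 _ s10] := F1; have [_ x20 _ s20] := F2.
have m1 := mu_gt0 n0 F1; have m2 := mu_gt0 n0 F2.
have [lex les] := later_le n3 l (neighborhood_weaken N1) F2 le.
have /andP[_ hi1] := neighborhood_coord n0 l N1.
have /andP[lo2 _] := neighborhood_coord n0 l N2.
have nR := natn_ge3 (R := R) n3.
have gen (u1 v1 u2 v2 : R) : 0 < u1 -> 0 < v1 -> 0 < u2 -> 0 < v2 ->
    u1 * v1 <= (1 + 1 / 8) * mu w1 -> (1 - 1 / 8) * mu w2 <= u2 * v2 ->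
    v2 <= 3 * n%:R * v1 -> u1 / mu w1 <= 4 * n%:R * (u2 / mu w2).
  move=> u10 v10 u20 v20 h1 h2 h3.
  rewrite ler_pdivrMr // (_ : _ * mu w1 = 4 * n%:R * u2 * mu w1 / mu w2); last by ring.
  rewrite ler_pdivlMr // -(ler_pM2r v10).
  have h4 := ler_wpM2l (ltW u20) h3.
  have h5 := ler_wpM2r (ltW m2) h1.
  have h6 := ler_wpM2l (ltW m1) (le_trans h2 h4).
  have h7 : 0 <= n%:R * u2 * mu w1 * v1.
    by rewrite mulr_ge0 ?(ltW v10) // mulr_ge0 ?(ltW m1) // mulr_ge0 ?(ltW u20).
  lra.
split; [apply: (gen _ (spart w1 l 0) _ (spart w2 l 0)) | apply: (gen _ (xpart w1 l 0) _ (xpart w2 l 0))] => //.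
  by rewrite [leLHS]mulrC.
by rewrite [leRHS]mulrC.
Qed.

(** A large imbalance at an index whose primal variable is pinned stays large:
    the dual variable of the other index decreases at most like mu. *)
Lemma weight_later w1 w2 i j : neighborhood A b c (1 / 8) w1 -> neighborhood A b c (1 / 8) w2 ->
  mu w2 <= mu w1 -> xpart w1 i 0 <= M * xpart w2 i 0 \/ spart w1 j 0 <= M * spart w2 j 0 ->
  weight w1 i j <= M ^+ 2 * weight w2 i j.
Proof.
move=> N1 N2 le pin; have [F1 _] := N1; have [F2 _] := N2.
have [_ x10 _ s10] := F1; have [_ x20 _ s20] := F2.
have m1 := mu_gt0 n0 F1; have m2 := mu_gt0 n0 F2.
have k0 : 0 <= kap W i j by apply: kap_ge0.
have lift (f h : R) : f <= M * (4 * n%:R) * h -> 0 <= h -> kap W i j * f <= M ^+ 2 * (kap W i j * h).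
  move=> h1 h2; rewrite mulrCA; apply: ler_wpM2l => //; apply: le_trans h1 _.
  by have h3 := ler_wpM2l (ltW M0) Mbound_ge; rewrite expr2; apply: ler_wpM2r.
rewrite !weightE -[kap W i j * _ / mu w1]mulrA -[kap W i j * _ / mu w2]mulrA.
apply: lift; last exact: divr_ge0 (mulr_ge0 (ltW (x20 i)) (ltW (s20 j))) (ltW m2).
have nonneg (u v : R) : 0 < u -> 0 < v -> 0 <= u / v by move=> ? ?; rewrite divr_ge0 // ltW.
case: pin => pin.
  have [_ rs] := ratio_later j N1 N2 le.
  have -> : M * (4 * n%:R) * (xpart w2 i 0 * spart w2 j 0 / mu w2) =
    M * xpart w2 i 0 * (4 * n%:R * (spart w2 j 0 / mu w2)) by ring.
  by rewrite -mulrA; apply: ler_pM => //; [exact: ltW | exact: nonneg].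
have [rx _] := ratio_later i N1 N2 le.
have -> : M * (4 * n%:R) * (xpart w2 i 0 * spart w2 j 0 / mu w2) =
  4 * n%:R * (xpart w2 i 0 / mu w2) * (M * spart w2 j 0) by ring.
by rewrite mulrAC; apply: ler_pM => //; [exact: nonneg | exact: ltW].
Qed.

Lemma pinned_weight w t S i j w2 : pinned_pair A b c K0 w t S i j ->
  neighborhood A b c (1 / 8) w2 -> mu w2 * M ^+ (8 * #|S|) <= t ->
  M ^+ (7 * #|S|) <= weight w2 i j.
Proof.
move=> [thx [ths [iS jS _ [x1 s1 bx bs] le]]] N2 small; have [F2 _] := N2.
have m2 := mu_gt0 n0 F2.
have near : near_path t w2.
  by split=> //; apply: le_trans small; rewrite ler_peMr ?(ltW m2) // exprn_ege1 // ltW.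
have /andP[lx _] := bx w2 near; have /andP[ls _] := bs w2 near.
rewrite !weightE ler_pdivlMr //.
have h1 := le_trans small le; rewrite (_ : 8 * #|S| = 7 * #|S| + #|S|)%N in h1; last by rewrite -mulSnr.
rewrite exprD mulrA ler_pM2r // in h1; rewrite mulrC; apply: le_trans h1 _.
rewrite -mulrA; apply: ler_wpM2l; first exact: kap_ge0.
by apply: ler_pM => //; exact: ltW.
Qed.

Lemma level_margin k : (1 < k)%N -> ((2 * k + 2 + (2 * k + 2)).+1 <= 7 * k)%N.
Proof. by clear; lia. Qed.

(** The decisive step. Since the pinned pair keeps its product x_i s_j, its
    imbalance grows like 1/mu; by the triangle inequality so does, for every l
    in S, the imbalance of (i, l) or of (l, j). At [w] all these were at most
    M^|S|, so each of them has passed a level 2^e between |S| and 2|S|. *)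
Lemma pinned_gain w t S i j w2 : neighborhood A b c (1 / 8) w ->
  pinned_pair A b c K0 w t S i j -> t <= mu w -> neighborhood A b c (1 / 8) w2 ->
  mu w2 * M ^+ (8 * #|S|) <= t ->
  (1 < #|S|)%N /\ (potential (mu w) + #|S|.-1 <= potential (mu w2))%N.
Proof.
move=> Nw pin tm N2 small; have [F2 _] := N2; have m2 := mu_gt0 n0 F2.
have [thx [ths [iS jS a [x1 s1 bx bs] _]]] := pin.
set r := #|S| in small a *.
have r0 : (0 < r)%N by apply/card_gt0P; exists i.
have M1 := ltW Mgt1.
have m2t : mu w2 <= t.
  by apply: le_trans small; rewrite ler_peMr ?(ltW m2) // exprn_ege1.
have smaller w' : near_path (mu w2) w' -> mu w' * M ^+ (8 * r) <= t.
  by move=> [_ le]; apply: le_trans small; rewrite ler_pM2r.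
have near2 : near_path t w2 by split.
have ij : i != j.
  apply/eqP => e; have := pinned_weight pin N2 small; rewrite -e -/r => le.
  have /andP[_ hi] := neighborhood_coord n0 i N2.
  have : weight w2 i i <= 2.
    by rewrite !weightE (kap_diag Aconn) mul1r ler_pdivrMr //; lra.
  have : M <= M ^+ (7 * r) by rewrite -[leLHS]expr1 ler_weXn2l // muln_gt0 r0.
  by have h := M12; lra.
have jSi : j \in S :\ i by rewrite !inE eq_sym ij.
have cS : r = (#|S :\ i :\ j|).+2.
  by rewrite /r (cardsD1 i S) iS (cardsD1 j (S :\ i)) jSi.
split; first by rewrite cS.
pose e := (trunc_log 2 r).+1.
have /andP[elo ehi] := trunc_log_bounds (isT : (1 < 2)%N) r0.
have rn : (r <= n)%N by rewrite /r -[X in (_ <= X)%N]card_ord max_card.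
have eL : (e < levels)%N by rewrite /e /levels !ltnS leq_trunc_log.
have e2 : (2 ^ e <= 2 * r)%N by rewrite /e expnS leq_pmul2l.
pose eo := Ordinal eL.
have lightw u v : weight w u v <= M ^+ r -> ~ heavy (mu w) (u, v, eo).
  move=> le H; have := H w (conj Nw (lexx _)); rewrite /= leNgt => /negP; apply.
  by apply: le_lt_trans le _; rewrite ltr_eXn2l.
have big_ij w' : near_path (mu w2) w' -> M ^+ (7 * r) <= weight w' i j.
  by move=> nw; apply: (pinned_weight pin) (smaller _ nw); have [] := nw.
have heavy_ij : heavy (mu w2) (i, j, eo).
  move=> w' nw /=; apply: le_trans (big_ij w' nw); rewrite ler_weXn2l //.
  by apply: leq_trans e2 _; rewrite leq_pmul2r.
have stays u v : (forall w', near_path (mu w2) w' ->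
    xpart w2 u 0 <= M * xpart w' u 0 \/ spart w2 v 0 <= M * spart w' v 0) ->
    M ^+ (2 * r + 2) <= weight w2 u v -> heavy (mu w2) (u, v, eo).
  move=> H le w' nw /=; have [Nw' mw'] := nw.
  have := le_trans le (weight_later N2 Nw' mw' (H w' nw)); rewrite addnC exprD ler_pM2l // => h.
  by apply: le_trans h; rewrite ler_weXn2l.
have pinx w' : near_path (mu w2) w' -> xpart w2 i 0 <= M * xpart w' i 0.
  move=> [Nw' mw']; have /andP[_ h1] := bx w2 near2.
  have /andP[h2 _] := bx w' (conj Nw' (le_trans mw' m2t)).
  by apply: le_trans h1 _; rewrite ler_pM2l.
have pins w' : near_path (mu w2) w' -> spart w2 j 0 <= M * spart w' j 0.
  move=> [Nw' mw']; have /andP[_ h1] := bs w2 near2.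
  have /andP[h2 _] := bs w' (conj Nw' (le_trans mw' m2t)).
  by apply: le_trans h1 _; rewrite ler_pM2l.
have either l : l \in S -> heavy (mu w2) (i, l, eo) \/ heavy (mu w2) (l, j, eo).
  move=> lS; have [h1|h1] := leP (M ^+ (2 * r + 2)) (weight w2 i l).
    by left; apply: stays h1 => w' /pinx; left.
  have [h2|h2] := leP (M ^+ (2 * r + 2)) (weight w2 l j).
    by right; apply: stays h2 => w' /pins; right.
  exfalso; have := weight_triangle i l j N2.
  have h3 : weight w2 i l * weight w2 l j <= M ^+ (2 * r + 2) * M ^+ (2 * r + 2).
    by apply: ler_pM; rewrite ?weight_ge0 // ltW.
  have := big_ij w2 (conj N2 (lexx _)).
  have h4 : M * (M ^+ (2 * r + 2) * M ^+ (2 * r + 2)) <= M ^+ (7 * r).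
    by rewrite -exprD -exprS ler_weXn2l // level_margin // cS.
  move: h3 h4; rewrite -exprD; have := Mp0 (2 * r + 2 + (2 * r + 2)).
  move: (_ ^+ (2 * r + 2 + _)) => z z0 h3 h4 h5 h6.
  have : 12 * z <= M * z by rewrite ler_pM2r.
  by lra.
pose f l := if `[< heavy (mu w2) (i, l, eo) >] then (i, l, eo) else (l, j, eo).
pose D := (i, j, eo) |: [set f l | l in S :\ i :\ j].
have f_inj : {in S :\ i :\ j &, injective f}.
  move=> u v; rewrite !inE /f => /and3P[uj ui uS] /and3P[vj vi vS].
  case: ifP => _; case: ifP => _; case=> //.
    by move=> e1 _; rewrite -e1 eqxx in vi.
  by move=> e1 _; rewrite e1 eqxx in ui.
have cD : #|D| = r.-1.
  rewrite cardsU1 card_in_imset // cS /=.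
  case: imsetP => // -[l]; rewrite !inE /f => /and3P[lj li lS].
  by case: ifP => _ [] => [e1|e1]; [rewrite e1 eqxx in lj | rewrite e1 eqxx in li].
have DP x : x \in D -> heavy (mu w2) x /\ ~ heavy (mu w) x.
  rewrite !inE => /orP[/eqP ->|/imsetP[l]].
    by split=> //; apply: lightw; have [] := a j jS.
  rewrite !inE /f => /and3P[_ _ lS] ->; have [al1 al2] := a l lS.
  case: asboolP => h; first by split=> //; apply: lightw.
  by split; [have [] := either l lS | apply: lightw].
have disj : [set x | `[< heavy (mu w) x >]] :&: D = finset.set0.
  apply/setP => x; rewrite finset.in_setI finset.in_set0; apply/negP => /andP[].
  by rewrite inE => /asboolP h1 /DP[_ h2].
rewrite -cD /potential -cardsUI disj cards0 addn0; apply: subset_leq_card.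
apply/subsetP => x; rewrite finset.in_setU => /orP[|/DP[h _]]; last by rewrite inE; apply/asboolP.
rewrite inE => /asboolP h; rewrite inE; apply/asboolP.
have mm := le_trans m2t tm.
apply: heavy_le mm h.
Qed.

End Potential.

(** * Circuits and the initial estimates *)

Section Circuits.
Context {R : realType} {m n : nat} (A : 'M[R]_(m, n)).
Implicit Types (S C : {set 'I_n}) (g : 'cV[R]_n).

(** A dependence among the columns in [S] is a kernel vector supported in [S]. *)
Lemma free_columnsP S : reflect (forall g, g \in kerspace A -> supp g \subset S -> g = 0)
  (free [seq col j A | j in S]).
Proof.
have colE' g : supp g \subset S ->
    A *m g = \sum_(i < #|S|) g (enum_val i) 0 *: (image_tuple (fun j => col j A) S)`_i.
  move=> sg; have gD : g = \sum_(i in S) g i 0 *: delta_mx i 0.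
    apply/colP => l; rewrite summxE [LHS](_ : _ = \sum_i g i 0 * (delta_mx i 0 : 'cV[R]_n) l 0).
      rewrite (bigID (mem S)) /= [X in _ + X]big1 ?addr0.
        by apply: eq_bigr => i _; rewrite [in RHS]mxE.
      move=> i iS; have /negP := contra (subsetP sg i) iS; rewrite in_supp => /negP.
      by rewrite negbK => /eqP ->; rewrite mul0r.
    rewrite (bigD1 l) //= mxE !eqxx mulr1 big1 ?addr0 // => i /negPf il.
    by rewrite mxE eq_sym il mulr0.
  rewrite {1}gD mulmx_sumr big_enum_val; apply: eq_bigr => i _.
  by rewrite -scalemxAr -colE /= nth_image.
rewrite -[[seq _ | _ in _]]/(tval (image_tuple (fun j => col j A) S)).
apply: (iffP freeP) => [H g gW sg|H k kz i].
  have gk := H (fun i => g (enum_val i) 0); apply/colP => j; rewrite mxE.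
  have [jS|jS] := boolP (j \in S); last first.
    by apply/eqP; have := contra (subsetP sg j) jS; rewrite in_supp negbK.
  rewrite -(enum_rankK_in jS jS); apply: gk.
  by rewrite -colE' //; apply/eqP; rewrite -mem_kerspace.
pose g : 'cV[R]_n := \sum_(i < #|S|) k i *: delta_mx (enum_val i) 0.
have gE j : g j 0 = \sum_(i < #|S|) k i * (j == enum_val i)%:R.
  by rewrite summxE; apply: eq_bigr => l _; rewrite !mxE andbT.
have g_val l : g (enum_val l) 0 = k l.
  rewrite gE (bigD1 l) //= eqxx mulr1 big1 ?addr0 // => l' ne.
  by rewrite (inj_eq enum_val_inj) eq_sym (negPf ne) mulr0.
have sg : supp g \subset S.
  apply/subsetP => j; rewrite in_supp gE; apply: contraNT => jS.
  rewrite big1 // => l _; case: eqP => [e|_]; last by rewrite mulr0.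
  by rewrite e enum_valP in jS.
have gW : g \in kerspace A.
  by rewrite mem_kerspace colE' // -[X in _ == X]kz; apply/eqP/eq_bigr => l _; rewrite g_val.
by rewrite -g_val (H g gW sg) mxE.
Qed.

Lemma dependent_supp g : g \in kerspace A -> g != 0 ->
  ~~ free [seq col j A | j in supp g].
Proof. by move=> gW g0; apply/free_columnsP => H; rewrite (H g) ?eqxx in g0. Qed.

Lemma circuit_vectorP C g : circuit A C ->
  circuit_vector A C g -> elementary (kerspace A) g.
Proof.
move=> /minsetP [dep minC] [gW gC].
have sg : supp g = C by [].
split=> //.
  apply: contraNneq dep => g0; apply/free_columnsP => z _.
  rewrite -sg g0 => zs; apply/eqP; rewrite -[_ == _]negbK; apply/negP => /neq0_supp [i].
  by rewrite -in_supp => /(subsetP zs); rewrite in_supp mxE eqxx.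
move=> z zW z0; rewrite sg => zC.
by rewrite (minC _ (dependent_supp zW z0) zC).
Qed.

Lemma circuit_vector_exists C : circuit A C -> exists g, circuit_vector A C g.
Proof.
move=> /minsetP [dep minC].
have [g [gW g0 sg]] : exists g, [/\ g \in kerspace A, g != 0 & supp g \subset C].
  apply: contrapT => none; move/negP: dep; apply; apply/free_columnsP => g gW sg.
  by apply/eqP; apply: contrapT => g0; apply: none; exists g; split=> //; apply/negP.
by exists g; split=> //; apply: minC => //; apply: dependent_supp.
Qed.

Lemma nonseparable_connected : (1 < n)%N -> nonseparable A -> connectedv (kerspace A).
Proof.
move=> n1 sep.
have ne i j : i != j -> exists g, [/\ elementary (kerspace A) g, g i 0 != 0 & g j 0 != 0].
  move=> /sep [C [cC iC jC]]; have [g gC] := circuit_vector_exists cC.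
  exists g; split; first exact: circuit_vectorP cC gC.
    by move: iC; case: gC => _ <-; rewrite inE.
  by move: jC; case: gC => _ <-; rewrite inE.
move=> i j; have [->|] := eqVneq i j; last exact: ne.
have : (0 < #|[set~ j]|)%N by rewrite cardsC1 card_ord; lia.
move=> /card_gt0P [l]; rewrite !inE => lj.
have [g [eg gl gj]] := ne l j lj; by exists g.
Qed.

Lemma initial_estimates_exist : nonseparable A -> exists kh, initial_estimates A kh.
Proof.
move=> sep.
have H C : exists g, circuit A C -> circuit_vector A C g.
  have [cC|nC] := boolP (circuit A C); last by exists 0.
  by have [g gC] := circuit_vector_exists cC; exists g.
have [g gP] := choice H.
exists (\matrix_(i, j) \big[Num.max/0]_(C in [set C | circuit A C] | (i \in C) && (j \in C))
                      `|g C j 0 / g C i 0|).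
exists [set C | circuit A C], g; split.
- by move=> C; rewrite inE => cC; split=> //; apply: gP.
- by move=> i j /sep [C [cC iC jC]]; exists C; rewrite inE.
- by move=> i j; rewrite mxE.
Qed.

(** Each estimate is an imbalance of an actual circuit, and a circuit of the
    family through [i] and [j] contributes reciprocal values to the two
    directions. *)
Lemma initial_estimates_sound kh : (1 < n)%N -> initial_estimates A kh ->
  sound_estimates A kh.
Proof.
move=> n1 [F [g [FP cover khE]]].
have gE C : C \in F -> elementary (kerspace A) (g C).
  by move=> /FP [cC gC]; apply: circuit_vectorP gC.
have gi C i : C \in F -> i \in C -> g C i 0 != 0.
  by move=> /FP [_ [_ gC]]; rewrite -[in i \in _]gC inE.
have kh_ge C i j : C \in F -> i \in C -> j \in C -> `|g C j 0 / g C i 0| <= kh i j.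
  by move=> CF iC jC; rewrite khE; apply: le_bigmax_cond; rewrite CF iC jC.
split=> i j.
  rewrite khE; apply/andP; split; first exact: bigmax_ge_id.
  apply: bigmax_le => [|C /andP[CF /andP[iC jC]]]; first exact: kap_ge0.
  by apply: kap_ge; [exact: gE | exact: gi].
have [C [CF iC jC]] : exists C, [/\ C \in F, i \in C & j \in C].
  have [->|] := eqVneq i j; last exact: cover.
  have : (0 < #|[set~ j]|)%N by rewrite cardsC1 card_ord; lia.
  move=> /card_gt0P [l]; rewrite !inE => /cover [C [CF _ jC]]; by exists C.
apply: le_trans (ler_pM _ _ (kh_ge C i j CF iC jC) (kh_ge C j i CF jC iC)) => //.
by rewrite -normrM mulrA divfK ?gi // divff ?normr1 // gi.
Qed.

End Circuits.

(** * Counting iterations *)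

Section Count.
Context {R : realType} {m n : nat} (A : 'M[R]_(m, n)) (b : 'cV[R]_m) (c : 'cV[R]_n).
Hypotheses (n3 : (2 < n)%N) (Aconn : connectedv (kerspace A)).
Variables (e : 'cV[R]_n) (K0 : R).
Hypotheses (e0 : forall i, 0 < e i 0) (K01 : 1 <= K0)
  (eK : forall i j, kap (kerspace A) i j * e j 0 / e i 0 <= K0).
Implicit Types (w : pdpoint R m n) (kh : 'M[R]_n).

Local Notation mu := Defs.mu.
Local Notation M := (Mbound (n := n) K0).
Local Notation potential := (potential A b c K0).
Local Notation finds := (finds_optimum_from A b c).

Let q : R := 1 - 1 / (8 * Num.sqrt n%:R).

Let n0 : (0 < n)%N. Proof. exact: leq_trans n3. Qed.

Lemma rate_bounds : 0 <= q /\ q <= 1.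
Proof.
have [r1 _] := sqrt_n (R := R) n3; have h : 0 <= 1 / (8 * Num.sqrt (n%:R : R)).
  by rewrite divr_ge0 // mulr_ge0 //; lra.
have : 1 / (8 * Num.sqrt n%:R) <= 1 :> R by rewrite ler_pdivrMr ?mulr_gt0 //; lra.
by rewrite /q; split; lra.
Qed.

Lemma run k w kh N : neighborhood A b c (1 / 8) w -> sound_estimates A kh ->
  (forall w' kh', neighborhood A b c (1 / 8) w' -> sound_estimates A kh' ->
    mu w' <= q ^+ k * mu w -> finds N w' kh') ->
  finds (k + N) w kh.
Proof.
have [q0 q1] := rate_bounds.
elim: k w kh => [|k IH] w kh Nw khS H; first by apply: H => //; rewrite expr0 mul1r.
apply: (iteration_progress n3 Aconn e0 K01 eK Nw khS) => // v kh' Nv khS' le _.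
apply: IH => // w' kh2 Nw' khS2 le'; apply: H => //; apply: le_trans le' _.
by rewrite exprSr -mulrA ler_wpM2l // exprn_ge0.
Qed.

(** After the pinned pair (i, j) of an iteration, T |S| further iterations raise
    the potential by |S| - 1. If less than that is missing to the maximum, the
    run must stop before; the summand T n covers this last phase. *)
Lemma finds_from_potential (T D N : nat) w kh : q ^+ T * M ^+ 8 <= 1 ->
  neighborhood A b c (1 / 8) w -> sound_estimates A kh ->
  (n * n * levels (n := n) - potential (mu w) <= D)%N ->
  ((2 * T + 1) * D + T * n + 1 <= N)%N -> finds N w kh.
Proof.
move=> qT; have [q0 q1] := rate_bounds.
have M1 : 1 < M by have := Mbound_ge n3 K01; have := natn_ge3 (R := R) n3; lra.
elim/ltn_ind: D N w kh => D IH [|N'] w kh Nw khS De Ne; first by rewrite addn1 in Ne.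
apply: (iteration_progress n3 Aconn e0 K01 eK Nw khS) => // v kh' Nv khS' le [S [i [j pin]]].
have rn : (#|S| <= n)%N by rewrite -[X in (_ <= X)%N]card_ord max_card.
have Tr : (T * #|S| <= T * n)%N by rewrite leq_mul2l rn orbT.
have mw0 : 0 <= mu w by rewrite ltW // (mu_gt0 n0 Nw.1).
have vw : mu v <= mu w by apply: le_trans le _; rewrite ler_piMl.
rewrite -(subnKC (_ : (T * #|S| <= N')%N)); last by move: Tr Ne; clear; lia.
apply: run => // w2 kh2 N2 khS2 le2.
have small : mu w2 * M ^+ (8 * #|S|) <= mu v.
  apply: le_trans (ler_wpM2r (exprn_ge0 _ (ltW (lt_trans ltr01 M1))) le2) _.
  rewrite mulrAC exprM exprM -exprMn ler_piMl ?(ltW (mu_gt0 n0 Nv.1)) //.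
  by rewrite exprn_ile1 // mulr_ge0 ?exprn_ge0 //; lra.
have [r1 gain] := pinned_gain n3 Aconn K01 Nw pin vw N2 small.
have bound := potential_max A b c K0 (mu w2).
have rD : (#|S|.-1 <= D)%N by move: bound gain De; clear; lia.
apply: (IH (D - #|S|.-1)%N) => //; [by move: r1 rD; clear; lia | by move: gain De; clear; lia |].
move: r1 rD Tr Ne; clear; case: #|S| => // -[//|r] _ /= rD Tr Ne.
have eD := subnK rD; move: (D - r.+1)%N eD => D' eD; rewrite -eD in Ne.
move: Tr Ne; clear => Tr Ne; nia.
Qed.

End Count.

Section Bounds.
Local Notation expR := sequences.expR.
Context {R : realType} {n : nat} (n3 : (2 < n)%N).
Variables (chi : R) (chi0 : 0 <= chi).

Local Notation X := (chi + n%:R).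
Local Notation M := (Mbound (n := n) (chi + 1)).
Local Notation s := (Num.sqrt n%:R).

Let n0 : (0 < n)%N. Proof. exact: leq_trans n3. Qed.

Lemma ln2_ge : 1 / 2 <= ln 2 :> R.
Proof.
rewrite -ler_expR lnK ?posrE //.
have := expR_ge1Dx (- (1 / 2) : R); rewrite expRN => h.
have e0 := expR_gt0 (1 / 2 : R).
have : expR (1 / 2) * (1 - 1 / 2) <= 1 :> R.
  by rewrite -[leRHS](divff (lt0r_neq0 e0)) ler_pM2l.
lra.
Qed.

Lemma ln_ge (x : R) : 2 <= x -> 1 / 2 <= ln x.
Proof. by move=> h; apply: le_trans ln2_ge _; rewrite ler_ln ?posrE //; lra. Qed.

(** M is a product of powers of n, chi + 1 and constants, each at most a power of
    chi + n; the exponent 69 is their sum. *)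
Lemma ln_Mbound : ln M <= 69 * ln X.
Proof.
have nR := natn_ge3 (R := R) n3; have g0 := gamma_gt0 (R := R) n0; have c0 := chi0.
have X3 : 3 <= X by lra.
have X0 : 0 < X by lra.
have chi1 : 0 <= chi + 1 by lra.
have M0 : 0 < M.
  rewrite /Mbound; apply: mulr_gt0.
    by apply: mulr_gt0 => //; rewrite exprn_gt0 //; lra.
  by rewrite exprn_gt0 // divr_gt0 ?sigma_gt0 //; lra.
rewrite mulr_natl -lnXn // ler_ln ?posrE ?exprn_gt0 //.
have Q_eq : (chi + 1) / (gamma R n / n%:R) = 2 ^+ 13 * n%:R ^+ 6 * (chi + 1).
  have gs := gamma_small (R := R) n0.
  have -> : gamma R n = (2 ^+ 13 * n%:R ^+ 5)^-1.
    by apply: (mulIf (x := 2 ^+ 13 * n%:R ^+ 5)); rewrite ?gs ?mulVf // mulf_neq0 ?expf_neq0 // gt_eqF //; lra.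
  have : (2 : R) ^+ 13 != 0 by rewrite expf_neq0 // pnatr_eq0.
  by move: (2 ^+ 13) => z z0; field; rewrite z0 gt_eqF //; lra.
have p6 : 500 <= X ^+ 6.
  apply: (@le_trans _ _ (3 ^+ 6)); first by rewrite -natrX ler_nat.
  by rewrite lerXn2r // nnegrE; lra.
have p9 : 2 ^+ 13 <= X ^+ 13 by rewrite lerXn2r // ?nnegrE //; lra.
have nX k : n%:R ^+ k <= X ^+ k by rewrite lerXn2r // ?nnegrE //; lra.
have cX : chi + 1 <= X by lra.
have Xp k : 0 <= X ^+ k by rewrite exprn_ge0 //; lra.
have np k : 0 <= n%:R ^+ k :> R by rewrite exprn_ge0.
rewrite /Mbound Q_eq (_ : X ^+ 69 = X ^+ 6 * X ^+ 3 * (X ^+ 13 * X ^+ 6 * X) ^+ 3); last first.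
  by rewrite -!exprD -exprSr -exprM -exprD.
have p13 : 0 <= (2 : R) ^+ 13 by rewrite exprn_ge0.
have q0 := mulr_ge0 (mulr_ge0 p13 (np 6)) chi1.
apply: ler_pM (mulr_ge0 (ler0n _ _) (np 3)) (exprn_ge0 _ q0) (ler_pM (ler0n _ _) (np 3) p6 (nX 3)) _.
apply: lerXn2r; rewrite ?nnegrE //; first exact: mulr_ge0 (mulr_ge0 (Xp 13) (Xp 6)) (ltW X0).
exact: ler_pM (mulr_ge0 p13 (np 6)) chi1 (ler_pM p13 (np 6) p9 (nX 6)) cX.
Qed.

(** The factor 64 is 8 * 8: each iteration takes at least 1 / (8 sqrt n) from the
    logarithm of the duality measure, and 8 ln M has to be taken. *)
Lemma rate_power (T : nat) : 64 * s * ln M <= T%:R -> 1 <= M ->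
  (1 - 1 / (8 * s)) ^+ T * M ^+ 8 <= 1.
Proof.
move=> TL M1; have [r1 _] := sqrt_n (R := R) n3.
have y1 : 1 / (8 * s) <= 1 :> R by rewrite ler_pdivrMr ?mulr_gt0 //; lra.
have M0 : 0 < M by lra.
have h1 : (1 - 1 / (8 * s)) ^+ T <= expR (- (1 / (8 * s)) * T%:R) :> R.
  rewrite expRM_natr lerXn2r ?nnegrE ?expR_ge0 ?expR_ge1Dx //; lra.
rewrite -[M in M ^+ 8](lnK (x := M)) ?posrE // -expRM_natr.
apply: le_trans (ler_wpM2r (expR_ge0 _) h1) _.
rewrite -expRD -[leRHS]expR0 ler_expR.
have -> : - (1 / (8 * s)) * T%:R + ln M * 8 = (64 * s * ln M - T%:R) / (8 * s).
  by field; rewrite gt_eqF //; lra.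
by rewrite pmulr_lle0 ?subr_le0 // invr_gt0 mulr_gt0 //; lra.
Qed.

Lemma iteration_count (T : nat) : T%:R <= 64 * s * ln M + 1 ->
  ((2 * T + 1) * (n * n * levels (n := n)) + T * n + 1)%:R
    <= 10 * 100 ^+ 2 * (n%:R `^ (5 / 2) * ln n%:R * ln X).
Proof.
move=> TL; have [r1 rn] := sqrt_n (R := R) n3; have nR := natn_ge3 (R := R) n3.
have lM := ln_Mbound.
have L := ln_ge (_ : 2 <= X); have l := ln_ge (_ : 2 <= n%:R).
have {}L : 1 / 2 <= ln X by apply: L; have c0 := chi0; lra.
have {}l : 1 / 2 <= ln n%:R :> R by apply: l; lra.
have -> : n%:R `^ (5 / 2) = n%:R ^+ 2 * s :> R.
  rewrite (_ : 5 / 2 = 2%:R + 2^-1); last by field.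
  by rewrite powRD ?powR_mulrn ?powR12_sqrt //; apply/implyP => _; rewrite gt_eqF //; lra.
have lev : (levels (n := n))%:R <= 6 * ln n%:R :> R.
  have /andP[le _] := trunc_log_bounds (isT : (1 < 2)%N) n0.
  have : (trunc_log 2 n)%:R * ln 2 <= ln n%:R :> R.
    by rewrite mulr_natl -lnXn // ler_ln ?posrE ?exprn_gt0 ?ltr0n // -natrX ler_nat.
  have h2 := ln2_ge; have : 0 <= (trunc_log 2 n)%:R * (ln 2 - 1 / 2) :> R.
    by rewrite mulr_ge0 // subr_ge0.
  by rewrite mulrBr => h3 h4; rewrite /levels -addn2 natrD; lra.
have lev0 : 0 <= (levels (n := n))%:R :> R by [].
move: lev0 lev lM L l TL; rewrite !(natrD, natrM).
move: (levels (n := n))%:R (ln X) (ln n%:R) (ln M) (T%:R : R) => v L l lM t vpos lev hM hL hl ht.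
have sL : 1 / 2 <= s * L.
  by apply: (le_trans hL); apply: ler_peMl => //; lra.
have st : 64 * s * lM <= 64 * 69 * (s * L).
  by rewrite (_ : 64 * 69 * _ = 64 * s * (69 * L)) ?ler_wpM2l //; [lra | ring].
have t1 : t <= 45 * 100 * (s * L) by lra.
have t2 : 2%:R * t + 1 <= 90 * 100 * (s * L) by lra.
set u := s * L in sL t1 t2 *.
have n1 : 1 <= n%:R ^+ 2 :> R by rewrite expr2; apply: mulr_ege1; lra.
set z : R := n%:R ^+ 2 * l.
have z1 : n%:R <= 2 * z.
  rewrite /z mulrCA -[leLHS]mulr1; apply: ler_pM => //; last lra.
  by rewrite expr2 ler_peMr //; lra.
have v0 : n%:R * n%:R * v <= 6 * z.
  by rewrite /z mulrCA -expr2; apply: ler_wpM2l => //; lra.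
have uz : 3 / 4 <= u * z.
  by rewrite (_ : 3 / 4 = 1 / 2 * (3 / 2)); [apply: ler_pM; lra | field].
have a1 : (2%:R * t + 1) * (n%:R * n%:R * v) <= 90 * 100 * u * (6 * z).
  have c0 : 0 <= 90 * 100 * u by lra.
  apply: (@le_trans _ _ (90 * 100 * u * (n%:R * n%:R * v))); last exact: ler_wpM2l.
  by apply: ler_wpM2r => //; rewrite !mulr_ge0.
have a2 : t * n%:R <= 45 * 100 * u * (2 * z).
  apply: (@le_trans _ _ (45 * 100 * u * n%:R)); first by rewrite ler_wpM2r.
  by rewrite ler_wpM2l //; lra.
have -> : n%:R ^+ 2 * s * l * L = u * z by rewrite /u /z; ring.
lra.
Qed.

End Bounds.

Theorem theorem3p16 (R : realType) :
  exists K : R,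
    forall (m n : nat) (A : 'M[R]_(m, n)) (b : 'cV[R]_m) (c : 'cV[R]_n)
           (w0 : pdpoint R m n),
      row_free A -> (3 <= n)%N -> nonseparable A ->
      neighborhood A b c (1 / 8) w0 ->
      exists N : nat,
        N%:R <= K * (n%:R `^ (5 / 2) * ln n%:R * ln (chibar_star A + n%:R)) /\
        lp_solve_finds_optimum A b c w0 N.
Proof.
exists (10 * 100 ^+ 2) => m n A b c w0 Afree n3 sep N0.
have n1 : (1 < n)%N by apply: leq_trans n3.
have conn := nonseparable_connected n1 sep.
have [chi0 [e [e0 eK]]] := balancing_weights Afree conn.
have K1 : 1 <= chibar_star A + 1 by lra.
set M := Mbound (n := n) (chibar_star A + 1).
have M1 : 1 <= M by have := Mbound_ge n3 K1; have := natn_ge3 (R := R) n3; rewrite -/M; lra.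
have x0 : 0 <= 64 * Num.sqrt n%:R * ln M.
  by rewrite mulr_ge0 ?ln_ge0 // mulr_ge0 ?sqrtr_ge0.
have /andP[T1 T2] := truncn_itv x0.
set T := (Num.truncn (64 * Num.sqrt n%:R * ln M)).+1 in T2.
exists ((2 * T + 1) * (n * n * levels (n := n)) + T * n + 1)%N; split.
  by apply: (iteration_count n3 chi0); rewrite /T -[(Num.truncn _).+1%:R]natr1 lerD2r.
split; first exact: initial_estimates_exist sep.
move=> kh /(initial_estimates_sound n1) khS.
apply: (finds_from_potential n3 conn e0 K1 eK _ N0 khS (leq_subr _ _) (leqnn _)).
by have := rate_power n3 (ltW T2) M1.
Qed.
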